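(* Let $p$ be an odd prime and let $M=\mathbb Q^*\cap\mathbb Z_{(p)}\hookrightarrow\mathbb Z_{(p)}$ be the canonical log-structure (the multiplicative monoid of nonzero elements). For every $n\ge1$ the $p$-typical de Rham-Witt complex $W_\bullet\Omega^*_{(\mathbb Z_{(p)},M)}$ has the following structure, where $V^i(1)$ denotes $V^i([1]_{n-i})$ at level $n$. (i) As additive groups, $$W_n\Omega^0_{(\mathbb Z_{(p)},M)}=W_n\Omega^0_{\mathbb Z_{(p)}}\cong W_n(\mathbb Z_{(p)}),\qquad W_n\Omega^1_{(\mathbb Z_{(p)},M)}=W_n\Omega^1_{\mathbb Z_{(p)}}\oplus\mathbb Z/p^n\mathbb Z\cdot d\log[p]_n,$$ and $W_n\Omega^i_{(\mathbb Z_{(p)},M)}=0$ for all $i\ge2$, where $W_n\Omega^0_{\mathbb Z_{(p)}}=\bigoplus_{i=0}^{n-1}\mathbb Z_{(p)}\cdot V^i(1)$ and $W_n\Omega^1_{\mathbb Z_{(p)}}=\bigoplus_{i=1}^{n-1}\mathbb Z/p^i\mathbb Z\cdot dV^i(1)$. (ii) The product is given by $V^i(1)V^j(1)=p^iV^j(1)$ if $i\le j$; $V^i(1)\,dV^j(1)=p^i\,dV^j(1)$ if $i<j$ and $=0$ if $i\ge j$; and, for $i\ge1$, $$V^i[1]_{n-i}\,d\log[p]_n=\begin{cases}3^i\,d\log[3]_n+3^{i-1}dV^i[1]_{n-i}+3^i\,dV^{i+1}[1]_{n-i-1}, & p=3,\\ p^i\,d\log[p]_n+p^{i-1}dV^i[1]_{n-i},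 & p\ge5.\end{cases}$$ (iii) The operators $F$ and $V$ satisfy $FV^i(1)=pV^{i-1}(1)$ and $FdV^i(1)=dV^{i-1}(1)$ for $i\ge1$, $V(V^i(1))=V^{i+1}(1)$, $V(dV^i(1))=p\,dV^{i+1}(1)$, and $$F(d\log[p]_n)=d\log[p]_{n-1},\qquad V(d\log[p]_n)=\begin{cases}3\,d\log[3]_{n+1}+dV[1]_n+3\,dV^2[1]_{n-1}, & p=3,\\ p\,d\log[p]_{n+1}+dV[1]_n, & p\ge5.\end{cases}$$ (Here $[1]_m=0$ for $m\le0$.)
   Context: All rings are commutative and unital; graded rings are graded-commutative, i.e. $xy=(-1)^{|x||y|}yx$. For a ring $A$, $W_n(A)$ is the ring of $p$-typical Witt vectors of length $n$ ($W_n(A)=0$ for $n\le 0$), with restriction $R$, Frobenius $F:W_n(A)\to W_{n-1}(A)$, Verschiebung $V:W_{n}(A)\to W_{n+1}(A)$, and Teichmüller map $[a]_n=(a,0,\dots,0)$. A pro-object is a sequence $\{X_n\}_{n\in\mathbb Z}$ with maps $R:X_n\to X_{n-1}$; a strict map is a family of maps commuting with $R$. For $p$ odd and a $\mathbb Z_{(p)}$-algebra $A$, a $p$-typical Witt complex over $A$ (Hesselholt–Madsen) consists of: a graded-commutative pro-graded ring $\{E_n^*,R\}_{n\in\mathbb Z}$ with $E_n^*=0$ for $n\le0$; a strict map of pro-rings $\lambda:W_\bullet(A)\to E^0_\bullet$; a strict map of pro-graded rings $F:E^*_\bullet\to E^*_{\bullet-1}$ with $\lambda F=F\lambda$; a strict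 map of pro-graded abelian groups $V:E^*_\bullet\to E^*_{\bullet+1}$ with $V(x)y=V(xF(y))$, $\lambda V=V\lambda$, $FV=p$; and a strict derivation $d:E^*_\bullet\to E^{*+1}_\bullet$, $d(xy)=d(x)y+(-1)^{|x|}x\,d(y)$, with $dd=0$, $FdV=d$, and $Fd\lambda([a]_n)=\lambda([a]_{n-1})^{p-1}d\lambda([a]_{n-1})$ for all $a\in A$. Morphisms are maps of pro-graded rings commuting with $\lambda,d,F,V$. The initial object is the $p$-typical de Rham-Witt complex $W_\bullet\Omega^*_A$. A log-ring $(R,M)$ is a ring $R$ with a map of monoids $\alpha:M\to R$ (multiplication on $R$), a pre-log structure. A derivation of $(R,M)$ into an $R$-module $N$ is a derivation $D:R\to N$ with a monoid map $D\log:M\to N$ such that $\alpha(a)D\log(a)=D\alpha(a)$. The log-ring $(W_n(R),M)$ has structure map $a\mapsto[\alpha(a)]_n$. A $p$-typical Witt complex over $(R,M)$ is a $p$-typical Witt complex $E$ over $R$ with a monoid $M_E$, pre-log structures $\alpha_n:M_E\to E_n^0$, monoid maps $d\log:M_E\to E_n^1$ (compatible with $R$) such that $(d,d\log)$ is a derivation of $(E_n^0,M_E)$, and an extension of $\lambda$ to a strict map of pro-log-rings $(W_\bullet(R),M)\to(E_\bullet^0,M_E)$, such that $R\circ\alpha_n=\alpha_{n-1}$, and $d(d\log[a]_n)=0$, $F\,d\log[a]_n=d\log[a]_{n-1}$ for all $a\in M$; here $d\log[a]_n$ is $d\log$ of the image of $a$ in $M_E$. Morphisms are morphisms of Witt complexes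 with a compatible monoid map, commuting with $d\log$. The initial object is the $p$-typical de Rham-Witt complex $W_\bullet\Omega^*_{(R,M)}$. The map $\lambda$ is suppressed from the notation. *)

(* Defs.v *)
From HB Require Import structures.
From mathcomp Require Import all_boot all_order all_algebra.
From mathcomp Require Import mpoly zify ring.

Set Implicit Arguments.
Unset Strict Implicit.
Unset Printing Implicit Defensive.

Import Order.TTheory GRing.Theory Num.Theory.

Local Open Scope ring_scope.

Section Ghost.
Variables (A : comNzRingType) (p : nat).

Definition ghost (k : nat) (a : nat -> A) : A :=
  \sum_(i < k.+1) p%:R ^+ i * a i ^+ (p ^ (k - i)).

Definition dvdr_nat (d : nat) (x : A) : Prop := exists y, x = d%:R * y.

Lemma dvdr_nat0 d : dvdr_nat d 0.
Proof. by exists 0; rewrite mulr0. Qed.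

Lemma dvdr_natD d x y : dvdr_nat d x -> dvdr_nat d y -> dvdr_nat d (x + y).
Proof. by case=> [u ->] [v ->]; exists (u + v); rewrite mulrDr. Qed.

Lemma dvdr_natN d x : dvdr_nat d x -> dvdr_nat d (- x).
Proof. by case=> [u ->]; exists (- u); rewrite mulrN. Qed.

Lemma dvdr_natB d x y : dvdr_nat d x -> dvdr_nat d y -> dvdr_nat d (x - y).
Proof. by move=> dx dy; apply/dvdr_natD/dvdr_natN. Qed.

Lemma dvdr_natMl d x y : dvdr_nat d x -> dvdr_nat d (y * x).
Proof. by case=> [u ->]; exists (y * u); rewrite mulrCA. Qed.

Lemma dvdr_natBD d x x' y y' :
  dvdr_nat d (x - x') -> dvdr_nat d (y - y') -> dvdr_nat d (x + y - (x' + y')).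
Proof. by move=> dx dy; rewrite opprD addrACA; apply: dvdr_natD. Qed.

Lemma dvdr_natBM d x x' y y' :
  dvdr_nat d (x - x') -> dvdr_nat d (y - y') -> dvdr_nat d (x * y - x' * y').
Proof.
move=> dx dy; have -> : x * y - x' * y' = y * (x - x') + x' * (y - y') by ring.
by apply: dvdr_natD; apply: dvdr_natMl.
Qed.

Lemma dvdr_nat_sum d (I : Type) (r : seq I) (P : pred I) (f : I -> A) :
  (forall i, P i -> dvdr_nat d (f i)) -> dvdr_nat d (\sum_(i <- r | P i) f i).
Proof.
move=> H; elim/big_ind: _ => //; [exact: dvdr_nat0 | exact: dvdr_natD].
Qed.

Lemma dvdr_nat_pow (d j m : nat) (x : A) :
  dvdr_nat (d ^ m) x -> dvdr_nat (d ^ (j + m)) (d%:R ^+ j * x).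
Proof.
by case=> [u ->]; exists u; rewrite -natrX mulrA -natrM expnD.
Qed.

Lemma dvdr_nat_trans d e x : (d %| e)%N -> dvdr_nat e x -> dvdr_nat d x.
Proof.
case/dvdnP=> k -> [u ->]; exists (k%:R * u).
by rewrite natrM mulrA [_%:R * _]mulrC.
Qed.

Hypothesis p_pr : prime p.

Lemma dvdr_nat_freshman (x y : A) :
  dvdr_nat p ((x + y) ^+ p - (x ^+ p + y ^+ p)).
Proof.
have := prime_gt1 p_pr; have := p_pr; case: (p) => // q q_pr lt1q.
rewrite exprDn big_ord_recl big_ord_recr /= subn0 bin0 expr0 mulr1 mulr1n.
rewrite /bump /= add1n subnn binn expr0 mul1r mulr1n.
set t := \sum_(_ < _) _; rewrite (_ : _ - _ = t); last by ring.
apply: dvdr_nat_sum => -[i lti] _ /=; rewrite add1n.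
apply: (@dvdr_nat_trans _ 'C(q.+1, i.+1)); first by rewrite prime_dvd_bin.
by eexists; rewrite -mulr_natl.
Qed.

Lemma dvdr_nat_expp j (x y : A) :
  dvdr_nat (p ^ j.+1) (x - y) -> dvdr_nat (p ^ j.+2) (x ^+ p - y ^+ p).
Proof.
case=> u /eqP; rewrite subr_eq => /eqP ->.
rewrite [_ * u + y]addrC exprDn big_ord_recl /= subn0 expr0 mulr1 bin0 mulr1n.
set t := \sum_(_ < _) _; rewrite (_ : _ - _ = t); last by ring.
apply: dvdr_nat_sum => -[i lti] _ /=; rewrite /bump /= add1n.
rewrite exprMn -mulr_natl mulrA [_%:R * _]mulrC -!mulrA; apply: dvdr_natMl.
rewrite mulrA; case: i lti => [|i] lti.
  by exists u; rewrite bin1 !expr1 -natrM -expnS.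
rewrite -natrX -natrM; move: (u ^+ i.+2) => w.
exists ('C(p, i.+2)%:R * (p ^ (j.+1 * i.+2 - j.+2))%:R * w).
rewrite !mulrA -!natrM -expnM; congr (_%:R * _).
rewrite mulnAC -expnD subnKC 1?mulnC //.
by rewrite mulSn mulnS; lia.
Qed.

Lemma dvdr_nat_exppX m (x y : A) :
  dvdr_nat p (x - y) -> dvdr_nat (p ^ m.+1) (x ^+ (p ^ m) - y ^+ (p ^ m)).
Proof.
move=> H; elim: m => [|m IH]; first by rewrite expn1 expn0 !expr1.
have E (z : A) : z ^+ (p ^ m.+1) = (z ^+ (p ^ m)) ^+ p by rewrite expnSr exprM.
by rewrite !E; apply: dvdr_nat_expp.
Qed.

Lemma ghostS k a :
  ghost k.+1 a = \sum_(i < k.+1) p%:R ^+ i * a i ^+ (p ^ (k.+1 - i))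
                 + p%:R ^+ k.+1 * a k.+1.
Proof. by rewrite /ghost big_ord_recr /= subnn expn0 expr1. Qed.

Lemma eq_ghost k (a b : nat -> A) :
  (forall i, (i <= k)%N -> a i = b i) -> ghost k a = ghost k b.
Proof. by move=> ab; apply: eq_bigr => -[i lti] _ /=; rewrite ab. Qed.

Lemma ghost_inj n (a b : nat -> A) :
  (forall x : A, p%:R * x = 0 -> x = 0) ->
  (forall i, (i < n)%N -> ghost i a = ghost i b) ->
  forall i, (i < n)%N -> a i = b i.
Proof.
move=> preg gab; elim/ltn_ind=> i IH ltin.
have: ghost i a = ghost i b by apply: gab.
have pXreg j x y : p%:R ^+ j * x = p%:R ^+ j * y -> x = y :> A.
  elim: j x y => [|j IHj] x y; first by rewrite expr0 !mul1r.
  rewrite exprS -!mulrA => /eqP; rewrite -subr_eq0 -mulrBr => /eqP /preg /eqP.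
  by rewrite subr_eq0 => /eqP /IHj.
rewrite /ghost !big_ord_recr /= subnn expn0 !expr1.
rewrite (eq_bigr (fun j : 'I_i => p%:R ^+ j * b j ^+ (p ^ (i - j)))).
  by move/addrI/pXreg.
by move=> j _; rewrite (IH j (ltn_ord j) (ltn_trans (ltn_ord j) ltin)).
Qed.

Lemma ghost_frob_lift (phi : {rmorphism A -> A}) k a :
  (forall x, dvdr_nat p (phi x - x ^+ p)) ->
  dvdr_nat (p ^ k.+1)
    (phi (ghost k a) - \sum_(i < k.+1) p%:R ^+ i * a i ^+ (p ^ (k.+1 - i))).
Proof.
move=> phiP; rewrite raddf_sum -sumrB; apply: dvdr_nat_sum => -[i lti] _ /=.
rewrite ltnS in lti.
have -> : a i ^+ (p ^ (k.+1 - i)) = (a i ^+ p) ^+ (p ^ (k - i)).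
  by rewrite subSn // expnS exprM.
rewrite rmorphM !rmorphXn /= rmorph_nat -mulrBr.
rewrite (_ : k.+1 = i + (k - i).+1)%N; last lia.
by apply: dvdr_nat_pow; apply: dvdr_nat_exppX.
Qed.

Section FrobLift.
Variable phi : {rmorphism A -> A}.

Let lifts x := dvdr_nat p (phi x - x ^+ p).

Lemma frob_liftD x y : lifts x -> lifts y -> lifts (x + y).
Proof.
move=> Sx Sy; rewrite /lifts rmorphD.
have := dvdr_natB (dvdr_natD Sx Sy) (dvdr_nat_freshman x y).
set u := (_ ^+ p); set v := (_ ^+ p); set w := (_ ^+ p).
by congr (dvdr_nat p _); ring.
Qed.

Lemma frob_liftM x y : lifts x -> lifts y -> lifts (x * y).
Proof.
move=> Sx Sy; rewrite /lifts rmorphM exprMn.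
have := dvdr_natD (dvdr_natMl (phi y) Sx) (dvdr_natMl (x ^+ p) Sy).
set u := (_ ^+ p); set v := (_ ^+ p).
by congr (dvdr_nat p _); ring.
Qed.

Lemma frob_liftN x : lifts x -> lifts (- x).
Proof.
move=> Sx; have := dvdr_natB (dvdr_nat_freshman x (- x)) Sx.
rewrite subrr expr0n gtn_eqF ?prime_gt0 // /lifts rmorphN.
set u := (_ ^+ p); set v := (_ ^+ p).
by congr (dvdr_nat p _); rewrite /=; ring.
Qed.

End FrobLift.

End Ghost.

Lemma rmorph_ghost (A B : comNzRingType) (h : {rmorphism A -> B}) p k a :
  h (ghost p k a) = ghost p k (h \o a).
Proof.
rewrite raddf_sum; apply: eq_bigr => i _ /=.
by rewrite rmorphM !rmorphXn rmorph_nat.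
Qed.

Section Universal.
Variable m : nat.
Implicit Types (P Q : {mpoly int[m]}).

Definition mpoly_divz (P : {mpoly int[m]}) (d : nat) : {mpoly int[m]} :=
  \sum_(e <- msupp P) (P@_e %/ d)%Z *: 'X_[e].

(* The sequence a with ghost p k a = g k for all k, solved recursively; the
   quotients are exact for the g used below (lemma [witt_solveP]). *)
Fixpoint witt_solve_seq (p : nat) (g : nat -> {mpoly int[m]}) (k : nat) :=
  if k is k'.+1 then
    let s := witt_solve_seq p g k' in
    rcons s (mpoly_divz
      (g k' - \sum_(i < k') p%:R ^+ i * s`_i ^+ (p ^ (k' - i))) (p ^ k'))
  else [::].

Definition witt_solve p g k : {mpoly int[m]} := (witt_solve_seq p g k.+1)`_k.

Lemma mpoly_divzK P d : (0 < d)%N -> dvdr_nat d P -> d%:R * mpoly_divz P d = P.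
Proof.
move=> d_gt0 [Q defP]; rewrite /mpoly_divz mulr_sumr [RHS]mpolyE.
apply: eq_bigr => e _; rewrite -mpolyC_nat mul_mpolyC scalerA natz.
congr (_ *: _); rewrite mulrC divzK //.
by rewrite defP -mpolyC_nat mcoeffCM natz dvdz_mulr.
Qed.

Lemma size_witt_solve_seq p g k : size (witt_solve_seq p g k) = k.
Proof. by elim: k => //= k IH; rewrite size_rcons IH. Qed.

Lemma nth_witt_solve_seq p g k i :
  (i < k)%N -> (witt_solve_seq p g k)`_i = witt_solve p g i.
Proof.
elim: k => // k IH; rewrite ltnS leq_eqVlt => /predU1P[->//|ltik].
by rewrite /= nth_rcons size_witt_solve_seq ltik IH.
Qed.

Lemma witt_solveE p g k : witt_solve p g k =
  mpoly_divz (g k - \sum_(i < k) p%:R ^+ i * witt_solve p g i ^+ (p ^ (k - i)))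
             (p ^ k).
Proof.
rewrite /witt_solve /= nth_rcons size_witt_solve_seq ltnn eqxx.
by congr (mpoly_divz (_ - _) _); apply: eq_bigr => i _; rewrite nth_witt_solve_seq.
Qed.

Variables (p : nat) (p_pr : prime p).

Definition mfrob : {rmorphism {mpoly int[m]} -> {mpoly int[m]}} :=
  mmap (@mpolyC m int) (fun i => 'X_i ^+ p).

Lemma mfrobP P : dvdr_nat p (mfrob P - P ^+ p).
Proof.
pose S Q := dvdr_nat p (mfrob Q - Q ^+ p).
have p_gt0 := prime_gt0 p_pr.
have SD := @frob_liftD _ _ p_pr mfrob; have SM := @frob_liftM _ p mfrob.
have SN := @frob_liftN _ _ p_pr mfrob.
have S0 : S 0 by rewrite /S rmorph0 expr0n gtn_eqF // subrr; apply: dvdr_nat0.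
have S1 : S 1 by rewrite /S rmorph1 expr1n subrr; apply: dvdr_nat0.
have SC (c : int) : S c%:MP.
  elim: c => [|k IH|k IH]; first by rewrite mpolyC0.
  - by rewrite -addn1 PoszD mpolyCD mpolyC1; apply: SD.
  - rewrite -addn1 PoszD opprD mpolyCD; apply: SD => //.
    by rewrite mpolyCN; apply/SN; rewrite mpolyC1.
have SX e : S 'X_[e].
  rewrite mpolyXE_id; elim/big_ind: _ => // i _; elim: (e i) => [|k IH].
    by rewrite expr0.
  rewrite exprS; apply: SM => //.
  by rewrite /S /= mmapX mmap1U subrr; apply: dvdr_nat0.
rewrite -/(S P); elim/mpolyind: P => [|c e Q _ _ SQ]; first exact: S0.
apply: SD; last exact: SQ.
by rewrite -mul_mpolyC; apply: SM; [apply: SC | apply: SX].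
Qed.

Lemma mpolyint_reg (P : {mpoly int[m]}) : p%:R * P = 0 -> P = 0.
Proof.
move/eqP; rewrite mulf_eq0 => /predU1P[|/eqP//].
move/(congr1 (fun P : {mpoly int[m]} => P@_0)).
rewrite mcoeff0 -mpolyC_nat mcoeffC eqxx mulr1 => /eqP.
by rewrite pnatr_eq0 gtn_eqF // prime_gt0.
Qed.

Lemma witt_solveP (g : nat -> {mpoly int[m]}) :
  (forall k, dvdr_nat (p ^ k.+1) (mfrob (g k) - g k.+1)) ->
  forall k, ghost p k (witt_solve p g) = g k.
Proof.
move=> gP; have p_gt0 := prime_gt0 p_pr.
have main k : dvdr_nat (p ^ k)
    (g k - \sum_(i < k) p%:R ^+ i * witt_solve p g i ^+ (p ^ (k - i))) ->
    ghost p k (witt_solve p g) = g k.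
  move=> D; rewrite /ghost big_ord_recr /= subnn expn0 expr1.
  rewrite [witt_solve p g k]witt_solveE -natrX mpoly_divzK ?expn_gt0 ?p_gt0 //.
  by rewrite addrC subrK.
elim=> [|k IH]; apply: main.
  by exists (g 0%N); rewrite big_ord0 subr0 expn0 mul1r.
have := dvdr_natB (ghost_frob_lift p_pr k (witt_solve p g) mfrobP) (gP k).
by rewrite IH opprB addrCA addrAC subrr add0r.
Qed.

Lemma mfrob_ghost k (a : nat -> {mpoly int[m]}) :
  dvdr_nat (p ^ k.+1) (mfrob (ghost p k a) - ghost p k.+1 a).
Proof.
have := ghost_frob_lift p_pr k a mfrobP.
have D : dvdr_nat (p ^ k.+1) (- (p%:R ^+ k.+1 * a k.+1)).
  by apply/dvdr_natN; exists (a k.+1); rewrite natrX.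
by move/dvdr_natD/(_ D); rewrite ghostS opprD addrA.
Qed.

End Universal.

Definition witt (p : nat) (p_pr : prime p) (n : nat) (A : comNzRingType) : Type :=
  n.-tuple A.

Section WittOps.
Variables (p : nat) (p_pr : prime p).
Local Notation W := (witt p_pr).

(* Every operation is given by the integral polynomials with prescribed ghost
   components g, evaluated at v; see [ghost_wittN], [ghost_wittD], [ghost_wittM],
   [ghost_wittF] and [witt_identity]. *)
Definition witt_eval (A : comNzRingType) m n (g : nat -> {mpoly int[m]})
    (v : 'I_m -> A) : W n A :=
  [tuple mmap intr v (witt_solve p g i) | i < n].

Definition genX n : nat -> {mpoly int[n]} := nth 0 [tuple 'X_i | i < n].
Definition genXl n : nat -> {mpoly int[n + n]} :=
  nth 0 [tuple 'X_(lshift n i) | i < n].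
Definition genXr n : nat -> {mpoly int[n + n]} :=
  nth 0 [tuple 'X_(rshift n i) | i < n].

Section Ops.
Variables (A : comNzRingType).

Definition wghost n k (a : W n A) : A := ghost p k (nth 0 a).

Definition witt_zero n : W n A := [tuple 0 | _ < n].

Definition teich n (x : A) : W n A :=
  [tuple if i == 0%N :> nat then x else 0 | i < n].

Definition witt_opp n (a : W n A) : W n A :=
  witt_eval n (fun k => - ghost p k (@genX n)) (tnth a).

Definition witt_add n (a b : W n A) : W n A :=
  witt_eval n (fun k => ghost p k (@genXl n) + ghost p k (@genXr n))
            (tnth [tuple of a ++ b]).

Definition witt_mul n (a b : W n A) : W n A :=
  witt_eval n (fun k => ghost p k (@genXl n) * ghost p k (@genXr n))
            (tnth [tuple of a ++ b]).

Definition wittR n (a : W n.+1 A) : W n A := [tuple a`_i | i < n].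

Definition wittF n (a : W n.+1 A) : W n A :=
  witt_eval n (fun k => ghost p k.+1 (@genX n.+1)) (tnth a).

Definition wittV n (a : W n A) : W n.+1 A := [tuple of 0 :: a].

End Ops.

Section Ghosts.
Variables (A : comNzRingType) (n : nat).
Implicit Types a b : W n A.

Lemma ghost_witt_eval m (g : nat -> {mpoly int[m]}) (v : 'I_m -> A) k :
  (forall k, dvdr_nat (p ^ k.+1) (mfrob m p (g k) - g k.+1)) -> (k < n)%N ->
  wghost k (witt_eval n g v) = mmap intr v (g k).
Proof.
move=> gP ltkn; rewrite -[in RHS](witt_solveP p_pr gP k) rmorph_ghost.
apply: eq_ghost => i leik; have ltin := leq_ltn_trans leik ltkn.
by rewrite -[i]/(val (Ordinal ltin)) nth_mktuple.
Qed.

Lemma mmap_genX a k : mmap intr (tnth a) (genX n k) = nth 0 a k.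
Proof.
have [ltkn|lenk] := ltnP k n; last by rewrite /genX !nth_default ?size_tuple ?rmorph0.
rewrite -[k]/(val (Ordinal ltkn)) /genX nth_mktuple mmapX mmap1U.
by rewrite (tnth_nth 0).
Qed.

Lemma mmap_genXl a b k : mmap intr (tnth [tuple of a ++ b]) (genXl n k) = nth 0 a k.
Proof.
have [ltkn|lenk] := ltnP k n; last by rewrite /genXl !nth_default ?size_tuple ?rmorph0.
rewrite -[k]/(val (Ordinal ltkn)) /genXl nth_mktuple mmapX mmap1U.
by rewrite tnth_lshift (tnth_nth 0).
Qed.

Lemma mmap_genXr a b k : mmap intr (tnth [tuple of a ++ b]) (genXr n k) = nth 0 b k.
Proof.
have [ltkn|lenk] := ltnP k n; last by rewrite /genXr !nth_default ?size_tuple ?rmorph0.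
rewrite -[k]/(val (Ordinal ltkn)) /genXr nth_mktuple mmapX mmap1U.
by rewrite tnth_rshift (tnth_nth 0).
Qed.

Lemma ghost_witt0 k : wghost k (witt_zero A n) = 0.
Proof.
rewrite /wghost /ghost big1 // => i _.
have -> : nth 0 (witt_zero A n) i = 0.
  have [ltin|lein] := ltnP i n; last by rewrite nth_default ?size_tuple.
  by rewrite -[nat_of_ord i]/(val (Ordinal ltin)) nth_mktuple.
by rewrite expr0n expn_eq0 (gtn_eqF (prime_gt0 p_pr)) mulr0.
Qed.

Lemma ghost_teich k (x : A) : (k < n)%N -> wghost k (teich n x) = x ^+ (p ^ k).
Proof.
move=> ltkn.
have E j : (j < n)%N -> nth 0 (teich n x) j = if j == 0%N then x else 0.
  by move=> ltjn; rewrite -[j]/(val (Ordinal ltjn)) nth_mktuple.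
rewrite /wghost /ghost big_ord_recl big1 => [|i _]; rewrite E.
- by rewrite expr0 mul1r addr0 subn0.
- exact: leq_ltn_trans ltkn.
- by rewrite expr0n expn_eq0 (gtn_eqF (prime_gt0 p_pr)) mulr0.
- by apply: leq_trans ltkn; rewrite /= /bump ltnS; apply: ltn_ord.
Qed.

Lemma ghost_wittN k a : (k < n)%N -> wghost k (witt_opp a) = - wghost k a.
Proof.
move=> ltkn; rewrite ghost_witt_eval //; last first.
  move=> j; rewrite rmorphN -opprD; apply: dvdr_natN; exact: mfrob_ghost.
rewrite mmapN rmorph_ghost; congr (- _).
by apply: eq_ghost => i _; rewrite /= mmap_genX.
Qed.

Lemma ghost_wittD k a b :
  (k < n)%N -> wghost k (witt_add a b) = wghost k a + wghost k b.
Proof.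
move=> ltkn; rewrite ghost_witt_eval //; last first.
  by move=> j; rewrite rmorphD; apply: dvdr_natBD; apply: mfrob_ghost.
rewrite mmapD; congr (_ + _); rewrite rmorph_ghost;
  by apply: eq_ghost => i _; rewrite /= (mmap_genXl, mmap_genXr).
Qed.

Lemma ghost_wittM k a b :
  (k < n)%N -> wghost k (witt_mul a b) = wghost k a * wghost k b.
Proof.
move=> ltkn; rewrite ghost_witt_eval //; last first.
  by move=> j; rewrite rmorphM; apply: dvdr_natBM; apply: mfrob_ghost.
rewrite rmorphM; congr (_ * _); rewrite rmorph_ghost;
  by apply: eq_ghost => i _; rewrite /= (mmap_genXl, mmap_genXr).
Qed.

Lemma ghost_wittF k (a : W n.+1 A) :
  (k < n)%N -> wghost k (wittF a) = wghost k.+1 a.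
Proof.
move=> ltkn; rewrite ghost_witt_eval //; last first.
  move=> j; apply: (dvdr_nat_trans (dvdn_exp2l p (leqnSn j.+1))).
  exact: mfrob_ghost.
rewrite rmorph_ghost; apply: eq_ghost => i _ /=.
have [ltin|lein] := ltnP i n.+1; last by rewrite /genX !nth_default ?size_tuple ?rmorph0.
rewrite -[i]/(val (Ordinal ltin)) /genX nth_mktuple mmapX mmap1U.
by rewrite (tnth_nth 0).
Qed.

Lemma ghost_wittV k (a : W n A) : wghost k.+1 (wittV a) = p%:R * wghost k a.
Proof.
rewrite /wghost /ghost big_ord_recl /= expr0n expn_eq0 (gtn_eqF (prime_gt0 p_pr)).
rewrite mulr0 add0r mulr_sumr; apply: eq_bigr => i _.
by rewrite /bump /= add1n subSS exprS mulrA.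
Qed.

Lemma witt_ext (a b : W n A) :
  (forall x : A, p%:R * x = 0 -> x = 0) ->
  (forall k, (k < n)%N -> wghost k a = wghost k b) -> a = b.
Proof.
move=> preg gab; apply: eq_from_tnth => i; rewrite !(tnth_nth 0).
exact: (ghost_inj preg gab).
Qed.

End Ghosts.

Definition witt_map (A B : comNzRingType) (h : A -> B) n (a : W n A) : W n B :=
  map_tuple h a.

Section Naturality.
Variables (A B : comNzRingType) (h : {rmorphism A -> B}) (n : nat).

Lemma witt_map_eval m (g : nat -> {mpoly int[m]}) (v : 'I_m -> A) (w : 'I_m -> B) :
  h \o v =1 w -> witt_map h (witt_eval n g v) = witt_eval n g w.
Proof.
move=> hvw; apply: eq_from_tnth => i; rewrite tnth_map !tnth_mktuple.
rewrite /mmap rmorph_sum; apply: eq_bigr => e _; rewrite rmorphM rmorph_int.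
congr (_ * _); rewrite /mmap1 rmorph_prod; apply: eq_bigr => j _.
by rewrite rmorphXn -hvw.
Qed.

Lemma witt_map0 : witt_map h (witt_zero A n) = witt_zero B n.
Proof. by apply: eq_from_tnth => i; rewrite tnth_map !tnth_mktuple rmorph0. Qed.

Lemma witt_map_teich x : witt_map h (teich n x) = teich n (h x).
Proof.
apply: eq_from_tnth => i; rewrite tnth_map !tnth_mktuple.
by case: ifP => // _; rewrite rmorph0.
Qed.

Lemma witt_mapN (a : W n A) : witt_map h (witt_opp a) = witt_opp (witt_map h a).
Proof. by apply: witt_map_eval => i; rewrite tnth_map. Qed.

Let map_cat (a b : W n A) :
  h \o tnth [tuple of a ++ b] =1 tnth [tuple of witt_map h a ++ witt_map h b].
Proof.
move=> i /=; rewrite !(tnth_nth 0) /= -map_cat (nth_map 0) //.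
by rewrite size_cat !size_tuple.
Qed.

Lemma witt_mapD (a b : W n A) :
  witt_map h (witt_add a b) = witt_add (witt_map h a) (witt_map h b).
Proof. exact: witt_map_eval. Qed.

Lemma witt_mapM (a b : W n A) :
  witt_map h (witt_mul a b) = witt_mul (witt_map h a) (witt_map h b).
Proof. exact: witt_map_eval. Qed.

End Naturality.

Let wittE := (witt_mapD, witt_mapM, witt_mapN, witt_map0, witt_map_teich).
Let ghostE := (ghost_wittD, ghost_wittM, ghost_wittN, ghost_witt0, ghost_teich).

(* An identity between natural operations on Witt vectors holds as soon as it
   holds on ghost components. *)
Lemma witt_identity n (f g : forall A, W n A -> W n A -> W n A -> W n A) :
  (forall (A B : comNzRingType) (h : {rmorphism A -> B}) a b c,
     witt_map h (f A a b c) = f B (witt_map h a) (witt_map h b) (witt_map h c)) ->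
  (forall (A B : comNzRingType) (h : {rmorphism A -> B}) a b c,
     witt_map h (g A a b c) = g B (witt_map h a) (witt_map h b) (witt_map h c)) ->
  (forall (A : comNzRingType) a b c k, (k < n)%N ->
     wghost k (f A a b c) = wghost k (g A a b c)) ->
  forall (A : comNzRingType) a b c, f A a b c = g A a b c.
Proof.
move=> fN gN fgP A a b c.
pose B := {mpoly int[n + n + n]}; pose v := tnth [tuple of (a ++ b) ++ c].
pose h : {rmorphism B -> A} := mmap intr v.
pose a' : W n B := [tuple 'X_(lshift n (lshift n i)) | i < n].
pose b' : W n B := [tuple 'X_(lshift n (rshift n i)) | i < n].
pose c' : W n B := [tuple 'X_(rshift (n + n) i) | i < n].
have ha : witt_map h a' = a.
  apply: eq_from_tnth => i; rewrite tnth_map tnth_mktuple /= mmapX mmap1U.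
  by rewrite /v !tnth_lshift.
have hb : witt_map h b' = b.
  apply: eq_from_tnth => i; rewrite tnth_map tnth_mktuple /= mmapX mmap1U.
  by rewrite /v tnth_lshift tnth_rshift.
have hc : witt_map h c' = c.
  apply: eq_from_tnth => i; rewrite tnth_map tnth_mktuple /= mmapX mmap1U.
  by rewrite /v tnth_rshift.
rewrite -ha -hb -hc -fN -gN; congr (witt_map h _).
by apply: witt_ext; [exact: mpolyint_reg | exact: fgP].
Qed.

Section Ring.
Variables (n : nat) (A : comNzRingType).
Implicit Types a b c : W n A.

Lemma witt_addA : associative (@witt_add A n).
Proof.
move=> a b c; apply: (@witt_identity n
  (fun B x y z => witt_add x (witt_add y z))
  (fun B x y z => witt_add (witt_add x y) z)
  _ _ _ A a b c) => *; rewrite ?wittE ?ghostE //.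
by rewrite addrA.
Qed.

Lemma witt_addC : commutative (@witt_add A n).
Proof.
move=> a b; apply: (@witt_identity n (fun B x y z => witt_add x y)
  (fun B x y z => witt_add y x) _ _ _ A a b a) => *; rewrite ?wittE ?ghostE //.
by rewrite addrC.
Qed.

Lemma witt_add0 : left_id (witt_zero A n) (@witt_add A n).
Proof.
move=> a; apply: (@witt_identity n (fun B x y z => witt_add (witt_zero B n) x)
  (fun B x y z => x) _ _ _ A a a a) => *; rewrite ?wittE ?ghostE //.
by rewrite add0r.
Qed.

Lemma witt_addN : left_inverse (witt_zero A n) (@witt_opp A n) (@witt_add A n).
Proof.
move=> a; apply: (@witt_identity n (fun B x y z => witt_add (witt_opp x) x)
  (fun B x y z => witt_zero B n) _ _ _ A a a a) => *; rewrite ?wittE ?ghostE //.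
by rewrite addNr.
Qed.

Lemma witt_mulA : associative (@witt_mul A n).
Proof.
move=> a b c; apply: (@witt_identity n
  (fun B x y z => witt_mul x (witt_mul y z))
  (fun B x y z => witt_mul (witt_mul x y) z)
  _ _ _ A a b c) => *; rewrite ?wittE ?ghostE //.
by rewrite mulrA.
Qed.

Lemma witt_mulC : commutative (@witt_mul A n).
Proof.
move=> a b; apply: (@witt_identity n (fun B x y z => witt_mul x y)
  (fun B x y z => witt_mul y x) _ _ _ A a b a) => *; rewrite ?wittE ?ghostE //.
by rewrite mulrC.
Qed.

Lemma witt_mul1 : left_id (teich n (1 : A)) (@witt_mul A n).
Proof.
move=> a; apply: (@witt_identity n (fun B x y z => witt_mul (teich n 1) x)
  (fun B x y z => x) _ _ _ A a a a) => *; rewrite ?wittE ?rmorph1 ?ghostE //.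
by rewrite expr1n mul1r.
Qed.

Lemma witt_mulD : left_distributive (@witt_mul A n) (@witt_add A n).
Proof.
move=> a b c; apply: (@witt_identity n
  (fun B x y z => witt_mul (witt_add x y) z)
  (fun B x y z => witt_add (witt_mul x z) (witt_mul y z))
  _ _ _ A a b c) => *; rewrite ?wittE ?ghostE //.
by rewrite mulrDl.
Qed.

HB.instance Definition _ := Choice.on (W n A).
HB.instance Definition _ := GRing.isZmodule.Build (W n A)
  witt_addA witt_addC witt_add0 witt_addN.
HB.instance Definition _ := GRing.Zmodule_isComPzRing.Build (W n A)
  witt_mulA witt_mulC witt_mul1 witt_mulD.

End Ring.
End WittOps.

Definition in_Zloc (p : nat) : {pred rat} := fun x => coprime p `|denq x|.

Lemma in_ZlocP p x :
  reflect (exists2 d : nat, coprime p d & x * d%:R \is a Num.int) (x \in in_Zloc p).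
Proof.
apply: (iffP idP) => [xp|[d pd xd]].
  exists `|denq x|%N; first exact: xp.
  by rewrite -[_%:R]/(`|denq x|%:Z%:~R) absz_denq -numqE rpred_int.
have [z zE] := intrP xd.
rewrite unfold_in; apply: coprime_dvdr pd.
have : (denq x %| numq x * d%:Z)%Z.
  apply/dvdzP; exists z; apply: (@intr_inj rat).
  by rewrite !rmorphM /= numqE -zE mulrAC.
rewrite dvdzE abszM Gauss_dvdr //.
by rewrite coprime_sym coprime_num_den.
Qed.

Lemma in_Zloc_subring p : subring_closed (in_Zloc p).
Proof.
split=> [|x y /in_ZlocP[d pd xd] /in_ZlocP[e pe ye]|
        x y /in_ZlocP[d pd xd] /in_ZlocP[e pe ye]].
- by apply/in_ZlocP; exists 1%N; rewrite ?coprimen1 ?mulr1 ?rpred1.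
- apply/in_ZlocP; exists (d * e)%N; first by rewrite coprimeMr pd pe.
  have -> : (x - y) * (d * e)%:R = x * d%:R * e%:R - y * e%:R * d%:R by ring.
  by rewrite rpredB // rpredM ?rpred_nat.
- apply/in_ZlocP; exists (d * e)%N; first by rewrite coprimeMr pd pe.
  have -> : x * y * (d * e)%:R = x * d%:R * (y * e%:R) by ring.
  by rewrite rpredM.
Qed.

HB.instance Definition _ p :=
  GRing.isSubringClosed.Build rat (in_Zloc p) (in_Zloc_subring p).

Record Zloc (p : nat) := MkZloc { Zloc_val :> rat; _ : Zloc_val \in in_Zloc p }.

HB.instance Definition _ p := [isSub for @Zloc_val p].
HB.instance Definition _ p := [Choice of Zloc p by <:].
HB.instance Definition _ p := [SubChoice_isSubComNzRing of Zloc p by <:].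

Record Zloc_nz (p : nat) := MkZlocNz { Zloc_nz_val :> Zloc p; _ : Zloc_nz_val != 0 }.

HB.instance Definition _ p := [isSub for @Zloc_nz_val p].
HB.instance Definition _ p := [Choice of Zloc_nz p by <:].

Section ZlocNzMonoid.
Variable p : nat.
Implicit Types x y z : Zloc_nz p.

Lemma Zloc_mulf_neq0 x y : (x : Zloc p) * (y : Zloc p) != 0.
Proof.
rewrite -val_eqE rmorphM /= mulf_neq0 //; first by case: x.
by case: y.
Qed.

Definition Zloc_nz_mul x y : Zloc_nz p := MkZlocNz (Zloc_mulf_neq0 x y).
Definition Zloc_nz_one : Zloc_nz p := MkZlocNz (oner_neq0 _).

Lemma Zloc_nz_mulA : associative Zloc_nz_mul.
Proof. by move=> x y z; apply: val_inj; rewrite /= mulrA. Qed.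

Lemma Zloc_nz_mulC : commutative Zloc_nz_mul.
Proof. by move=> x y; apply: val_inj; rewrite /= mulrC. Qed.

Lemma Zloc_nz_mul1 : left_id Zloc_nz_one Zloc_nz_mul.
Proof. by move=> x; apply: val_inj; rewrite /= mul1r. Qed.

Lemma Zloc_nz_mulr1 : right_id Zloc_nz_one Zloc_nz_mul.
Proof. by move=> x; rewrite Zloc_nz_mulC Zloc_nz_mul1. Qed.

HB.instance Definition _ :=
  isMonoid.Build (Zloc_nz p) Zloc_nz_mulA Zloc_nz_mul1 Zloc_nz_mulr1.
End ZlocNzMonoid.

HB.mixin Record Monoid_isCommutative M of Monoid M := {
  mulmC : commutative (fun x y : M => (x * y)%g)
}.

#[short(type="comMonoidType")]
HB.structure Definition ComMonoid := {M of Monoid_isCommutative M & Monoid M}.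

HB.instance Definition _ p :=
  Monoid_isCommutative.Build (Zloc_nz p) (@Zloc_nz_mulC p).

(* Non-negatively graded rings, graded internally: [hpart i] is the subgroup of
   elements of degree i, and the ring is the direct sum of these subgroups. *)
Record gradedRing := GradedRing {
  gr_ring :> pzRingType;
  hpart : nat -> gr_ring -> Prop;
  hpart0 : forall i, hpart i 0;
  hpartB : forall i x y, hpart i x -> hpart i y -> hpart i (x - y);
  hpart1 : hpart 0 1;
  hpartM : forall i j x y, hpart i x -> hpart j y -> hpart (i + j)%N (x * y);
  hpart_span : forall x, exists m (c : nat -> gr_ring),
    (forall i, hpart i (c i)) /\ x = \sum_(i < m) c i;
  hpart_direct : forall m (c : nat -> gr_ring),
    (forall i, hpart i (c i)) -> \sum_(i < m) c i = 0 ->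
    forall i, (i < m)%N -> c i = 0;
  hpart_comm : forall i j x y, hpart i x -> hpart j y ->
    x * y = (-1) ^+ (i * j)%N * (y * x)
}.

(* The standard definition for p odd and A a Z_(p)-algebra, a property of A that
   the axioms do not mention. Pro-objects are indexed by the levels n : nat, level
   0 being zero; the levels n < 0 are zero as well and carry no information. *)
Record witt_complex (p : nat) (p_pr : prime p) (A : comNzRingType) := WittComplex {
  wc_ring :> nat -> gradedRing;
  wc_R : forall n, {rmorphism wc_ring n.+1 -> wc_ring n};
  wc_lambda : forall n, {rmorphism witt p_pr n A -> wc_ring n};
  wc_F : forall n, {rmorphism wc_ring n.+1 -> wc_ring n};
  wc_V : forall n, {additive wc_ring n -> wc_ring n.+1};
  wc_d : forall n, {additive wc_ring n -> wc_ring n};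

  wc_level0 : forall x : wc_ring 0%N, x = 0;
  wc_R_homog : forall n i x, hpart i x -> hpart i (wc_R n x);

  wc_lambda_hpart : forall n a, hpart 0 (wc_lambda n a);
  wc_lambdaR : forall n a, wc_R n (wc_lambda n.+1 a) = wc_lambda n (wittR a);

  wc_F_homog : forall n i x, hpart i x -> hpart i (wc_F n x);
  wc_FR : forall n x, wc_R n (wc_F n.+1 x) = wc_F n (wc_R n.+1 x);
  wc_lambdaF : forall n a, wc_F n (wc_lambda n.+1 a) = wc_lambda n (wittF a);

  wc_V_homog : forall n i x, hpart i x -> hpart i (wc_V n x);
  wc_VR : forall n x, wc_R n.+1 (wc_V n.+1 x) = wc_V n (wc_R n x);
  wc_VF : forall n x y, wc_V n x * y = wc_V n (x * wc_F n y);
  wc_lambdaV : forall n a, wc_V n (wc_lambda n a) = wc_lambda n.+1 (wittV a);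
  wc_FV : forall n x, wc_F n (wc_V n x) = x *+ p;

  wc_d_hpart : forall n i x, hpart i x -> hpart i.+1 (wc_d n x);
  wc_dR : forall n x, wc_R n (wc_d n.+1 x) = wc_d n (wc_R n x);
  wc_dM : forall n i x y, hpart i x ->
    wc_d n (x * y) = wc_d n x * y + (-1) ^+ i * (x * wc_d n y);
  wc_dd : forall n x, wc_d n (wc_d n x) = 0;
  wc_FdV : forall n x, wc_F n (wc_d n.+1 (wc_V n x)) = wc_d n x;
  wc_Fdteich : forall n (a : A),
    wc_F n (wc_d n.+1 (wc_lambda n.+1 (teich p_pr n.+1 a))) =
    wc_lambda n (teich p_pr n a) ^+ p.-1 * wc_d n (wc_lambda n (teich p_pr n a))
}.

Arguments wc_R {p p_pr A} E n : rename.
Arguments wc_lambda {p p_pr A} E n : rename.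
Arguments wc_F {p p_pr A} E n : rename.
Arguments wc_V {p p_pr A} E n : rename.
Arguments wc_d {p p_pr A} E n : rename.

Record wc_hom (p : nat) (p_pr : prime p) (A : comNzRingType)
    (E E' : witt_complex p_pr A) := WcHom {
  wc_map :> forall n, {rmorphism E n -> E' n};
  wc_map_hpart : forall n i x, hpart i x -> hpart i (wc_map n x);
  wc_mapR : forall n x, wc_map n (wc_R E n x) = wc_R E' n (wc_map n.+1 x);
  wc_map_lambda : forall n a, wc_map n (wc_lambda E n a) = wc_lambda E' n a;
  wc_mapd : forall n x, wc_map n (wc_d E n x) = wc_d E' n (wc_map n x);
  wc_mapF : forall n x, wc_map n (wc_F E n x) = wc_F E' n (wc_map n.+1 x);
  wc_mapV : forall n x, wc_map n.+1 (wc_V E n x) = wc_V E' n (wc_map n x)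
}.

Definition is_de_Rham_Witt (p : nat) (p_pr : prime p) (A : comNzRingType)
    (E : witt_complex p_pr A) : Prop :=
  forall E' : witt_complex p_pr A, exists f : wc_hom E E',
    forall (g : wc_hom E E') n x, g n x = f n x.

Record prelogRing := PrelogRing {
  plr_ring :> comNzRingType;
  plr_mon : comMonoidType;
  plr_alpha : plr_mon -> plr_ring;
  plr_alpha1 : plr_alpha 1%g = 1;
  plr_alphaM : forall a b, plr_alpha (a * b)%g = plr_alpha a * plr_alpha b
}.

Record log_witt_complex (p : nat) (p_pr : prime p) (L : prelogRing) :=
    LogWittComplex {
  lwc_wc :> witt_complex p_pr L;
  lwc_mon : comMonoidType;
  lwc_alpha : forall n, lwc_mon -> lwc_wc n;
  lwc_dlog : forall n, lwc_mon -> lwc_wc n;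
  lwc_mu : plr_mon L -> lwc_mon;

  lwc_alpha_hpart : forall n a, hpart 0 (lwc_alpha n a);
  lwc_alpha1 : forall n, lwc_alpha n 1%g = 1;
  lwc_alphaM : forall n a b,
    lwc_alpha n (a * b)%g = lwc_alpha n a * lwc_alpha n b;
  lwc_alphaR : forall n a, wc_R lwc_wc n (lwc_alpha n.+1 a) = lwc_alpha n a;

  lwc_dlog_hpart : forall n a, hpart 1 (lwc_dlog n a);
  lwc_dlog1 : forall n, lwc_dlog n 1%g = 0;
  lwc_dlogM : forall n a b, lwc_dlog n (a * b)%g = lwc_dlog n a + lwc_dlog n b;
  lwc_dlogR : forall n a, wc_R lwc_wc n (lwc_dlog n.+1 a) = lwc_dlog n a;
  lwc_dlogP : forall n a,
    lwc_alpha n a * lwc_dlog n a = wc_d lwc_wc n (lwc_alpha n a);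

  lwc_mu1 : lwc_mu 1%g = 1%g;
  lwc_muM : forall a b, lwc_mu (a * b)%g = (lwc_mu a * lwc_mu b)%g;
  lwc_muP : forall n a,
    lwc_alpha n (lwc_mu a) = wc_lambda lwc_wc n (teich p_pr n (plr_alpha a));

  lwc_ddlog : forall n a, wc_d lwc_wc n (lwc_dlog n (lwc_mu a)) = 0;
  lwc_Fdlog : forall n a,
    wc_F lwc_wc n (lwc_dlog n.+1 (lwc_mu a)) = lwc_dlog n (lwc_mu a)
}.

Arguments lwc_alpha {p p_pr L} E n a : rename.
Arguments lwc_dlog {p p_pr L} E n a : rename.
Arguments lwc_mu {p p_pr L} E a : rename.

Record lwc_hom (p : nat) (p_pr : prime p) (L : prelogRing)
    (E E' : log_witt_complex p_pr L) := LwcHom {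
  lwc_map :> wc_hom E E';
  lwc_map_mon : lwc_mon E -> lwc_mon E';
  lwc_map_mon1 : lwc_map_mon 1%g = 1%g;
  lwc_map_monM : forall a b,
    lwc_map_mon (a * b)%g = (lwc_map_mon a * lwc_map_mon b)%g;
  lwc_map_mu : forall a, lwc_map_mon (lwc_mu E a) = lwc_mu E' a;
  lwc_map_alpha : forall n a,
    lwc_map n (lwc_alpha E n a) = lwc_alpha E' n (lwc_map_mon a);
  lwc_map_dlog : forall n a,
    lwc_map n (lwc_dlog E n a) = lwc_dlog E' n (lwc_map_mon a)
}.

Definition is_log_de_Rham_Witt (p : nat) (p_pr : prime p) (L : prelogRing)
    (E : log_witt_complex p_pr L) : Prop :=
  forall E' : log_witt_complex p_pr L, exists f : lwc_hom E E',
    forall g : lwc_hom E E',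
      (forall n x, g n x = f n x) /\
      (forall a, lwc_map_mon g a = lwc_map_mon f a).

Definition Zloc_log (p : nat) : prelogRing :=
  @PrelogRing (Zloc p) (Zloc_nz p) (@Zloc_nz_val p) erefl (fun _ _ => erefl).

Lemma Zloc_natp_neq0 p : prime p -> p%:R != 0 :> Zloc p.
Proof.
move=> p_pr; rewrite -val_eqE rmorph_nat /= pnatr_eq0.
by rewrite (gtn_eqF (prime_gt0 p_pr)).
Qed.

Definition Zloc_nz_p (p : nat) (p_pr : prime p) : plr_mon (Zloc_log p) :=
  MkZlocNz (Zloc_natp_neq0 p_pr).

(* V^i(1) at level n, i.e. V^i applied to the unit of level n - i; it is 0 when
   i >= n. *)
Fixpoint wc_Vone (p : nat) (p_pr : prime p) (A : comNzRingType)
    (E : witt_complex p_pr A) (n i : nat) : E n :=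
  match i, n return E n with
  | 0, _ => 1
  | _.+1, 0 => 0
  | i'.+1, n'.+1 => wc_V E n' (wc_Vone E n' i')
  end.

Definition dlogp (p : nat) (p_pr : prime p)
    (E : log_witt_complex p_pr (Zloc_log p)) (n : nat) : E n :=
  lwc_dlog E n (lwc_mu E (Zloc_nz_p p_pr)).

(* S is the internal direct sum of the subgroups generated by the g i, and
   these are cyclic of order q i. *)
Definition cyclic_direct_sum (G : zmodType) (S : G -> Prop) (I : finType)
    (g : I -> G) (q : I -> nat) : Prop :=
  (forall x, S x <-> exists c : I -> int, x = \sum_i g i *~ c i) /\
  (forall c : I -> int,
     \sum_i g i *~ c i = 0 <-> forall i, ((q i)%:Z %| c i)%Z).

(* Main.v *)
(** The degree 1 part of either complex is computed by explicit models. In ghost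
    components x, an element of W_n(Z_(p)) is \sum_j c_j V^j(1) with
    c_j = (x_j - x_(j-1)) / p^j; on the summand Z/p^j of dV^j(1) it acts through x_j, and
    its differential is \sum_j c_j dV^j(1). In the logarithmic model the summand
    Z/p^n dlog[p] is glued on through the derivation a |-> a dlog[p] - x_(n-1) dlog[p].
    Both square-zero extensions of W_n(Z_(p)) are Witt complexes. Conversely the relations
    between the dV^j(1) hold in every Witt complex over Z_(p), and the formula for
    V(dlog[p]) follows in every log Witt complex from [p] dlog[p] = d[p] and the
    coordinates of [p], by induction on the level. So the models map to every (log) Witt
    complex, and the initial objects are retracts of the models. *)

From HB Require Import structures.
Require Import Defs.
From mathcomp Require Import all_boot all_order all_algebra ring_quotient.
From mathcomp Require Import zify ring.

Set Implicit Arguments.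
Unset Strict Implicit.
Unset Printing Implicit Defensive.

Import Order.TTheory GRing.Theory Num.Theory.
Local Open Scope ring_scope.

(** * Arithmetic of Z_(p) *)

(** The axioms give no direct access to V(dlog[p]). The ghost components of [p] are p^(p^k), so its
    i-th coordinate is p c_i - c_(i-1) with c_i = p^(p^i - i - 1) and c_(-1) = 0. Summation by parts
    turns [p] dlog[p] into the sum of the c_i V^i(p dlog[p] - V(dlog[p])), whose term i = 0 is the
    unknown. On the other side, dV^i(1) is killed by p^i, so d[p] keeps only the coordinates not
    divisible by p^i. Since 2i <= p^(i-1) for i >= 3, what survives is -dV(1) and, because c_1 =
    p^(p-2), also -3 dV^2(1) when p = 3. This is the origin of the case distinction. The bound on
    the order of dlog[p] then follows: V^n vanishes at level n, and the closed formula for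
    V^n(dlog[p]) reads p^n dlog[p] = 0. That the order is not smaller is visible only in the model.
    There a coefficient of dV^j(1) makes sense only modulo p^j, so the axioms become congruences
    between divided differences of ghost components. They rest on Dwork's congruence, that is, on
    Fermat's little theorem. *)

Section ZlocArith.
Variables (p : nat) (p_pr : prime p).
Local Notation Z := (Zloc p).
Implicit Types (x y z : Z) (k : nat).

Let p_gt0 : (0 < p)%N := prime_gt0 p_pr.

Lemma ratp_neq0 k : p%:R ^+ k != 0 :> rat.
Proof. by rewrite expf_neq0 // pnatr_eq0 -lt0n. Qed.

Lemma mulpX_inj k : injective (fun x => p%:R ^+ k * x).
Proof.
move=> x y /(congr1 val); rewrite !rmorphM !rmorphXn !rmorph_nat /=.
by move/(mulfI (ratp_neq0 k))/val_inj.
Qed.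

Lemma Zloc_natp_reg x : p%:R * x = 0 -> x = 0.
Proof. by move=> px; apply: (@mulpX_inj 1); rewrite expr1 px mulr0. Qed.

Definition pdvd k : {pred Z} := fun x => val x / p%:R ^+ k \in in_Zloc p.

Definition pquo k x : Z := insubd 0 (val x / p%:R ^+ k).

Lemma pquoK k x : x \in pdvd k -> p%:R ^+ k * pquo k x = x.
Proof.
move=> kx; apply: val_inj; rewrite rmorphM rmorphXn rmorph_nat /=.
by rewrite [Zloc_val (pquo k x)]insubdK // mulrC divfK // ratp_neq0.
Qed.

Lemma pdvdP k x : reflect (exists y, x = p%:R ^+ k * y) (x \in pdvd k).
Proof.
apply: (iffP idP) => [kx|[y ->]]; first by exists (pquo k x); rewrite pquoK.
rewrite unfold_in rmorphM rmorphXn rmorph_nat /= mulrC mulKf ?ratp_neq0 //.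
exact: valP.
Qed.

Lemma pdvd_dvdr_nat k x : dvdr_nat (p ^ k) x <-> x \in pdvd k.
Proof. by split=> [[y ->]|/pdvdP[y ->]]; [apply/pdvdP|]; exists y; rewrite natrX. Qed.

Lemma pdvd_zmod_closed k : zmod_closed (pdvd k).
Proof.
split=> [|x y]; rewrite ![_ \in pdvd k]unfold_in ?rmorph0 ?mul0r.
  exact: rpred0.
by move=> kx ky; rewrite rmorphB mulrBl; apply: rpredB.
Qed.

HB.instance Definition _ k :=
  GRing.isZmodClosed.Build Z (pdvd k) (pdvd_zmod_closed k).

Lemma pdvdMr k x y : x \in pdvd k -> x * y \in pdvd k.
Proof. by case/pdvdP=> z ->; apply/pdvdP; exists (z * y); rewrite mulrA. Qed.

Lemma pdvdMl k x y : y \in pdvd k -> x * y \in pdvd k.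
Proof. by move=> ky; rewrite mulrC pdvdMr. Qed.

Lemma pdvd0 x : x \in pdvd 0.
Proof. by apply/pdvdP; exists x; rewrite mul1r. Qed.

Lemma pdvdX k l x : (k <= l)%N -> x \in pdvd l -> x \in pdvd k.
Proof.
move=> lekl /pdvdP[z ->]; apply/pdvdP; exists (p%:R ^+ (l - k) * z).
by rewrite mulrA -exprD subnKC.
Qed.

Lemma pdvd_pX k l x : (k <= l)%N -> p%:R ^+ l * x \in pdvd k.
Proof. by move=> lekl; apply: pdvdX lekl _; apply/pdvdP; exists x. Qed.

Lemma Zloc_unit d : coprime p d -> exists y : Z, d%:R * y = 1.
Proof.
move=> pd; have d_neq0 : d%:R != 0 :> rat.
  rewrite pnatr_eq0; apply: contraL pd => /eqP ->.
  by rewrite /coprime gcdn0 neq_ltn prime_gt1 ?orbT.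
have dP : d%:R^-1 \in in_Zloc p.
  by apply/in_ZlocP; exists d; rewrite // mulVf // rpred1.
by exists (MkZloc dP); apply: val_inj; rewrite rmorphM rmorph_nat rmorph1 /= mulfV.
Qed.

Lemma Zloc_frac x : exists (m : int) (d : nat), coprime p d /\ x * d%:R = m%:~R.
Proof.
have [d pd /intrP[m xd]] := in_ZlocP _ _ (valP x).
by exists m, d; split=> //; apply: val_inj; rewrite rmorphM rmorph_nat rmorph_int.
Qed.

(** The identity of Z_(p) lifts Frobenius, which is what Dwork's congruence needs. Integers are
    reached by induction, Frobenius being additive modulo p, and fractions by clearing a denominator
    prime to p. *)
Lemma Zloc_fermat x : dvdr_nat p (x - x ^+ p).
Proof.
pose S z := dvdr_nat p (z - z ^+ p).
have SD := @frob_liftD _ _ p_pr (idfun : {rmorphism Z -> Z}).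
have SN := @frob_liftN _ _ p_pr (idfun : {rmorphism Z -> Z}).
have S1 : S 1 by rewrite /S expr1n subrr; apply: dvdr_nat0.
have SI (m : int) : S m%:~R.
  elim: m => [|m IH|m IH].
  - by rewrite /S expr0n gtn_eqF // subrr; apply: dvdr_nat0.
  - by rewrite -addn1 PoszD rmorphD; apply: SD.
  - by rewrite -addn1 PoszD opprD rmorphD; apply: SD => //; apply: SN.
have [m [d [pd xd]]] := Zloc_frac x; have [y dy] := Zloc_unit pd.
have := SI m; rewrite /S -xd exprMn => Sm.
have Sd : dvdr_nat p (d%:R - d%:R ^+ p : Z) := SI d.
have := dvdr_natMl y (dvdr_natB Sm (dvdr_natMl (x ^+ p) Sd)).
set u := x ^+ p; set v := d%:R ^+ p.
suff -> : y * (x * d%:R - u * v - u * (d%:R - v)) = d%:R * y * (x - u).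
  by rewrite dy mul1r.
by ring.
Qed.

(** Together with [pdvd_int] this says Z/p^k = Z_(p)/p^k. It converts between the Z_(p)-coefficients
    of the computation and the integer coefficients of cyclic groups. *)
Lemma Zloc_int_mod k x : exists c : int, x - c%:~R \in pdvd k.
Proof.
have [m [d [pd xd]]] := Zloc_frac x.
have [[u v] uv] : exists uv : nat * nat, (d * uv.1 = 1 + uv.2 * p ^ k)%N.
  case: d pd {xd} => [|d] pd.
    by move: pd; rewrite /coprime gcdn0 => /eqP p1; move: p_pr; rewrite p1.
  have pd' : coprime d.+1 (p ^ k) by rewrite coprime_sym coprimeXl.
  have [u v uv _] := egcdnP (p ^ k) (ltn0Sn d).
  by exists (u, v); move/eqP: pd' uv => -> /=; rewrite mulnC addnC.
exists (m * u%:Z); rewrite intrM -xd.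
apply/pdvdP; exists (- (x * v%:R)).
have := congr1 (fun n => n%:R : Z) uv; rewrite !natrD !natrM natrX /= => uvE.
transitivity (x - x * (d%:R * u%:R)); first by rewrite mulrA.
by rewrite uvE; ring.
Qed.

Lemma pdvd_int k (c : int) : (c%:~R \in pdvd k) = ((p ^ k)%:Z %| c)%Z.
Proof.
apply/idP/dvdzP => [/pdvdP[y cE]|[q ->]]; last first.
  by apply/pdvdP; exists q%:~R; rewrite intrM mulrC -natrX.
have [m [d [pd yd]]] := Zloc_frac y.
have cd : c * d%:Z = (p ^ k)%:Z * m.
  apply: (@intr_inj rat).
  have /(congr1 val) : c%:~R * d%:R = p%:R ^+ k * m%:~R :> Z by rewrite cE -yd mulrA.
  by rewrite !rmorphM !rmorph_int rmorphXn !rmorph_nat /= -natrX.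
apply/dvdzP; have : ((p ^ k)%:Z %| c * d%:Z)%Z by rewrite cd dvdz_mulr.
by rewrite Gauss_dvdzl // coprimezE /= coprimeXl.
Qed.

(** The triple consists of the valuation, the unit part and the inverse of the unit part. The
    boolean form lets [xchoose] pick it when dlog is defined on the model. *)
Lemma Zloc_factor_ex (x : Z) : x != 0 ->
  exists t : nat * Z * Z, [&& x == p%:R ^+ t.1.1 * t.1.2 & t.1.2 * t.2 == 1].
Proof.
move=> x_neq0; have [m [d [pd xd]]] := Zloc_frac x.
have [y dy] := Zloc_unit pd.
have xE : x = m%:~R * y by rewrite -xd -mulrA dy mulr1.
have m_gt0 : (0 < `|m|)%N.
  by rewrite absz_gt0; apply: contraNneq x_neq0 => m0; rewrite xE m0 mul0r.
have [v' pv' mE] := pfactor_coprime p_pr m_gt0.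
have [y' v'y'] := Zloc_unit pv'.
have sgE : m = (-1) ^+ (m < 0)%R * `|m|%N%:Z by rewrite [LHS]intEsign.
exists (logn p `|m|, (-1) ^+ (m < 0)%R * v'%:R * y, (-1) ^+ (m < 0)%R * y' * d%:R).
rewrite /= xE; apply/andP; split; apply/eqP.
  have -> : m%:~R = (-1) ^+ (m < 0)%R * `|m|%:R :> Z.
    by rewrite {1}sgE intrM rmorphXn rmorphN1.
  by rewrite [in LHS]mE natrM natrX; ring.
transitivity ((-1) ^+ (m < 0)%R * (-1) ^+ (m < 0)%R * (v'%:R * y') * (d%:R * y)).
  by ring.
by rewrite v'y' dy -expr2 sqrr_sign !mulr1.
Qed.

Lemma Zloc_factor_uniq v w (x x' y y' : Z) :
  x * x' = 1 -> y * y' = 1 -> p%:R ^+ v * x = p%:R ^+ w * y -> v = w /\ x = y.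
Proof.
wlog levw : v w x x' y y' / (v <= w)%N => [hw xx yy E|xx yy].
  have [vw|/ltnW wv] := leqP v w; first exact: hw vw xx yy E.
  by have [-> ->] := hw _ _ _ _ _ _ wv yy xx (esym E).
rewrite -(subnKC levw) exprD -mulrA => /mulpX_inj xE.
suff wv0 : (w - v = 0)%N by move: xE; rewrite wv0 mul1r addn0.
case: (w - v)%N xE => // k xE.
have : (1 : Z) \in pdvd 1.
  by apply/pdvdP; exists (p%:R ^+ k * y * x'); rewrite expr1 !mulrA -exprS -xE xx.
rewrite -[1]/((1 : int)%:~R) pdvd_int expn1.
by rewrite dvdzE /= dvdn1 gtn_eqF // prime_gt1.
Qed.

End ZlocArith.

(** * Ghost components and coordinates of Witt vectors *)

HB.lock Definition gh (p : nat) (p_pr : prime p) (n k : nat)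
  (a : witt p_pr n (Zloc p)) : Zloc p := wghost k a.

(* The coordinates of a in the basis V^j(1): the ghost components of V^j(1) are
   0 below j and p^j from j on. *)
HB.lock Definition wdiff (p : nat) (p_pr : prime p) (n : nat)
    (a : witt p_pr n (Zloc p)) (j : nat) : Zloc p :=
  pquo j (gh j a - if j is i.+1 then gh i a else 0).

Section WittCoordinates.
Variables (p : nat) (p_pr : prime p).
Local Notation Z := (Zloc p).
Local Notation W n := (witt p_pr n Z).
Implicit Types (n j k : nat) (c : Z).

Let preg := Zloc_natp_reg p_pr.

Section Ghosts.
Variable n : nat.
Implicit Types a b : W n.

Lemma ghD k a b : (k < n)%N -> gh k (a + b) = gh k a + gh k b.
Proof. by rewrite gh.unlock; apply: ghost_wittD. Qed.

Lemma ghN k a : (k < n)%N -> gh k (- a) = - gh k a.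
Proof. by rewrite gh.unlock; apply: ghost_wittN. Qed.

Lemma ghM k a b : (k < n)%N -> gh k (a * b) = gh k a * gh k b.
Proof. by rewrite gh.unlock; apply: ghost_wittM. Qed.

Lemma gh0 k : gh k (0 : W n) = 0.
Proof. by rewrite gh.unlock; apply: ghost_witt0. Qed.

Lemma gh1 k : (k < n)%N -> gh k (1 : W n) = 1.
Proof. by move=> ltkn; rewrite gh.unlock ghost_teich // expr1n. Qed.

Lemma ghX k a m : (k < n)%N -> gh k (a ^+ m) = gh k a ^+ m.
Proof.
move=> ltkn; elim: m => [|m IH]; first by rewrite gh1.
by rewrite !exprS ghM // IH.
Qed.

Lemma ghMn k a m : (k < n)%N -> gh k (a *+ m) = gh k a *+ m.
Proof.
move=> ltkn; elim: m => [|m IH]; first by rewrite !mulr0n gh0.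
by rewrite !mulrS ghD // IH.
Qed.

Lemma gh_ext a b : (forall k, (k < n)%N -> gh k a = gh k b) -> a = b.
Proof. by rewrite gh.unlock; apply: witt_ext preg. Qed.

(** Dwork's congruence. It holds for every k, also beyond the length, because missing components are
    read as 0. *)
Lemma dwork k a : gh k.+1 a - gh k a \in pdvd k.+1.
Proof.
have := ghost_frob_lift p_pr k (nth 0 a) (phi := idfun) (Zloc_fermat p_pr).
rewrite gh.unlock /wghost ghostS /= => /(pdvd_dvdr_nat p_pr).
set s := \sum_(_ < _) _; rewrite -rpredN opprB => D.
by rewrite addrAC rpredD // pdvd_pX.
Qed.

End Ghosts.

Lemma ghR n k (a : W n.+1) : (k < n)%N -> gh k (wittR a) = gh k a.
Proof.
move=> ltkn; rewrite gh.unlock; apply: eq_ghost => i leik.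
have ltin := leq_ltn_trans leik ltkn.
by rewrite -[i]/(val (Ordinal ltin)) nth_mktuple.
Qed.

Lemma ghV0 n (a : W n) : gh 0 (wittV a) = 0.
Proof. by rewrite gh.unlock /wghost /ghost big_ord1 /= subnn expr1 mulr0. Qed.

Lemma ghVS n k (a : W n) : gh k.+1 (wittV a) = p%:R * gh k a.
Proof. by rewrite gh.unlock; apply: ghost_wittV. Qed.

Lemma ghF n k (a : W n.+1) : (k < n)%N -> gh k (wittF a) = gh k.+1 a.
Proof. by rewrite gh.unlock; apply: ghost_wittF. Qed.

(** Converse of Dwork's congruence for constant sequences: the vector is extended by one component
    at a time, the required division by p^n being exact by Fermat. These vectors make W_n(Z_(p)) a
    Z_(p)-algebra. *)
Lemma const_ghost_ex n c :
  exists a : W n, [forall k : 'I_n, gh k a == c].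
Proof.
rewrite gh.unlock; elim: n => [|n [a /forallP aP]].
  by exists 0; apply/forallP => -[].
have gha k : (k < n)%N -> ghost p k (nth 0 a) = c.
  by move=> kn; apply/eqP; have := aP (Ordinal kn).
pose s := \sum_(i < n) p%:R ^+ i * a`_i ^+ (p ^ (n - i)).
have cs : c - s \in pdvd n.
  case: (n) a {aP} gha @s => [|m] a gha s; first exact: pdvd0.
  have := ghost_frob_lift p_pr m (nth 0 a) (phi := idfun) (Zloc_fermat p_pr).
  by rewrite gha // => /(pdvd_dvdr_nat p_pr).
have bP : size (rcons a (pquo n (c - s))) == n.+1 by rewrite size_rcons size_tuple.
exists (Tuple bP); apply/forallP => -[k /=]; rewrite ltnS /wghost.
have lt_nth i : (i < n)%N -> nth 0 (rcons a (pquo n (c - s))) i = a`_i.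
  by move=> ltin; rewrite nth_rcons size_tuple ltin.
rewrite leq_eqVlt => /predU1P[->|ltkn]; last first.
  apply/eqP; rewrite -[RHS](gha _ ltkn); apply: eq_ghost => i leik.
  by rewrite lt_nth ?(leq_ltn_trans leik).
rewrite /ghost big_ord_recr /= nth_rcons size_tuple ltnn eqxx subnn expn0 expr1.
rewrite pquoK // (eq_bigr (fun i : 'I_n => p%:R ^+ i * a`_i ^+ (p ^ (n - i)))).
  by rewrite addrC subrK.
by move=> i _; rewrite lt_nth.
Qed.

Let ghE := (ghD, ghN, ghM, gh1, gh0, ghR, ghF, ghVS).

Lemma gh_teich n k c : (k < n)%N -> gh k (teich p_pr n c) = c ^+ (p ^ k).
Proof. by rewrite gh.unlock; apply: ghost_teich. Qed.

Lemma wittR_is_zmod_morphism n : zmod_morphism (@wittR p p_pr Z n).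
Proof.
by move=> a b; apply: gh_ext => k kn; rewrite !ghE // ltnW.
Qed.

Lemma wittR_is_monoid_morphism n : monoid_morphism (@wittR p p_pr Z n).
Proof.
by split=> [|a b]; apply: gh_ext => k kn; rewrite !ghE // ltnW.
Qed.

Lemma wittF_is_zmod_morphism n : zmod_morphism (@wittF p p_pr Z n).
Proof. by move=> a b; apply: gh_ext => k kn; rewrite !ghE. Qed.

Lemma wittF_is_monoid_morphism n : monoid_morphism (@wittF p p_pr Z n).
Proof. by split=> [|a b]; apply: gh_ext => k kn; rewrite !ghE. Qed.

Lemma wittV_is_zmod_morphism n : zmod_morphism (@wittV p p_pr Z n).
Proof.
move=> a b; apply: gh_ext => -[|k] kn; rewrite !ghE ?ghV0 //; first by rewrite subr0.
by rewrite mulrBr.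
Qed.

HB.instance Definition _ n :=
  GRing.isZmodMorphism.Build _ _ (@wittR p p_pr Z n) (@wittR_is_zmod_morphism n).
HB.instance Definition _ n :=
  GRing.isMonoidMorphism.Build _ _ (@wittR p p_pr Z n) (@wittR_is_monoid_morphism n).
HB.instance Definition _ n :=
  GRing.isZmodMorphism.Build _ _ (@wittF p p_pr Z n) (@wittF_is_zmod_morphism n).
HB.instance Definition _ n :=
  GRing.isMonoidMorphism.Build _ _ (@wittF p p_pr Z n) (@wittF_is_monoid_morphism n).
HB.instance Definition _ n :=
  GRing.isZmodMorphism.Build _ _ (@wittV p p_pr Z n) (@wittV_is_zmod_morphism n).

Lemma wittFR n (a : W n.+2) : wittR (wittF a) = wittF (wittR a).
Proof. by apply: gh_ext => k kn; rewrite !ghE // ltnW. Qed.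

Lemma wittVR n (a : W n.+1) : wittR (wittV a) = wittV (wittR a).
Proof.
by apply: gh_ext => -[|k] kn; rewrite ?ghV0 !ghE // ?ghV0 // ltnW.
Qed.

Lemma wittVF n (a : W n) (b : W n.+1) : wittV a * b = wittV (a * wittF b).
Proof.
by apply: gh_ext => -[|k] kn; rewrite ?ghV0 !ghE // ?ghV0 ?mul0r // mulrA.
Qed.

Lemma wittFV n (a : W n) : wittF (wittV a) = a *+ p.
Proof. by apply: gh_ext => k kn; rewrite !ghE // ghMn // mulr_natl. Qed.

Lemma wittR_teich n c : wittR (teich p_pr n.+1 c) = teich p_pr n c.
Proof. by apply: gh_ext => k kn; rewrite !ghE // !gh_teich // ltnW. Qed.

Lemma wittF_teich n c : wittF (teich p_pr n.+1 c) = teich p_pr n c ^+ p.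
Proof.
by apply: gh_ext => k kn; rewrite !ghE // ghX // !gh_teich // expnSr exprM.
Qed.

Lemma teichM n c c' : teich p_pr n (c * c') = teich p_pr n c * teich p_pr n c'.
Proof. by apply: gh_ext => k kn; rewrite ghM // !gh_teich // exprMn. Qed.

Lemma teich1 n : teich p_pr n (1 : Z) = 1.
Proof. by []. Qed.

Lemma teichX n c m : teich p_pr n (c ^+ m) = teich p_pr n c ^+ m.
Proof. by elim: m => [//|m IH]; rewrite !exprS teichM IH. Qed.

Definition wconst n c : W n := xchoose (const_ghost_ex n c).

Lemma gh_wconst n c k : (k < n)%N -> gh k (wconst n c) = c.
Proof.
by move=> ltkn; have /forallP/(_ (Ordinal ltkn))/eqP := xchooseP (const_ghost_ex n c).
Qed.

Lemma wconst_is_zmod_morphism n : zmod_morphism (wconst n).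
Proof. by move=> c c'; apply: gh_ext => k kn; rewrite !ghE // !gh_wconst. Qed.

Lemma wconst_is_monoid_morphism n : monoid_morphism (wconst n).
Proof. by split=> [|c c']; apply: gh_ext => k kn; rewrite !ghE // !gh_wconst. Qed.

HB.instance Definition _ n :=
  GRing.isZmodMorphism.Build Z (W n) (wconst n) (@wconst_is_zmod_morphism n).
HB.instance Definition _ n :=
  GRing.isMonoidMorphism.Build Z (W n) (wconst n) (@wconst_is_monoid_morphism n).

Lemma wittR_const n c : wittR (wconst n.+1 c) = wconst n c.
Proof. by apply: gh_ext => k kn; rewrite !ghE // !gh_wconst // ltnW. Qed.

Lemma wittF_const n c : wittF (wconst n.+1 c) = wconst n c.
Proof. by apply: gh_ext => k kn; rewrite !ghE // !gh_wconst. Qed.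

Definition ghp n (a : W n) j : Z := if j is i.+1 then gh i a else 0.

Lemma wdiffE n (a : W n) j : gh j a = ghp a j + p%:R ^+ j * wdiff a j.
Proof.
rewrite wdiff.unlock pquoK ?(addrC (ghp _ _)) ?subrK //.
case: j => [|j]; last exact: dwork.
by rewrite subr0 pdvd0.
Qed.

Lemma wdiff_uniq n (a : W n) j c : gh j a = ghp a j + p%:R ^+ j * c -> wdiff a j = c.
Proof. by rewrite wdiffE => /addrI/(mulpX_inj p_pr). Qed.

Lemma ghpD n (a b : W n) j : (j <= n)%N -> ghp (a + b) j = ghp a j + ghp b j.
Proof. by case: j => [|j] jn /=; rewrite ?addr0 // ghD. Qed.

Lemma wdiffD n (a b : W n) j : (j < n)%N -> wdiff (a + b) j = wdiff a j + wdiff b j.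
Proof. by move=> jn; apply: wdiff_uniq; rewrite ghD // ghpD 1?ltnW // !wdiffE; ring. Qed.

Lemma wdiffN n (a : W n) j : (j < n)%N -> wdiff (- a) j = - wdiff a j.
Proof.
move=> jn; apply: wdiff_uniq; rewrite ghN // wdiffE.
by case: j jn => [|j] jn /=; rewrite ?ghN 1?ltnW //; ring.
Qed.

Lemma wdiffB n (a b : W n) j : (j < n)%N -> wdiff (a - b) j = wdiff a j - wdiff b j.
Proof. by move=> jn; rewrite wdiffD // wdiffN. Qed.

Lemma wdiff0 n j : wdiff (0 : W n) j = 0.
Proof. by apply: wdiff_uniq; case: j => [|j]; rewrite /= !gh0 !mulr0 addr0. Qed.

Lemma wdiff_sum n j (I : Type) (r : seq I) (f : I -> W n) :
  (j < n)%N -> wdiff (\sum_(i <- r) f i) j = \sum_(i <- r) wdiff (f i) j.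
Proof.
move=> jn; elim: r => [|i r IH]; first by rewrite !big_nil wdiff0.
by rewrite !big_cons wdiffD // IH.
Qed.

(** Leibniz rule for divided differences: one factor is taken at j, the other at j - 1. *)
Lemma wdiffM n (a b : W n) j :
  (j < n)%N -> wdiff (a * b) j = wdiff a j * gh j b + ghp a j * wdiff b j.
Proof.
move=> jn; apply: wdiff_uniq; rewrite ghM //.
have -> : ghp (a * b) j = ghp a j * ghp b j.
  by case: j jn => [|j] jn /=; rewrite ?mulr0 // ghM // ltnW.
by rewrite !wdiffE; ring.
Qed.

Lemma wdiff_const n c j : (j < n)%N -> wdiff (wconst n c) j = if j == 0%N then c else 0.
Proof.
move=> jn; apply: wdiff_uniq; rewrite gh_wconst //.
case: j jn => [|j] jn; first by rewrite /= add0r mul1r.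
by rewrite /= mulr0 addr0 gh_wconst // ltnW.
Qed.

Lemma wdiff1 n j : (j < n)%N -> wdiff (1 : W n) j = if j == 0%N then 1 else 0.
Proof. by move=> jn; rewrite -(rmorph1 (wconst n)) wdiff_const. Qed.

Lemma wdiff_constM n c (a : W n) j :
  (j < n)%N -> wdiff (wconst n c * a) j = c * wdiff a j.
Proof.
move=> jn; rewrite mulrC wdiffM // wdiff_const // gh_wconst // mulrC.
by case: j jn => [|j] jn; rewrite /= ?mul0r ?mulr0 addr0.
Qed.

Lemma wdiff_ext n (a b : W n) : (forall j, (j < n)%N -> wdiff a j = wdiff b j) -> a = b.
Proof.
move=> ab; apply: gh_ext; elim=> [|k IH] kn; rewrite wdiffE [RHS]wdiffE ab //.
by rewrite /= IH // ltnW.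
Qed.

Lemma wdiffR n (a : W n.+1) j : (j < n)%N -> wdiff (wittR a) j = wdiff a j.
Proof.
move=> jn; apply: wdiff_uniq; rewrite ghR // wdiffE; congr (_ + _).
by case: j jn => [//|j] jn; rewrite /= ghR // ltnW.
Qed.

Lemma wdiffV0 n (a : W n) : wdiff (wittV a) 0 = 0.
Proof. by apply: wdiff_uniq; rewrite ghV0 /= mulr0 addr0. Qed.

Lemma wdiffVS n (a : W n) j : wdiff (wittV a) j.+1 = wdiff a j.
Proof.
apply: wdiff_uniq; rewrite /= ghVS wdiffE exprS mulrDr mulrA; congr (_ + _).
by case: j => [|j]; rewrite /= ?ghV0 ?mulr0 // ghVS.
Qed.

(** F shifts the ghost components, but the difference is now divided by p^(j+1) instead of p^(j+2).
    Coordinate 0 of F a is [gh 1 a], not a difference, so the rule starts at index 1. *)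
Lemma wdiffFS n (a : W n.+1) j :
  (j.+1 < n)%N -> wdiff (wittF a) j.+1 = p%:R * wdiff a j.+2.
Proof.
move=> jn; apply: wdiff_uniq; rewrite /= !ghF //; last exact: ltnW.
by rewrite (wdiffE a j.+2) /= [_ ^+ j.+2]exprSr mulrA.
Qed.

Lemma gh_mod n (a : W n) k l : (k <= l)%N -> gh l a - gh k a \in pdvd k.+1.
Proof.
elim: l => [|l IH]; first by rewrite leqn0 => /eqP ->; rewrite subrr rpred0.
rewrite leq_eqVlt => /predU1P[<-|lekl]; first by rewrite subrr rpred0.
rewrite -[gh _.+1 _ as X in X - _](subrK (gh l a)) -addrA rpredD ?IH //.
exact: pdvdX (lekl) (dwork _ _).
Qed.

Fixpoint wVone n i : W n :=
  match i, n return W n with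
  | 0, _ => 1
  | _.+1, 0 => 0
  | i'.+1, n'.+1 => wittV (wVone n' i')
  end.

Lemma wdiff_wVone n i j : (j < n)%N -> wdiff (wVone n i) j = if j == i then 1 else 0.
Proof.
elim: i n j => [|i IH] [|n] [|j] jn //; rewrite ?wdiff1 //.
  by rewrite /= wdiffV0.
by rewrite /= wdiffVS IH.
Qed.

Lemma witt_sum_Vone n (a : W n) : a = \sum_(i < n) wconst n (wdiff a i) * wVone n i.
Proof.
apply: wdiff_ext => j jn; rewrite wdiff_sum // (bigD1 (Ordinal jn)) //= big1 => [|i ij].
  by rewrite wdiff_constM // wdiff_wVone // eqxx mulr1 addr0.
rewrite wdiff_constM // wdiff_wVone // ifN ?mulr0 //.
by apply: contraNneq ij => ji; apply/eqP/val_inj.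
Qed.

Lemma gh_sum_wdiff n (a : W n) k : gh k a = \sum_(i < k.+1) p%:R ^+ i * wdiff a i.
Proof.
elim: k => [|k IH]; first by rewrite big_ord1 wdiffE /= add0r.
by rewrite big_ord_recr /= -IH wdiffE.
Qed.

Lemma pX_wdiff_teichp n j : (j < n)%N ->
  p%:R ^+ j * wdiff (teich p_pr n (p%:R : Z)) j
  = p%:R ^+ (p ^ j) - (if j is i.+1 then p%:R ^+ (p ^ i) else 0).
Proof.
move=> jn; rewrite -(gh_teich _ jn).
have -> : (if j is i.+1 then p%:R ^+ (p ^ i) else 0) = ghp (teich p_pr n (p%:R : Z)) j.
  by case: j jn => //= j jn; rewrite gh_teich // ltnW.
by rewrite wdiffE; ring.
Qed.

End WittCoordinates.

(** * Relations in Witt complexes over Z_(p) *)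

Section GradedRings.
Variable G : gradedRing.
Implicit Types (i j : nat) (x y : G).

Lemma hpartN i x : hpart i x -> hpart i (- x).
Proof. by move=> hx; rewrite -[- x]sub0r; apply: hpartB; first exact: hpart0. Qed.

Lemma hpartD i x y : hpart i x -> hpart i y -> hpart i (x + y).
Proof. by move=> hx /hpartN hy; rewrite -[y]opprK; apply: hpartB. Qed.

Lemma hpart_sum i (I : Type) (r : seq I) (P : pred I) (f : I -> G) :
  (forall k, P k -> hpart i (f k)) -> hpart i (\sum_(k <- r | P k) f k).
Proof. by move=> hf; elim/big_ind: _ => //; [exact: hpart0 | exact: hpartD]. Qed.

Lemma hpart0M i x y : hpart 0 x -> hpart i y -> hpart i (x * y).
Proof. by move=> hx hy; rewrite -[i]add0n; apply: hpartM. Qed.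

Lemma hpart0_comm i x y : hpart 0 x -> hpart i y -> x * y = y * x.
Proof. by move=> hx hy; rewrite (hpart_comm hx hy) expr0 mul1r. Qed.

End GradedRings.

Section WittComplexes.
Variables (p : nat) (p_pr : prime p) (E : witt_complex p_pr (Zloc p)).
Local Notation Z := (Zloc p).
Local Notation W n := (witt p_pr n Z).
Local Notation V1 := (wc_Vone E).
Local Notation dV n i := (wc_d E n (wc_Vone E n i)).
Implicit Types (n i j k : nat) (c : Z).

Lemma level0_eq (x y : E 0) : x = y.
Proof. by rewrite (wc_level0 x) (wc_level0 y). Qed.

Lemma wc_d1 n : wc_d E n 1 = 0.
Proof.
have := wc_dM (1 : E n) (hpart1 (E n)); rewrite expr0 !mulr1 !mul1r => /eqP.
by rewrite -subr_eq0 opprD addNKr oppr_eq0 => /eqP.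
Qed.

Lemma wc_dM0 n (x y : E n) : hpart 0 x ->
  wc_d E n (x * y) = wc_d E n x * y + x * wc_d E n y.
Proof. by move=> hx; rewrite (wc_dM y hx) expr0 mul1r. Qed.

Lemma Vone0 n : V1 n 0 = 1.
Proof. by case: n. Qed.

Lemma Vone_lambda n i : V1 n i = wc_lambda E n (wVone p_pr n i).
Proof.
elim: i n => [|i IH] [|n] /=; rewrite ?rmorph1 //; first exact: level0_eq.
by rewrite -wc_lambdaV IH.
Qed.

Lemma hpart_Vone n i : hpart 0 (V1 n i).
Proof. by rewrite Vone_lambda; apply: wc_lambda_hpart. Qed.

Lemma hpart_dVone n i : hpart 1 (dV n i).
Proof. exact/wc_d_hpart/hpart_Vone. Qed.

Lemma Vone_ge n i : (n <= i)%N -> V1 n i = 0.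
Proof.
elim: n i => [|n IH] [|i] ni //=; first exact: wc_level0.
by rewrite IH ?raddf0.
Qed.

Lemma dVone_ge n i : (n <= i)%N -> dV n i = 0.
Proof. by move=> /Vone_ge ->; rewrite raddf0. Qed.

Lemma dVone0 n : dV n 0 = 0.
Proof. by rewrite Vone0 wc_d1. Qed.

Lemma wc_R_Vone n i : wc_R E n (V1 n.+1 i) = V1 n i.
Proof.
elim: i n => [|i IH] [|n] /=; rewrite ?rmorph1 //; first exact: level0_eq.
by rewrite wc_VR IH.
Qed.

Lemma wc_R_dVone n i : wc_R E n (dV n.+1 i) = dV n i.
Proof. by rewrite wc_dR wc_R_Vone. Qed.

Lemma wc_F_VoneS n i : wc_F E n (V1 n.+1 i.+1) = V1 n i *+ p.
Proof. exact: wc_FV. Qed.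

Lemma wc_F_dVoneS n i : wc_F E n (dV n.+1 i.+1) = dV n i.
Proof. exact: wc_FdV. Qed.

(* [V (d x) = V (F (d (V x))) = V 1 * d (V x)], to be compared with the
   derivative of [V 1 * V x = p V x]. *)
Lemma wc_Vd n i (x : E n) : hpart i x ->
  wc_V E n (wc_d E n x) = wc_d E n.+1 (wc_V E n x) *+ p.
Proof.
move=> hx; have hV1 := wc_V_homog (hpart1 (E n)).
have -> : wc_V E n (wc_d E n x) = wc_V E n 1 * wc_d E n.+1 (wc_V E n x).
  by rewrite wc_VF wc_FdV mul1r.
have dV1Vx : wc_d E n.+1 (wc_V E n 1) * wc_V E n x = 0.
  rewrite (hpart_comm (wc_d_hpart hV1) (wc_V_homog hx)) wc_VF wc_FdV wc_d1.
  by rewrite mulr0 raddf0 mulr0.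
have := wc_dM0 (wc_V E n x) hV1.
by rewrite wc_VF wc_FV mul1r !raddfMn /= dV1Vx add0r => ->.
Qed.

Lemma wc_V_dVone n i : wc_V E n (dV n i) = dV n.+1 i.+1 *+ p.
Proof. exact: wc_Vd (hpart_Vone n i). Qed.

(** Since p dV^(i+1)(1) = V(dV^i(1)), each V multiplies the exponent by at most p, starting from
    d(1) = 0. *)
Lemma dVone_torsion n i : dV n i *+ p ^ i = 0.
Proof.
elim: i n => [|i IH] [|n]; rewrite ?dVone0 ?mul0rn //; first exact: wc_level0.
by rewrite expnS mulrnA -wc_V_dVone -raddfMn IH raddf0.
Qed.

Lemma Vone_mul n i j : (i <= j)%N -> V1 n i * V1 n j = V1 n j *+ p ^ i.
Proof.
elim: i n j => [|i IH] [|n] [|j] lij; rewrite ?mul1r //; first exact: level0_eq.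
by rewrite /= wc_VF wc_FV mulrnAr IH // -mulrnA -expnSr raddfMn.
Qed.

Lemma Vone_dVone_lt n i j : (i < j)%N -> V1 n i * dV n j = dV n j *+ p ^ i.
Proof.
elim: i n j => [|i IH] [|n] [|j] lij; rewrite ?mul1r //; first exact: level0_eq.
by rewrite [LHS]wc_VF wc_F_dVoneS IH // raddfMn /= wc_V_dVone -mulrnA -expnS.
Qed.

Lemma Vone_dVone_ge n i j : (j <= i)%N -> V1 n i * dV n j = 0.
Proof.
elim: i n j => [|i IH] [|n] [|j] lij; rewrite ?dVone0 ?mulr0 //.
  exact: wc_level0.
by rewrite [LHS]wc_VF wc_F_dVoneS IH // raddf0.
Qed.

(** The product is d(V^i(1) dV^j(1)), and V^i(1) dV^j(1) is zero or a multiple of the closed element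
    dV^j(1). *)
Lemma dVone_dVone n i j : dV n i * dV n j = 0.
Proof.
have := wc_dM0 (dV n j) (hpart_Vone n i); rewrite wc_dd mulr0 addr0 => <-.
case: (ltnP i j) => [/Vone_dVone_lt|/Vone_dVone_ge] ->; last exact: raddf0.
by rewrite raddfMn /= wc_dd mul0rn.
Qed.

(** The Z_(p)-algebra structure of E_n, through Witt vectors with constant ghost components. R and F
    fix these scalars and d kills them, so all operators except V are visibly Z_(p)-linear; for V
    see [wc_V_ucM]. *)
Definition uc n c : E n := wc_lambda E n (wconst p_pr n c).

Lemma uc_is_zmod_morphism n : zmod_morphism (uc n).
Proof. by move=> x y; rewrite /uc !raddfB. Qed.

Lemma uc_is_monoid_morphism n : monoid_morphism (uc n).
Proof. by split=> [|x y]; rewrite /uc ?rmorph1 ?rmorphM. Qed.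

HB.instance Definition _ n :=
  GRing.isZmodMorphism.Build Z (E n) (uc n) (@uc_is_zmod_morphism n).
HB.instance Definition _ n :=
  GRing.isMonoidMorphism.Build Z (E n) (uc n) (@uc_is_monoid_morphism n).

Lemma hpart_uc n c : hpart 0 (uc n c).
Proof. exact: wc_lambda_hpart. Qed.

Lemma uc_comm n i c (x : E n) : hpart i x -> uc n c * x = x * uc n c.
Proof. by move=> hx; apply: hpart0_comm hx; apply: hpart_uc. Qed.

Lemma wc_R_uc n c : wc_R E n (uc n.+1 c) = uc n c.
Proof. by rewrite /uc wc_lambdaR wittR_const. Qed.

Lemma wc_F_uc n c : wc_F E n (uc n.+1 c) = uc n c.
Proof. by rewrite /uc wc_lambdaF wittF_const. Qed.

(** Some multiple k c with k prime to p is an integer, hence killed by d, and k is invertible in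
    E_n. *)
Lemma wc_d_uc n c : wc_d E n (uc n c) = 0.
Proof.
have [m [k [pk ck]]] := Zloc_frac c; have [y ky] := Zloc_unit p_pr pk.
have: wc_d E n (uc n c) *+ k = 0.
  have := congr1 (uc n) ck; rewrite mulr_natr rmorphMn /= rmorph_int.
  move/(congr1 (wc_d E n)); rewrite raddfMn /= => ->.
  by rewrite raddfMz /= wc_d1 mul0rz.
move/(congr1 ( *%R (uc n y))); rewrite mulr0 mulrnAr -mulrnAl -rmorphMn /=.
by rewrite -mulr_natl ky rmorph1 mul1r.
Qed.

Lemma wc_d_ucM n c (x : E n) : wc_d E n (uc n c * x) = uc n c * wc_d E n x.
Proof. by rewrite wc_dM0 ?wc_d_uc ?mul0r ?add0r //; apply: hpart_uc. Qed.

Lemma wc_V_ucM n i c (x : E n) : hpart i x ->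
  wc_V E n (uc n c * x) = uc n.+1 c * wc_V E n x.
Proof.
move=> hx; rewrite (uc_comm _ hx) (uc_comm _ (wc_V_homog hx)).
by rewrite wc_VF wc_F_uc.
Qed.

Lemma uc_pXM n k c (x : E n) : uc n (p%:R ^+ k * c) * x = uc n c * (x *+ p ^ k).
Proof.
by rewrite -natrX mulr_natl rmorphMn /= mulrnAl mulrnAr.
Qed.

Lemma uc_pdvd n k c (x : E n) : x *+ p ^ k = 0 -> c \in pdvd k -> uc n c * x = 0.
Proof. by move=> kx /(pdvdP p_pr)[y ->]; rewrite uc_pXM kx mulr0. Qed.

Lemma uc_cong n k c c' (x : E n) :
  x *+ p ^ k = 0 -> c - c' \in pdvd k -> uc n c * x = uc n c' * x.
Proof.
by move=> kx /(uc_pdvd kx)/eqP; rewrite rmorphB mulrBl subr_eq0 => /eqP.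
Qed.

(** The sum may be longer than n because V^i(1) = 0 for i >= n. The freedom in m allows fixed
    indices to be split off at every level. *)
Lemma lambda_sum n m (a : W n) : (n <= m)%N ->
  wc_lambda E n a = \sum_(i < m) uc n (wdiff a i) * V1 n i.
Proof.
move=> nm; rewrite {1}[a]witt_sum_Vone raddf_sum.
rewrite (big_ord_widen_cond _ xpredT
  (fun i => wc_lambda E n (wconst p_pr n (wdiff a i) * wVone p_pr n i)) nm) /=.
rewrite big_mkcond /=; apply: eq_bigr => i _; case: ltnP => [lin|/Vone_ge ->].
  by rewrite rmorphM Vone_lambda.
by rewrite mulr0.
Qed.

Lemma wc_d_lambda n m (a : W n) : (n <= m)%N ->
  wc_d E n (wc_lambda E n a) = \sum_(i < m) uc n (wdiff a i) * dV n i.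
Proof.
move=> nm; rewrite (lambda_sum a nm) raddf_sum.
by apply: eq_bigr => i _; rewrite /= wc_d_ucM.
Qed.

(** V^i(1) acts on dV^j(1) as p^i for i < j and as 0 for i >= j. The term i = j may still be counted
    in the ghost component, because p^j kills dV^j(1). *)
Lemma lambda_dVone n (a : W n) j : wc_lambda E n a * dV n j = uc n (gh j a) * dV n j.
Proof.
have lej : (j.+1 <= n + j.+1)%N by rewrite leq_addl.
rewrite (lambda_sum a (leq_addr j.+1 n)) mulr_suml gh_sum_wdiff rmorph_sum mulr_suml.
rewrite (big_ord_widen _ (fun i => uc n (p%:R ^+ i * wdiff a i) * dV n j) lej).
rewrite [RHS]big_mkcond /=; apply: eq_bigr => i _; rewrite ltnS uc_pXM -mulrA.
case: (ltngtP i j) => [ij|ji|->]; first by rewrite Vone_dVone_lt.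
  by rewrite Vone_dVone_ge ?mulr0 // ltnW.
by rewrite Vone_dVone_ge // dVone_torsion.
Qed.

End WittComplexes.

(** * The relation between V(dlog[p]) and dlog[p] *)

Section OddPrime.
Variables (p : nat) (p_pr : prime p) (p_odd : odd p).
Local Notation Z := (Zloc p).
Local Notation W n := (witt p_pr n Z).
Implicit Types (n i j k : nat) (c : Z).

Lemma expn_ge_add2 i : (0 < i)%N -> (i.+2 <= p ^ i)%N.
Proof.
have := odd_prime_gt2 p_odd p_pr => p_gt2; elim: i => // -[|i] IH _.
  by rewrite expn1.
by rewrite expnS; have := IH isT; nia.
Qed.

Lemma expn_ge_double i : (1 < i)%N -> (i.+1 + i.+1 <= p ^ i)%N.
Proof.
have := odd_prime_gt2 p_odd p_pr => p_gt2; elim: i => // -[|[|i]] IH _ //.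
  by rewrite expnS expn1; nia.
by rewrite expnS; have := IH isT; nia.
Qed.

Definition q3 : nat := p == 3%N.

(* The coordinates of the Teichmueller representative [p] of the prime are
   [p * teichp_coef i - teichp_coef i.-1], see [wdiff_teichp]. *)
Definition teichp_coef i : Z := p%:R ^+ (p ^ i - i.+1).

Lemma wdiff_teichp n i : (i < n)%N -> wdiff (teich p_pr n (p%:R : Z)) i
  = p%:R * teichp_coef i - (if i is k.+1 then teichp_coef k else 0).
Proof.
have p_gt1 := prime_gt1 p_pr => lin; apply: (mulpX_inj p_pr (k := i)).
rewrite (pX_wdiff_teichp p_pr lin) mulrBr mulrA -exprSr -exprD subnKC; last exact: ltn_expl.
congr (_ - _); case: i lin => [|i] lin; first by rewrite mulr0.
by rewrite -exprD subnKC // ltn_expl.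
Qed.

(** The first term p^(p^(i+1) - i - 1) always vanishes modulo p^(i+1). The second, p^(p^i - i - 1),
    does so as soon as 2(i+1) <= p^i. This fails only for i = 0, where it is 1, and for i = 1 and p
    = 3, where it is p. *)
Lemma wdiff_teichp_mod n i : (i.+1 < n)%N ->
  wdiff (teich p_pr n (p%:R : Z)) i.+1
  - (if i == 0%N then -1 else if i == 1%N then - (q3 * p)%:R else 0) \in pdvd i.+1.
Proof.
have p_gt2 := odd_prime_gt2 p_odd p_pr => lin; have lti := ltn_expl i.+1 (prime_gt1 p_pr).
rewrite wdiff_teichp // -addrA; apply: rpredD.
  rewrite /teichp_coef -exprS subnSK // -[p%:R ^+ _]mulr1; apply: pdvd_pX => //.
  case: i {lin} lti => [|i] lti; first by rewrite expn1; lia.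
  by have := @expn_ge_double i.+2 isT; lia.
case: i {lin lti} => [|[|i]] /=.
- by rewrite /teichp_coef expn0 subnn expr0 opprK addNr rpred0.
- rewrite opprK /q3 /teichp_coef expn1; case: eqP => [p3|/eqP p_neq3].
    have -> : (p - 2 = 1)%N by lia.
    by rewrite mul1n expr1 addNr rpred0.
  rewrite mul0n addr0 rpredN -[p%:R ^+ _]mulr1; apply: pdvd_pX => //.
  by move: p_odd p_neq3; case: (p) p_gt2 => [|[|[|[|[|]]]]] //; lia.
- rewrite subr0 rpredN -[teichp_coef _]mulr1; apply: pdvd_pX => //.
  by have := @expn_ge_double i.+2 isT; lia.
Qed.

(* The coefficients on the dV^j(1) of a * dlog[p], see [lambda_theta]; modulo p^j a
   derivation in a, see [twistM]. *)
Definition twist n (a : W n) j : Z :=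
  if j is i.+1
  then p%:R ^+ i * wdiff a i.+1 + p%:R ^+ i * (q3%:R * (if i is 0 then 0 else wdiff a i))
  else 0.

(* The coefficients on the dV^j(1) of V(dlog[p]), see [wc_V_theta]. *)
Definition tv j : Z := if j == 1%N then 1 else if j == 2%N then (q3 * p)%:R else 0.

(* [theta] is dlog[p] if [b] is true and 0 otherwise, so that the complexes with and
   without logarithmic poles are treated at once. *)
Section Theta.
Variables (E : witt_complex p_pr Z) (b : bool) (theta : forall n, E n).
Local Notation V1 := (wc_Vone E).
Local Notation dV n i := (wc_d E n (wc_Vone E n i)).

Hypothesis hpart_theta : forall n, hpart 1 (theta n).
Hypothesis wc_F_theta : forall n, wc_F E n (theta n.+1) = theta n.
Hypothesis wc_R_theta : forall n, wc_R E n (theta n.+1) = theta n.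
Hypothesis wc_d_theta : forall n, wc_d E n (theta n) = 0.
Hypothesis teichp_theta : forall n,
  if b then wc_lambda E n (teich p_pr n p%:R) * theta n
            = wc_d E n (wc_lambda E n (teich p_pr n p%:R))
  else theta n = 0.

Fixpoint Vtheta n i : E n :=
  match i, n return E n with
  | 0, n => theta n
  | _.+1, 0 => 0
  | i'.+1, n'.+1 => wc_V E n' (Vtheta n' i')
  end.

Lemma Vtheta0 n : Vtheta n 0 = theta n.
Proof. by case: n. Qed.

Lemma Vtheta_ge n i : (0 < i)%N -> (n <= i)%N -> Vtheta n i = 0.
Proof.
elim: n i => [|n IH] [|i] //= _ ni.
case: i ni => [|i] ni; last by rewrite IH ?raddf0.
case: n ni {IH} => // _; rewrite Vtheta0.
by rewrite (wc_level0 (theta 0)) raddf0.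
Qed.

Lemma Vone_theta n i : V1 n i * theta n = Vtheta n i.
Proof.
elim: i n => [|i IH] [|n]; rewrite ?Vone0 ?mul1r ?Vtheta0 //; first exact: level0_eq.
by rewrite /= wc_VF wc_F_theta IH.
Qed.

Lemma lambda_theta_sum n m (a : W n) : (n <= m)%N ->
  wc_lambda E n a * theta n = \sum_(i < m) uc E n (wdiff a i) * Vtheta n i.
Proof.
move=> nm; rewrite (lambda_sum E a nm) mulr_suml.
by apply: eq_bigr => i _; rewrite -mulrA Vone_theta.
Qed.

(** V^(i+1)(theta) at level n is V^i applied to V(theta_m) with m = n - i - 1, so knowing V(theta_m)
    for m < N is enough for n <= N + i. The gain of i levels drives the induction in
    [wc_V_theta]. *)
Lemma Vtheta_step N :
  (forall n, (n < N)%N -> wc_V E n (theta n)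
     = theta n.+1 *+ p + (dV n.+1 1 + dV n.+1 2 *+ (q3 * p)) *+ b) ->
  forall n i, (n <= N + i)%N -> Vtheta n i.+1 =
    Vtheta n i *+ p + (dV n i.+1 *+ p ^ i + dV n i.+2 *+ (q3 * p * p ^ i)) *+ b.
Proof.
move=> VN n i; elim: i n => [|i IH] [|n] lnN; try exact: level0_eq.
  by rewrite expn0 !muln1 !mulr1n /= Vtheta0; apply: VN; rewrite addn0 in lnN.
have lnN' : (n <= N + i)%N by rewrite -ltnS -addnS.
rewrite [LHS]/= (IH _ lnN') !(raddfD, raddfMn) /= !wc_V_dVone.
by rewrite -!mulrnA !expnS mulnCA.
Qed.

(** Summation by parts, from the shape p c_i - c_(i-1) of the coordinates of [p]. *)
Lemma Vtheta_telescope m k : (k < m)%N ->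
  \sum_(i < k.+1) uc E m (wdiff (teich p_pr m (p%:R : Z)) i) * Vtheta m i =
  \sum_(i < k.+1) uc E m (teichp_coef i) * (Vtheta m i *+ p - Vtheta m i.+1)
  + uc E m (teichp_coef k) * Vtheta m k.+1.
Proof.
elim: k => [|k IH] km.
  rewrite !big_ord1 wdiff_teichp // subr0 mulr_natl rmorphMn /= mulrnAl -mulrnAr.
  by rewrite -mulrDr subrK.
rewrite big_ord_recr [in RHS]big_ord_recr /= IH; last exact: ltnW.
rewrite wdiff_teichp // rmorphB mulr_natl rmorphMn /= mulrBl mulrnAl -mulrnAr.
rewrite -!addrA; congr (_ + _); rewrite addrC subrK.
by rewrite -mulrDr subrK.
Qed.

Lemma teichp_coef_dVone m i k l : (i + k.+1 <= p ^ k + l)%N ->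
  uc E m (teichp_coef k) * (dV m i *+ p ^ l) = 0.
Proof.
move=> ikl; have lk := ltn_expl k (prime_gt1 p_pr).
rewrite -uc_pXM; apply: (uc_pdvd (dVone_torsion E m i)).
rewrite /teichp_coef -exprD -[_ ^+ _]mulr1; apply: pdvd_pX => //.
by lia.
Qed.

Arguments wc_Vone : simpl never.
Arguments Vtheta : simpl never.

(** Summed over i this is d[p] = -dV(1) - q3 p dV^2(1). *)
Lemma wdiff_teichp_dVone m i : uc E m (wdiff (teich p_pr m (p%:R : Z)) i) * dV m i =
  if i == 1%N then - dV m 1 else if i == 2%N then - (dV m 2 *+ (q3 * p)) else 0.
Proof.
have [mi|im] := leqP m i.
  rewrite dVone_ge // mulr0; case: eqP => [i1|_].
    by rewrite dVone_ge ?oppr0 // -i1.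
  by case: eqP => // i2; rewrite dVone_ge ?mul0rn ?oppr0 // -i2.
case: i im => [|i] im; first by rewrite dVone0 mulr0.
rewrite (uc_cong (dVone_torsion E m i.+1) (wdiff_teichp_mod im)) /=.
case: i {im} => [|[|i]] /=; first by rewrite rmorphN1 mulN1r.
  by rewrite rmorphN rmorph_nat mulNr mulr_natl.
by rewrite rmorph0 mul0r.
Qed.

(* Write [p] theta = d[p] in coordinates. The left hand side telescopes into a sum of
   multiples of V^i (p theta - V theta); for i > 0 these are known by induction on the
   level and die for torsion reasons, which leaves p theta - V theta. *)
Lemma wc_V_theta n : wc_V E n (theta n)
  = theta n.+1 *+ p + (dV n.+1 1 + dV n.+1 2 *+ (q3 * p)) *+ b.
Proof.
have := teichp_theta; case bE: b; last first.
  by move=> th0; rewrite !th0 raddf0 mul0rn add0r mulr0n.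
elim/ltn_ind: n => n IH thp; have := thp n.+1.
have IH' m : (m < n)%N -> wc_V E m (theta m)
    = theta m.+1 *+ p + (dV m.+1 1 + dV m.+1 2 *+ (q3 * p)) *+ b.
  by rewrite bE => mn; apply: IH.
(* Three extra terms on the right, so that the indices 0, 1, 2 exist even at low levels. *)
rewrite (lambda_theta_sum _ (leqnn _)) (wc_d_lambda E _ (leq_addl 3 n.+1)).
rewrite Vtheta_telescope // Vtheta_ge // mulr0 addr0.
under [RHS]eq_bigr do rewrite wdiff_teichp_dVone.
rewrite [RHS]big_ord_recl [in RHS]big_ord_recl [in RHS]big_ord_recl /= add0r.
rewrite [in RHS]big1 ?addr0; last by [].
rewrite big_ord_recl big1 => [|i _]; last first.
  rewrite lift0 (Vtheta_step (i := i.+1) IH'); last by rewrite addnS ltnS leq_addr.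
  rewrite opprD addNKr bE mulr1n mulrN mulrDr teichp_coef_dVone; last first.
    by have := @expn_ge_add2 i.+1 isT; lia.
  rewrite -mulnA mulnC mulrnA mulrnAr -expnS teichp_coef_dVone; last first.
    by have := @expn_ge_add2 i.+1 isT; lia.
  by rewrite mul0rn addr0 oppr0.
rewrite addr0 /= /teichp_coef expn0 subnn expr0 rmorph1 mul1r Vtheta0.
rewrite -[Vtheta n.+1 1]/(wc_V E n (Vtheta n 0)) Vtheta0.
rewrite -opprD mulr1n => E1.
by rewrite -[X in _ = _ + X]opprK -E1 opprB addrC subrK.
Qed.

Lemma VthetaS n i : Vtheta n i.+1 =
  Vtheta n i *+ p + (dV n i.+1 *+ p ^ i + dV n i.+2 *+ (q3 * p * p ^ i)) *+ b.
Proof. exact: Vtheta_step (fun m _ => wc_V_theta m) _ _ (leq_addr i n). Qed.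

(** On iterating [VthetaS], the corrections of earlier steps get multiplied by p and die by torsion,
    so only those of the last step remain. *)
Lemma Vtheta_closed n i : Vtheta n i.+1 =
  theta n *+ p ^ i.+1 + (dV n i.+1 *+ p ^ i + dV n i.+2 *+ (q3 * p ^ i.+1)) *+ b.
Proof.
elim: i => [|i IH]; first by rewrite VthetaS Vtheta0 expn0 muln1 expn1.
have X0 : (dV n i.+1 *+ p ^ i + dV n i.+2 *+ (q3 * p ^ i.+1)) *+ p = 0.
  rewrite mulrnDl -!mulrnA -expnSr dVone_torsion add0r -mulnA -expnSr mulnC mulrnA.
  by rewrite dVone_torsion mul0rn.
rewrite VthetaS {}IH mulrnDl [_ *+ b *+ p]mulrnAC X0 mul0rn addr0.
by rewrite -mulrnA -expnSr -mulnA -expnS.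
Qed.

(** For n > 0, V^n(theta), dV^n(1) and dV^(n+1)(1) all vanish at level n, so the closed formula for
    V^n(theta) reduces to p^n theta = 0. *)
Lemma theta_torsion n : theta n *+ p ^ (b * n) = 0.
Proof.
have := teichp_theta n; case bE: b; last by move=> ->; rewrite mul0rn.
case: n => [|n] _; first exact: level0_eq.
have := Vtheta_closed n.+1 n.
rewrite Vtheta_ge // !dVone_ge // !mul0rn addr0 mul0rn addr0.
by rewrite mul1n => ->.
Qed.

(** With a in coordinates, a theta is a combination of the V^i(theta). In their closed forms the
    multiples of theta add up to the top ghost component, and the dV-terms make up the twist. *)
Lemma lambda_theta n (a : W n) : wc_lambda E n a * theta n =
  uc E n (gh n.-1 a) * theta n + (\sum_(j < n) uc E n (twist a j) * dV n j) *+ b.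
Proof.
case: n a => [|m] a; first exact: level0_eq.
rewrite (lambda_theta_sum a (leqnn _)) gh_sum_wdiff rmorph_sum mulr_suml.
(* [f] collects the terms dV^i(1) of V^i(theta), [g] the terms dV^(i+1)(1) present for p = 3. The
   latter must be shifted by one to match [twist]; the top one is zero. *)
pose f i := if i is k.+1 then (uc E m.+1 (p%:R ^+ k * wdiff a i) * dV m.+1 i) else 0.
pose g i := if i is 0 then 0 else
  uc E m.+1 (p%:R ^+ i * (q3%:R * wdiff a i)) * dV m.+1 i.+1.
have gm k : (m <= k)%N -> g k = 0.
  by case: k => // k mk; rewrite /g dVone_ge ?mulr0.
have tE : \sum_(j < m.+1) uc E m.+1 (twist a j) * dV m.+1 j
    = \sum_(i < m.+1) f i + \sum_(i < m.+1) g i.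
  have -> : \sum_(i < m.+1) g i = \sum_(i < m.+1) if (i : nat) is k.+1 then g k else 0.
    rewrite [RHS]big_ord_recl /= add0r big_ord_recr /= [X in _ + X = _](_ : _ = 0).
      by rewrite addr0; apply: eq_bigr.
    by apply: gm.
  rewrite -big_split /=; apply: eq_bigr => -[[|i] _] _ /=.
    by rewrite dVone0 mulr0 addr0.
  by rewrite rmorphD mulrDl; case: i => [|i] /=; rewrite ?mulr0 ?rmorph0 ?mul0r.
rewrite tE -big_split -sumrMnl -big_split /=; apply: eq_bigr => -[i _] _ /=.
rewrite uc_pXM; case: i => [|i] /=; first by rewrite Vtheta0 addr0 mul0rn addr0.
rewrite Vtheta_closed mulrDr; congr (_ + _); rewrite mulrnAr mulrDr.
congr ((_ + _) *+ b).
  by rewrite uc_pXM.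
by rewrite uc_pXM rmorphM rmorph_nat -mulrA mulr_natl mulnC mulrnA mulrnAr.
Qed.

Lemma dVone_sum_widen n m (f : nat -> Z) : (n <= m)%N ->
  \sum_(j < m) uc E n (f j) * dV n j = \sum_(j < n) uc E n (f j) * dV n j.
Proof.
move=> nm; rewrite (big_ord_widen m (fun j => uc E n (f j) * dV n j) nm).
rewrite [RHS]big_mkcond /=; apply: eq_bigr => j _.
by case: ltnP => // nj; rewrite dVone_ge ?mulr0.
Qed.

(** As theta is closed, the product is d(V^j(theta)), and the closed formula writes V^j(theta)
    through closed elements. *)
Lemma dVone_theta n j : dV n j * theta n = 0.
Proof.
have := wc_dM0 (theta n) (hpart_Vone E n j).
rewrite wc_d_theta mulr0 addr0 Vone_theta => <-; case: j => [|j].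
  by rewrite Vtheta0 wc_d_theta.
rewrite Vtheta_closed raddfD raddfMn /= wc_d_theta mul0rn add0r.
by rewrite raddfMn /= raddfD /= !raddfMn /= !wc_dd !mul0rn addr0 mul0rn.
Qed.

Lemma theta_dVone n j : theta n * dV n j = 0.
Proof. by rewrite (hpart_comm (hpart_theta n) (hpart_dVone E n j)) dVone_theta mulr0. Qed.

(** Odd degree gives 2 theta^2 = 0, and 2 is a unit of Z_(p) for p odd. *)
Lemma theta_theta n : theta n * theta n = 0.
Proof.
have p2 : coprime p 2 by rewrite coprimen2.
have [y y2] := Zloc_unit p_pr p2.
have th2 : (theta n * theta n) *+ 2 = 0.
  rewrite mulr2n {1}(hpart_comm (hpart_theta n) (hpart_theta n)) expr1 mulN1r.
  by rewrite addNr.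
by rewrite -[LHS]mul1r -(rmorph1 (uc E n)) -y2 mulr_natl rmorphMn mulrnAl -mulrnAr th2
  mulr0.
Qed.

Definition Gsum n (e : nat -> Z) (t : Z) : E n :=
  \sum_(j < n) uc E n (e j) * dV n j + uc E n t * theta n.

(** This makes [Gsum] well defined on the classes of [logN]. *)
Lemma Gsum_cong n e e' t t' :
  (forall j, (j < n)%N -> e j - e' j \in pdvd j) -> t - t' \in pdvd (b * n) ->
  Gsum n e t = Gsum n e' t'.
Proof.
move=> ee' tt'; congr (_ + _); last exact: uc_cong (theta_torsion n) tt'.
apply: eq_bigr => j _; apply: uc_cong (dVone_torsion E n j) _.
exact: ee'.
Qed.

Lemma hpart_Gsum n e t : hpart 1 (Gsum n e t).
Proof.
apply: hpartD; last exact: hpart0M (hpart_uc E n t) (hpart_theta n).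
by apply: hpart_sum => j _; apply: hpart0M (hpart_uc E n _) (hpart_dVone E n _).
Qed.

Lemma Gsum_B n e e' t t' :
  Gsum n e t - Gsum n e' t' = Gsum n (fun j => e j - e' j) (t - t').
Proof.
rewrite /Gsum opprD addrACA -sumrB rmorphB mulrBl; congr (_ + _).
by apply: eq_bigr => j _; rewrite rmorphB mulrBl.
Qed.

(** The coefficients found here and in the formulas for R, F, d and V below are the ones by which
    [Nact], [NR], [NF], [Nd] and [NV] are defined. *)
Lemma lambda_Gsum n (a : W n) e t : wc_lambda E n a * Gsum n e t =
  Gsum n (fun j => gh j a * e j + (t * twist a j) *+ b) (gh n.-1 a * t).
Proof.
have laC x : wc_lambda E n a * uc E n x = uc E n x * wc_lambda E n a.
  by rewrite (hpart0_comm (hpart_uc E n x) (wc_lambda_hpart E a)).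
rewrite mulrDr mulrA laC -mulrA lambda_theta mulrDr addrCA.
rewrite /Gsum [RHS]addrC; congr (_ + _).
  by rewrite mulrA -rmorphM [t * _]mulrC.
rewrite mulrnAr !mulr_sumr -sumrMnl -big_split /=; apply: eq_bigr => j _.
rewrite rmorphD mulrDl mulrA laC -mulrA lambda_dVone mulrA -rmorphM [_ * e j]mulrC.
by congr (_ + _); rewrite rmorphMn /= mulrnAl mulrA rmorphM.
Qed.

Lemma Gsum_mul n e e' t t' : Gsum n e t * Gsum n e' t' = 0.
Proof.
have muc (x y : Z) (u v : E n) : hpart 1 u -> u * v = 0 ->
    (uc E n x * u) * (uc E n y * v) = 0.
  move=> hu uv; rewrite -mulrA [u * (_ * _)]mulrA -(uc_comm _ hu) -mulrA uv.
  by rewrite !mulr0.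
have dVdV : (\sum_(j < n) uc E n (e j) * dV n j)
    * (\sum_(j < n) uc E n (e' j) * dV n j) = 0.
  rewrite mulr_suml big1 // => i _; rewrite mulr_sumr big1 // => j _.
  exact: muc (hpart_dVone E n i) (dVone_dVone _ _ _ _).
rewrite mulrDl !mulrDr dVdV (muc _ _ _ _ _ (theta_theta n)) // mulr_suml mulr_sumr.
rewrite !big1 ?addr0 // => j _; first exact: muc (hpart_theta n) (theta_dVone n j).
exact: muc (hpart_dVone E n j) (dVone_theta n j).
Qed.

Lemma wc_R_Gsum n e t : wc_R E n (Gsum n.+1 e t) = Gsum n e t.
Proof.
rewrite raddfD raddf_sum /= rmorphM wc_R_uc wc_R_theta /Gsum; congr (_ + _).
rewrite -(dVone_sum_widen e (leqnSn n)); apply: eq_bigr => j _.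
by rewrite rmorphM wc_R_uc wc_R_dVone.
Qed.

Lemma wc_F_Gsum n e t : wc_F E n (Gsum n.+1 e t) = Gsum n (fun j => e j.+1) t.
Proof.
rewrite raddfD raddf_sum /= rmorphM wc_F_uc wc_F_theta /Gsum; congr (_ + _).
rewrite big_ord_recl dVone0 mulr0 raddf0 add0r; apply: eq_bigr => j _.
by rewrite lift0 rmorphM wc_F_uc wc_F_dVoneS.
Qed.

Lemma wc_d_Gsum n e t : wc_d E n (Gsum n e t) = 0.
Proof.
rewrite raddfD raddf_sum /= wc_d_ucM wc_d_theta mulr0 addr0.
by apply: big1 => j _; rewrite /= wc_d_ucM wc_dd mulr0.
Qed.

Lemma wc_d_lambda_Gsum n (a : W n) :
  wc_d E n (wc_lambda E n a) = Gsum n (wdiff a) 0.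
Proof. by rewrite (wc_d_lambda E a (leqnn n)) /Gsum rmorph0 mul0r addr0. Qed.

Lemma wc_V_Gsum n e t : wc_V E n (Gsum n e t) = Gsum n.+1
  (fun j => (if j is i.+1 then p%:R * e i else 0) + (t * tv j) *+ b) (p%:R * t).
Proof.
rewrite raddfD raddf_sum /= (wc_V_ucM _ (hpart_theta n)) wc_V_theta mulrDr addrCA.
rewrite /Gsum addrC; congr (_ + _); last first.
  by rewrite mulr_natl rmorphMn mulrnAl mulrnAr.
under [RHS]eq_bigr do rewrite rmorphD mulrDl.
rewrite big_split /= big_ord_recl rmorph0 mul0r add0r; congr (_ + _).
  apply: eq_bigr => j _; rewrite lift0 (wc_V_ucM _ (hpart_dVone E n j)) wc_V_dVone.
  by rewrite mulr_natl rmorphMn mulrnAl mulrnAr.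
have len : (n.+1 <= n.+3)%N by rewrite ltnW.
rewrite -(dVone_sum_widen (fun j => t * tv j *+ b) len).
rewrite 3!big_ord_recl dVone0 mulr0 add0r big1 => [|i _]; last first.
  by rewrite !lift0 /tv /= mulr0 mul0rn rmorph0 mul0r.
rewrite !lift0 /tv /= addr0 mulr1 !rmorphMn /=.
rewrite !mulrnAl [_ * (_ *+ b)]mulrnAr mulrDr mulrnDl; congr (_ + _ *+ b).
by rewrite rmorphM rmorph_nat -mulrA mulr_natl.
Qed.

End Theta.
End OddPrime.

(** * The models *)

Section TwistCongruences.
Variables (p : nat) (p_pr : prime p) (p_odd : odd p).
Local Notation Z := (Zloc p).
Local Notation W n := (witt p_pr n Z).
Implicit Types (n i j k : nat) (c : Z).

Lemma gh_mod_any k n (a : W n) i j : (k <= i.+1)%N -> (k <= j.+1)%N ->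
  exists c, gh i a = gh j a + p%:R ^+ k * c.
Proof.
wlog lij : i j / (i <= j)%N => [hw ki kj|ki kj].
  have [ij|/ltnW ji] := leqP i j; first exact: hw.
  have [c ->] := hw j i ji kj ki; exists (- c); ring.
have /(pdvdP p_pr)[c cE] := gh_mod a lij.
exists (- (p%:R ^+ (i.+1 - k) * c)).
rewrite -(subrK (gh i a) (gh j a)) cE -[in X in X * c](subnKC ki) exprD; ring.
Qed.

Lemma twistD n (a a' : W n) j : (j < n)%N -> twist (a + a') j = twist a j + twist a' j.
Proof.
case: j => [|[|j]] jn /=; rewrite ?addr0 // !wdiffD //; last exact: ltnW; ring.
Qed.

(** Both terms of the twist carry the factor p^(j-1), so the ghost components in the Leibniz rule
    matter only modulo p, where they all agree. *)
Lemma twistM n (a a' : W n) j : (j < n)%N ->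
  twist (a * a') j - (gh j a * twist a' j + gh n.-1 a' * twist a j) \in pdvd j.
Proof.
case: j => [|i] jn; first exact: pdvd0.
rewrite /twist; set l := n.-1.
have [u1 uE1] := gh_mod_any (k := 1) a (i := i.+1) (j := i) isT isT.
have [v1 vE1] := gh_mod_any (k := 1) a' (i := i.+1) (j := l) isT isT.
rewrite !wdiffM //; last exact: ltnW.
rewrite /= uE1 vE1.
case: i jn u1 uE1 v1 vE1 => [|i] jn u1 uE1 v1 vE1.
  apply/(pdvdP p_pr); exists (wdiff a 1 * v1 - u1 * wdiff a' 1); ring.
have [u0 uE0] := gh_mod_any (k := 1) a (i := i.+1) (j := i) isT isT.
have [v0 vE0] := gh_mod_any (k := 1) a' (i := i.+1) (j := l) isT isT.
rewrite /= uE0 vE0; apply/(pdvdP p_pr).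
exists (wdiff a i.+2 * v1 - u1 * wdiff a' i.+2 + (q3 p)%:R * (wdiff a i.+1 * v0
  - (u0 + u1) * wdiff a' i.+1)).
rewrite !exprS expr0; ring.
Qed.

Lemma twist1 n j : (j < n)%N -> twist (1 : W n) j = 0.
Proof.
case: j => [|[|j]] jn //=; rewrite !wdiff1 //; try exact: ltnW; rewrite /=; ring.
Qed.

Lemma twistR n (a : W n.+1) j : (j < n)%N -> twist (wittR a) j = twist a j.
Proof.
by case: j => [|[|j]] jn //=; rewrite !wdiffR //; exact: ltnW.
Qed.

(** For j = 1 the sides differ by the [q3] term, which the twist omits at index 1; it is divisible
    by p. From j = 2 on they are equal. *)
Lemma twistF n (a : W n.+1) j : (j < n)%N ->
  twist a j.+1 - twist (wittF a) j \in pdvd j.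
Proof.
case: j => [|[|j]] jn; first exact: pdvd0.
  rewrite /= !wdiffFS //; apply/(pdvdP p_pr).
  by exists ((q3 p)%:R * wdiff a 1); rewrite expr1 expr0; ring.
rewrite /= !wdiffFS //; last exact: ltnW.
set x := (X in X \in _); have -> : x = 0 by rewrite /x !exprS; ring.
exact: rpred0.
Qed.

(** V moves coordinate 0 of a, which [twist a] ignores, to index 1, where it enters the twist at the
    indices 1 and 2. That coordinate is [gh 0 a], congruent modulo p to the top ghost component,
    whence [tv]. *)
Lemma twistV n (a : W n) j : (j < n)%N ->
  twist (wittV a) j.+1 - (p%:R * twist a j + gh n.-1 a * tv p j.+1) \in pdvd j.+1.
Proof.
rewrite /= wdiffVS; case: j => [|[|j]] jn.
- have [u ->] := gh_mod_any (k := 1) a (i := n.-1) (j := 0%N) isT isT.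
  rewrite wdiffE /tv /=; apply/(pdvdP p_pr); exists (- u); rewrite !expr0; ring.
- have [u ->] := gh_mod_any (k := 1) a (i := n.-1) (j := 0%N) isT isT.
  rewrite wdiffVS (wdiffE a 0) /tv /= natrM; apply/(pdvdP p_pr).
  by exists (- ((q3 p)%:R * u)); rewrite !exprS expr0; ring.
- rewrite wdiffVS /tv /=.
  set x := (X in X \in _); have -> : x = 0 by rewrite /x !exprS; ring.
  exact: rpred0.
Qed.

(* For p = 2 the last binomial term is only divisible by p^(2m). *)
Lemma expp_expand m (u t : Z) : (0 < m)%N -> exists z,
  (u + p%:R ^+ m * t) ^+ p
  = u ^+ p + p%:R ^+ m.+1 * (u ^+ p.-1 * t) + p%:R ^+ (m + m).+1 * z.
Proof.
move=> m_gt0; have p_gt2 := odd_prime_gt2 p_odd p_pr.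
set P : Z := p%:R; pose f k : Z := u ^+ (p - k) * (P ^+ m * t) ^+ k *+ 'C(p, k).
suff /(pdvdP p_pr)[z zE] : \sum_(2 <= k < p.+1) f k \in pdvd (m + m).+1.
  exists z; rewrite -/P -zE exprDn.
  rewrite -(big_mkord xpredT f) big_ltn // big_ltn; last by rewrite ltnW // ltnW.
  rewrite addrA; congr (_ + _ + _); rewrite /f; first by rewrite subn0 mulr1 bin0.
  by rewrite bin1 subn1 expr1 -mulr_natr exprSr -/P; ring.
rewrite big_nat_cond; apply: rpred_sum => k; rewrite andbT => /andP[k2].
rewrite ltnS leq_eqVlt /f exprMn -exprM => /predU1P[->|kp].
  rewrite subnn expr0 mul1r binn mulr1n; apply: pdvdMr => //.
  rewrite -[P ^+ _]mulr1; apply: pdvd_pX => //.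
  by nia.
have /dvdnP[q ->] : (p %| 'C(p, k))%N by apply: prime_dvd_bin; rewrite // kp ltnW.
rewrite -mulr_natr natrM -/P.
set x := (X in X \in _); have -> : x = P ^+ (m * k).+1 * (u ^+ (p - k) * t ^+ k * q%:R).
  by rewrite /x exprS; ring.
by apply: pdvd_pX => //; nia.
Qed.

(** F d[c] = [c]^(p-1) d[c] in coordinates. The ghost components w_j of [c] satisfy w_(j+1) = w_j^p,
    so the p-th power of w_(j+1) = w_j + p^(j+1) t gives the next difference quotient as w_j^(p-1) t
    modulo p^(j+1). There w_j may be replaced by w_(j+1). *)
Lemma wdiff_teichS n c j : (j.+2 < n)%N ->
  wdiff (teich p_pr n c) j.+2
  - gh j.+1 (teich p_pr n c) ^+ p.-1 * wdiff (teich p_pr n c) j.+1 \in pdvd j.+1.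
Proof.
move=> jn; set x := teich p_pr n c; set t := wdiff x j.+1; set w := gh j.+1 x.
have wE : w = gh j x + p%:R ^+ j.+1 * t by rewrite /w wdiffE.
have ghp i : (i.+1 < n)%N -> gh i.+1 x = gh i x ^+ p.
  by move=> lin; rewrite !gh_teich ?expnSr ?exprM // ltnW.
have [z zE] := expp_expand (gh j x) t (ltn0Sn j).
have sE : wdiff x j.+2 = gh j x ^+ p.-1 * t + p%:R ^+ j.+1 * z.
  apply: wdiff_uniq; rewrite /= ghp // -/w {1}wE zE -ghp; last exact: ltnW.
  by rewrite -/w mulrDr addrA; congr (_ + _); rewrite mulrA -exprD addSn.
rewrite sE addrAC -mulrBl; apply: rpredD; last exact: pdvd_pX.
apply: pdvdMr => //; rewrite -rpredN opprB subrXX wE addrAC subrr add0r -mulrA.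
exact: pdvd_pX.
Qed.

End TwistCongruences.

(* The class of (e, t) stands for \sum_j e_j dV^j(1) + t dlog[p] at level n. If [b] is
   false, then t only matters modulo p^0, so that the summand of dlog[p] vanishes. *)
Section LogModule.
Variables (p : nat).
Local Notation Z := (Zloc p).
Variables (b : bool) (n : nat).
Implicit Types (e : nat -> Z) (t : Z).

(** Polynomials serve as coefficient sequences with the choice structure that the quotient requires;
    coefficients from n on are ignored. *)
Definition Nzero : {pred {poly Z} * Z} :=
  fun x => [forall j : 'I_n, x.1`_j \in pdvd j] && (x.2 \in pdvd (b * n)).

Lemma NzeroP (x : {poly Z} * Z) :
  reflect ((forall j, (j < n)%N -> x.1`_j \in pdvd j) /\ x.2 \in pdvd (b * n))
          (x \in Nzero).
Proof.
apply: (iffP andP) => -[x1 x2]; split=> //.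
  by move=> j jn; have /forallP/(_ (Ordinal jn)) := x1.
by apply/forallP => j; apply: x1.
Qed.

Lemma Nzero_zmod_closed : zmod_closed Nzero.
Proof.
split=> [|x y /NzeroP[x1 x2] /NzeroP[y1 y2]]; apply/NzeroP; split=> /=.
- by move=> j _; rewrite coef0 rpred0.
- exact: rpred0.
- by move=> j jn; rewrite coefB rpredB ?x1 ?y1.
- exact: rpredB.
Qed.

HB.instance Definition _ := GRing.isZmodClosed.Build _ Nzero Nzero_zmod_closed.

Definition logN : zmodType := {ideal_quot Nzero}.

Definition mkN e t : logN := \pi_({ideal_quot Nzero})%qT (\poly_(j < n) e j, t).
Definition coN (x : logN) j : Z := (repr (x : {ideal_quot Nzero})).1`_j.
Definition ctN (x : logN) : Z := (repr (x : {ideal_quot Nzero})).2.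

Lemma pi_Nzero (x y : {poly Z} * Z) :
  (\pi_({ideal_quot Nzero})%qT x = \pi_({ideal_quot Nzero})%qT y) <-> x - y \in Nzero.
Proof.
by rewrite Quotient.idealrBE; split=> [->|/eqP].
Qed.

Lemma mkN_eq e e' t t' :
  mkN e t = mkN e' t' <->
  (forall j, (j < n)%N -> e j - e' j \in pdvd j) /\ t - t' \in pdvd (b * n).
Proof.
rewrite pi_Nzero; split=> [/NzeroP[/= ee' tt']|[ee' tt']].
  by split=> // j jn; have := ee' j jn; rewrite coefB !coef_poly jn.
by apply/NzeroP; split=> //= j jn; rewrite coefB !coef_poly jn; apply: ee'.
Qed.

Lemma mkN_ext e e' t : (forall j, (j < n)%N -> e j = e' j) -> mkN e t = mkN e' t.
Proof.
by move=> ee'; apply/mkN_eq; split=> [j jn|]; rewrite ?ee' // subrr rpred0.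
Qed.

Lemma mkNK x : mkN (coN x) (ctN x) = x.
Proof.
rewrite -[RHS]reprK; apply/pi_Nzero/NzeroP; split=> [j jn|] /=.
  by rewrite coefB coef_poly jn subrr rpred0.
by rewrite subrr rpred0.
Qed.

Lemma mkNP (P : logN -> Type) : (forall e t, P (mkN e t)) -> forall x, P x.
Proof. by move=> Pmk x; rewrite -[x]mkNK. Qed.

Lemma mkN_rep e t :
  (forall j, (j < n)%N -> coN (mkN e t) j - e j \in pdvd j) /\
  ctN (mkN e t) - t \in pdvd (b * n).
Proof. by apply/mkN_eq; rewrite mkNK. Qed.

Lemma mkN_B e e' t t' : mkN e t - mkN e' t' = mkN (fun j => e j - e' j) (t - t').
Proof.
rewrite /mkN -(raddfB (\pi_({ideal_quot Nzero})%qT)).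
apply/pi_Nzero/NzeroP; split=> [j jn|] /=.
  by rewrite !coefB !coef_poly jn subrr rpred0.
by rewrite subrr rpred0.
Qed.

Lemma mkN0 : mkN (fun=> 0) 0 = 0.
Proof. by rewrite -[RHS](subrr (mkN (fun=> 0) 0)) mkN_B subrr. Qed.

Lemma mkN_N e t : - mkN e t = mkN (fun j => - e j) (- t).
Proof.
rewrite -sub0r -mkN0 mkN_B sub0r; apply: mkN_ext => j _; exact: sub0r.
Qed.

Lemma mkN_D e e' t t' : mkN e t + mkN e' t' = mkN (fun j => e j + e' j) (t + t').
Proof.
by rewrite -[mkN e' t']opprK mkN_N mkN_B opprK; apply: mkN_ext => j _; rewrite opprK.
Qed.

Lemma mkN_Mn e t m : mkN e t *+ m = mkN (fun j => e j *+ m) (t *+ m).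
Proof.
elim: m => [|m IH]; first by rewrite !mulr0n -mkN0; apply: mkN_ext.
by rewrite mulrSr IH mkN_D mulrSr; apply: mkN_ext => j _; rewrite mulrSr.
Qed.

End LogModule.

(** This and the next operations compute on chosen representatives; [NactE], [NRE], [NFE] and [NVE]
    show that any representative gives the same class. *)
HB.lock Definition Nact (p : nat) (p_pr : prime p) (b : bool) (n : nat)
    (a : witt p_pr n (Zloc p)) (x : logN p b n) : logN p b n :=
  mkN b n (fun j => gh j a * coN x j + (ctN x * twist a j) *+ b) (gh n.-1 a * ctN x).

HB.lock Definition NR (p : nat) (b : bool) (n : nat) (x : logN p b n.+1) : logN p b n :=
  mkN b n (coN x) (ctN x).

HB.lock Definition NF (p : nat) (b : bool) (n : nat) (x : logN p b n.+1) : logN p b n :=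
  mkN b n (fun j => coN x j.+1) (ctN x).

HB.lock Definition NV (p : nat) (b : bool) (n : nat) (x : logN p b n) : logN p b n.+1 :=
  mkN b n.+1 (fun j => (if j is i.+1 then p%:R * coN x i else 0) + (ctN x * tv p j) *+ b)
    (p%:R * ctN x).

HB.lock Definition Nd (p : nat) (p_pr : prime p) (b : bool) (n : nat)
    (a : witt p_pr n (Zloc p)) : logN p b n :=
  mkN b n (wdiff a) 0.

(** * Witt complex identities on the degree 1 module *)

Section LogOps.
Variables (p : nat) (p_pr : prime p) (b : bool).
Local Notation Z := (Zloc p).
Local Notation W n := (witt p_pr n Z).
Local Notation N n := (logN p b n).
Local Notation mk := (mkN b _).
Implicit Types (n i j k : nat) (e : nat -> Z) (t : Z).

Lemma pdvd_b n j t x : t \in pdvd (b * n) -> (j <= n)%N -> (t * x) *+ b \in pdvd j.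
Proof.
case: b => [tn jn|_ _]; last exact: rpred0.
by apply: pdvdMr => //; apply: pdvdX jn _ => //; rewrite mul1n in tn.
Qed.

Lemma NactE n (a : W n) e t :
  Nact a (mk e t) = mk (fun j => gh j a * e j + (t * twist a j) *+ b) (gh n.-1 a * t).
Proof.
have [ee' tt'] := mkN_rep b n e t; rewrite Nact.unlock.
apply/mkN_eq; split=> [j jn|]; last by rewrite -mulrBr; apply: pdvdMl.
rewrite opprD addrACA -mulrBr -mulrnBl -mulrBl; apply: rpredD.
  by apply: pdvdMl => //; apply: ee'.
exact: pdvd_b tt' (ltnW jn).
Qed.

Lemma NRE n e t : NR (mk e t : N n.+1) = mk e t.
Proof.
have [ee' tt'] := mkN_rep b n.+1 e t; rewrite NR.unlock.
apply/mkN_eq; split=> [j jn|]; first by apply: ee'; apply: ltnW.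
by apply: pdvdX tt' => //; rewrite leq_mul2l leqnSn orbT.
Qed.

Lemma NFE n e t : NF (mk e t : N n.+1) = mk (fun j => e j.+1) t.
Proof.
have [ee' tt'] := mkN_rep b n.+1 e t; rewrite NF.unlock.
apply/mkN_eq; split=> [j jn|]; first by apply: pdvdX (ee' j.+1 _).
by apply: pdvdX tt' => //; rewrite leq_mul2l leqnSn orbT.
Qed.

Lemma NVE n e t : NV (mk e t : N n) =
  mk (fun j => (if j is i.+1 then p%:R * e i else 0) + (t * tv p j) *+ b) (p%:R * t).
Proof.
have [ee' tt'] := mkN_rep b n e t; rewrite NV.unlock.
apply/mkN_eq; split=> [j jn|].
  rewrite opprD addrACA -mulrnBl -mulrBl; apply: rpredD; last exact: pdvd_b tt' jn.
  case: j jn => [|j] jn; first by rewrite subrr rpred0.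
  rewrite -mulrBr; have /(pdvdP p_pr)[z ->] := ee' j jn.
  by rewrite mulrA -exprS; apply: pdvd_pX.
rewrite -mulrBr; case: b tt' => [|_]; last exact: pdvd0.
rewrite !mul1n => /(pdvdP p_pr)[z ->].
by rewrite mulrA -exprS; apply: pdvd_pX.
Qed.

Lemma NdE n (a : W n) : Nd b a = mk (wdiff a) 0.
Proof. by rewrite Nd.unlock. Qed.

Lemma Nact_is_zmod_morphism n (a : W n) : zmod_morphism (@Nact p p_pr b n a).
Proof.
elim/mkNP=> e t; elim/mkNP=> e' t'; rewrite mkN_B !NactE mkN_B -mulrBr.
by apply: mkN_ext => j _; ring.
Qed.

Lemma NR_is_zmod_morphism n : zmod_morphism (@NR p b n).
Proof. by elim/mkNP=> e t; elim/mkNP=> e' t'; rewrite mkN_B !NRE mkN_B. Qed.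

Lemma NF_is_zmod_morphism n : zmod_morphism (@NF p b n).
Proof. by elim/mkNP=> e t; elim/mkNP=> e' t'; rewrite mkN_B !NFE mkN_B. Qed.

Lemma NV_is_zmod_morphism n : zmod_morphism (@NV p b n).
Proof.
elim/mkNP=> e t; elim/mkNP=> e' t'; rewrite mkN_B !NVE mkN_B -mulrBr.
by apply: mkN_ext => -[|j] _; ring.
Qed.

Lemma Nd_is_zmod_morphism n : zmod_morphism (@Nd p p_pr b n).
Proof.
move=> a a'; rewrite !NdE mkN_B subr0; apply: mkN_ext => j jn; exact: wdiffB.
Qed.

Lemma Nact1 n (x : N n) : Nact (1 : W n) x = x.
Proof.
elim/mkNP: x => e t; rewrite NactE; apply/mkN_eq; split=> [j jn|].
  by rewrite gh1 // twist1 // mul1r mulr0 mul0rn addr0 subrr rpred0.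
case: n => [|n]; first by rewrite muln0 pdvd0.
by rewrite gh1 // mul1r subrr rpred0.
Qed.

Lemma Nact_addl n (x : N n) (a a' : W n) : Nact (a + a') x = Nact a x + Nact a' x.
Proof.
elim/mkNP: x => e t; rewrite !NactE mkN_D; apply/mkN_eq; split=> [j jn|].
  rewrite ghD // twistD //; set x := (X in X \in _).
  have -> : x = 0 by rewrite /x; ring.
  exact: rpred0.
case: n a a' => [|n] a a'; first by rewrite muln0 pdvd0.
by rewrite ghD // mulrDl subrr rpred0.
Qed.

Lemma NactM n (x : N n) (a a' : W n) : Nact (a * a') x = Nact a (Nact a' x).
Proof.
elim/mkNP: x => e t; rewrite !NactE; apply/mkN_eq; split=> [j jn|].
  rewrite ghM //; have := twistM a a' jn; set u := twist (a * a') j => D.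
  set x := (X in X \in _).
  have -> : x = (t * (u - (gh j a * twist a' j + gh n.-1 a' * twist a j))) *+ b.
    by rewrite /x; ring.
  by case: b => /=; [apply: pdvdMl | apply: rpred0].
case: n a a' => [|n] a a'; first by rewrite muln0 pdvd0.
by rewrite ghM // mulrA subrr rpred0.
Qed.

Lemma NR_act n (a : W n.+1) (x : N n.+1) : NR (Nact a x) = Nact (wittR a) (NR x).
Proof.
elim/mkNP: x => e t; rewrite NactE !NRE NactE; apply/mkN_eq; split=> [j jn|].
  by rewrite ghR // twistR // subrr rpred0.
case: n a => [|n] a; first by rewrite muln0 pdvd0.
(* The scalar acting on dlog[p] is the top ghost component, which changes with the level; Dwork's
   congruence makes the two agree modulo the order of dlog[p]. *)
rewrite -mulrBl; apply: pdvdMr => //; rewrite ghR //=.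
by case: b; rewrite ?mul1n; [apply: dwork | apply: pdvd0].
Qed.

Lemma NF_act n (a : W n.+1) (x : N n.+1) : NF (Nact a x) = Nact (wittF a) (NF x).
Proof.
elim/mkNP: x => e t; rewrite NactE !NFE NactE; apply/mkN_eq; split=> [j jn|].
  rewrite ghF //; have D := twistF a jn.
  rewrite opprD addrACA subrr add0r -mulrnBl -mulrBr.
  by case: b => /=; [apply: pdvdMl | apply: rpred0].
case: n a => [|n] a; first by rewrite muln0 pdvd0.
by rewrite ghF // subrr rpred0.
Qed.

Lemma NV_actF n (a : W n.+1) (x : N n) : Nact a (NV x) = NV (Nact (wittF a) x).
Proof.
elim/mkNP: x => e t; rewrite NVE !NactE NVE; apply/mkN_eq; split=> [j jn|].
  case: j jn => [_|j jn]; first exact: pdvd0.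
  rewrite ghF //; set x := (X in X \in _).
  have -> : x = (t * tv p j.+1 * (gh j.+1 a - gh n.-1 (wittF a))
                 + t * (p%:R * (twist a j.+1 - twist (wittF a) j))) *+ b.
    by rewrite /x; ring.
  case: b => /=; last exact: rpred0.
  have n_gt0 : (0 < n)%N := leq_ltn_trans (leq0n j) jn.
  rewrite ghF ?prednK //; apply: rpredD.
    have [c ->] := gh_mod_any (k := j.+1) a (leqnSn j.+1) (leqW jn : (j < n.+1)%N).
    by rewrite addrAC subrr add0r; apply: pdvdMl => //; apply: pdvd_pX.
  have /(pdvdP p_pr)[z ->] := twistF a jn.
  by rewrite [p%:R * _]mulrA -exprS; apply: pdvdMl => //; apply: pdvd_pX.
case: n a => [|n] a /=; last first.
  by rewrite ghF // mulrCA subrr rpred0.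
set x := (X in X \in _); have -> : x = p%:R ^+ 1 * (gh 0 a * t - gh 0 (wittF a) * t).
  by rewrite /x expr1; ring.
by apply: pdvd_pX; rewrite // muln1 leq_b1.
Qed.

Lemma NV_act n (a : W n) (x : N n.+1) : Nact (wittV a) x = NV (Nact a (NF x)).
Proof.
elim/mkNP: x => e t; rewrite NactE NFE NactE NVE; apply/mkN_eq; split=> [j jn|].
  case: j jn => [_|j jn]; first exact: pdvd0.
  rewrite ghVS; set x := (X in X \in _).
  have -> : x = (t * (twist (wittV a) j.+1
                 - (p%:R * twist a j + gh n.-1 a * tv p j.+1))) *+ b.
    by rewrite /x; ring.
  case: b => /=; last exact: rpred0.
  by apply: pdvdMl => //; apply: twistV.
case: n a => [|n] a /=; last by rewrite ghVS mulrA subrr rpred0.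
rewrite ghV0 mul0r sub0r rpredN -[p%:R]expr1.
by apply: pdvd_pX; rewrite // muln1 leq_b1.
Qed.

Lemma NFR n (x : N n.+2) : NR (NF x) = NF (NR x).
Proof. by elim/mkNP: x => e t; rewrite NFE !NRE NFE. Qed.

Lemma NVR n (x : N n.+1) : NR (NV x) = NV (NR x).
Proof. by elim/mkNP: x => e t; rewrite NVE !NRE NVE. Qed.

Lemma NFV n (x : N n) : NF (NV x) = x *+ p.
Proof.
elim/mkNP: x => e t; rewrite NVE NFE mkN_Mn; apply/mkN_eq; split=> [j jn|].
  (* Moved down one index by F, the values 1 and q3 p of [tv] are read modulo p^0 and p^1, so they
     vanish. *)
  set x := (X in X \in _); have -> : x = (t * tv p j.+1) *+ b by rewrite /x; ring.
  case: b => /=; last exact: rpred0.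
  apply: pdvdMl => //; case: j {jn x} => [|[|j]]; first exact: pdvd0.
    rewrite /tv /=; apply/(pdvdP p_pr); exists (q3 p)%:R.
    by rewrite natrM expr1 mulrC.
  exact: rpred0.
by rewrite mulr_natl subrr rpred0.
Qed.

Lemma NdR n (a : W n.+1) : NR (Nd b a) = Nd b (wittR a).
Proof. by rewrite !NdE NRE; apply: mkN_ext => j jn; rewrite wdiffR. Qed.

Lemma NFdV n (a : W n) : NF (Nd b (wittV a)) = Nd b a.
Proof. by rewrite !NdE NFE; apply: mkN_ext => j jn; rewrite wdiffVS. Qed.

(** [wdiffM] has a ghost component at j - 1 where the action has it at j; they differ by a multiple
    of p^j, which is zero on dV^j(1). *)
Lemma NdM n (a a' : W n) : Nd b (a * a') = Nact a (Nd b a') + Nact a' (Nd b a).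
Proof.
rewrite !NdE !NactE mkN_D; apply/mkN_eq; split=> [j jn|].
  rewrite wdiffM // (wdiffE a); apply/(pdvdP p_pr).
  by exists (- (wdiff a j * wdiff a' j)); ring.
by rewrite !mulr0 addr0 subrr rpred0.
Qed.

Lemma NFd_teich n (p_odd : odd p) (c : Z) : NF (Nd b (teich p_pr n.+1 c))
  = Nact (teich p_pr n c ^+ p.-1) (Nd b (teich p_pr n c)).
Proof.
rewrite !NdE NFE NactE; apply/mkN_eq; split=> [j jn|]; last first.
  by rewrite mulr0 subrr rpred0.
rewrite mul0r mul0rn addr0 ghX // gh_teich //.
case: j jn => [|j] jn; first exact: pdvd0.
rewrite -[in wdiff (teich _ n c)]wittR_teich wdiffR //.
have := wdiff_teichS p_pr p_odd (n := n.+1) c jn; by rewrite gh_teich // ltnW.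
Qed.

End LogOps.

Local Opaque witt_add witt_mul witt_opp.

(** * The square-zero extension as a Witt complex *)

Section Model.
Variables (p : nat) (p_pr : prime p) (b : bool).
Local Notation Z := (Zloc p).
Local Notation W n := (witt p_pr n Z).
Local Notation N n := (logN p b n).
Implicit Types (n i j k : nat).

HB.instance Definition _ n (a : W n) :=
  GRing.isZmodMorphism.Build (N n) (N n) (@Nact p p_pr b n a) (Nact_is_zmod_morphism a).
HB.instance Definition _ n :=
  GRing.isZmodMorphism.Build (N n.+1) (N n) (@NR p b n) (@NR_is_zmod_morphism p p_pr b n).
HB.instance Definition _ n :=
  GRing.isZmodMorphism.Build (N n.+1) (N n) (@NF p b n) (@NF_is_zmod_morphism p p_pr b n).
HB.instance Definition _ n :=
  GRing.isZmodMorphism.Build (N n) (N n.+1) (@NV p b n) (@NV_is_zmod_morphism p p_pr b n).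
HB.instance Definition _ n :=
  GRing.isZmodMorphism.Build (W n) (N n) (@Nd p p_pr b n) (@Nd_is_zmod_morphism p p_pr b n).

Lemma Nact0 n (x : N n) : Nact (0 : W n) x = 0.
Proof. by apply: (addrI (Nact (0 : W n) x)); rewrite -Nact_addl !addr0. Qed.

Definition model n : Type := (W n * N n)%type.

Section Ring.
Variable n : nat.
Implicit Types x y z : model n.

HB.instance Definition _ := GRing.Zmodule.copy (model n) (W n * N n)%type.

Lemma modelD (a a' : W n) (u u' : N n) :
  ((a, u) : model n) + ((a', u') : model n) = (a + a', u + u').
Proof. by []. Qed.

Definition model_mul x y : model n := (x.1 * y.1, Nact x.1 y.2 + Nact y.1 x.2).
Definition model_one : model n := (1, 0).

Lemma model_mulA : associative model_mul.
Proof.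
move=> [a u] [a' u'] [a'' u'']; rewrite /model_mul /= mulrA.
by rewrite !raddfD /= -!NactM -addrA [a'' * a]mulrC [a'' * a']mulrC.
Qed.

Lemma model_mulC : commutative model_mul.
Proof.
by move=> [a u] [a' u']; rewrite /model_mul /= [a * a']mulrC [Nact a u' + _]addrC.
Qed.

Lemma model_mul1 : left_id model_one model_mul.
Proof. by move=> [a u]; rewrite /model_mul /= mul1r raddf0 Nact1 addr0. Qed.

Lemma model_mulD : left_distributive model_mul +%R.
Proof.
move=> [a u] [a' u'] [a'' u'']; rewrite modelD /model_mul /= modelD.
rewrite mulrDl Nact_addl raddfD /= [X in (_, X)]addrACA; reflexivity.
Qed.

HB.instance Definition _ := GRing.Zmodule_isComPzRing.Build (model n)
  model_mulA model_mulC model_mul1 model_mulD.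

Lemma modelM (a a' : W n) (u u' : N n) :
  ((a, u) : model n) * ((a', u') : model n) = (a * a', Nact a u' + Nact a' u).
Proof. by []. Qed.

Lemma modelB (a a' : W n) (u u' : N n) :
  ((a, u) : model n) - ((a', u') : model n) = (a - a', u - u').
Proof. by []. Qed.

Definition model_part i x : Prop :=
  match i with 0 => x.2 = 0 | 1 => x.1 = 0 | _ => x = 0 end.

Lemma model_part0 i : model_part i 0.
Proof. by case: i => [|[]]. Qed.

Lemma model_partB i x y : model_part i x -> model_part i y -> model_part i (x - y).
Proof.
case: i => [|[|i]] /=; last by move=> -> ->; rewrite subrr.
  by case: x y => [a u] [a' u'] /= -> ->; rewrite subrr.
by case: x y => [a u] [a' u'] /= -> ->; rewrite subrr.
Qed.

Lemma model_mul11 x y : x.1 = 0 -> y.1 = 0 -> x * y = 0.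
Proof.
by case: x y => [a u] [a' u'] /= -> ->; rewrite modelM mulr0 !Nact0 addr0.
Qed.

Lemma model_partM i j x y :
  model_part i x -> model_part j y -> model_part (i + j) (x * y).
Proof.
case: x y => [a u] [a' u']; rewrite modelM.
case: i => [|[|i]] /=; last by case=> -> ->; rewrite mul0r Nact0 raddf0 addr0.
- move=> ->; case: j => [|[|j]] /= h; first by rewrite h !raddf0 addr0.
    by rewrite h mulr0.
  by case: h => -> ->; rewrite mulr0 !raddf0 addr0.
- move=> ->; case: j => [|[|j]] /= h; first by rewrite mul0r.
    by rewrite h mul0r !Nact0 addr0.
  by case: h => -> ->; rewrite mulr0 !Nact0 addr0.
Qed.

Lemma model_part_span x : exists m (c : nat -> model n),
  (forall i, model_part i (c i)) /\ x = \sum_(i < m) c i.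
Proof.
exists 2%N, (fun i => match i with 0 => (x.1, 0) | 1 => (0, x.2) | _ => 0 end).
split=> [[|[]]//|]; rewrite big_ord_recr big_ord1 /=.
by case: x => a u; congr pair; rewrite /= ?addr0 ?add0r.
Qed.

Lemma model_part_direct m (c : nat -> model n) :
  (forall i, model_part i (c i)) -> \sum_(i < m) c i = 0 ->
  forall i, (i < m)%N -> c i = 0.
Proof.
move=> hc c0 i im.
have c1 k : k != 0%N -> (c k).1 = 0.
  by case: k => [|[|k]] // _; [exact: (hc 1%N) | rewrite (hc k.+2 : c k.+2 = 0)].
have c2 k : k != 1%N -> (c k).2 = 0.
  by case: k => [|[|k]] // _; [exact: (hc 0%N) | rewrite (hc k.+2 : c k.+2 = 0)].
have ne_i (k : 'I_m) : k != Ordinal im -> k != i :> nat by [].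
case: i im ne_i => [|[|i]] im ne_i; last exact: (hc i.+2).
- have : \sum_(k < m) (c k).1 = 0 by rewrite -raddf_sum c0.
  rewrite (bigD1 (Ordinal im)) //= big1 => [|k /ne_i/c1 //]; rewrite addr0.
  by have := c2 0%N isT; case: (c 0%N) => a u /= -> ->.
- have : \sum_(k < m) (c k).2 = 0 by rewrite -raddf_sum c0.
  rewrite (bigD1 (Ordinal im)) //= big1 => [|k /ne_i/c2 //]; rewrite addr0.
  by have := c1 1%N isT; case: (c 1%N) => a u /= -> ->.
Qed.

Lemma model_part_comm i j x y : model_part i x -> model_part j y ->
  x * y = (-1) ^+ (i * j) * (y * x).
Proof.
case: i => [|[|i]]; first by rewrite mul0n expr0 mul1r mulrC.
  case: j => [|[|j]]; first by rewrite muln0 expr0 mul1r mulrC.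
    by move=> hx hy; rewrite (model_mul11 hx hy) (model_mul11 hy hx) mulr0.
  by move=> _ /= ->; rewrite mulr0 mul0r mulr0.
by move=> /= ->; rewrite mulr0 mul0r mulr0.
Qed.

Definition model_graded : gradedRing := GradedRing model_part0 model_partB
  (erefl : model_part 0 1) model_partM model_part_span model_part_direct
  model_part_comm.

End Ring.

Definition model_lambda n (a : W n) : model n := (a, 0).
Definition model_R n (x : model n.+1) : model n := (wittR x.1, NR x.2).
Definition model_F n (x : model n.+1) : model n := (wittF x.1, NF x.2).
Definition model_V n (x : model n) : model n.+1 := (wittV x.1, NV x.2).
Definition model_d n (x : model n) : model n := (0, Nd b x.1).

Lemma model_lambda_is_zmod_morphism n : zmod_morphism (@model_lambda n).
Proof. by move=> x y; rewrite /model_lambda modelB subr0. Qed.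
Lemma model_lambda_is_monoid_morphism n : monoid_morphism (@model_lambda n).
Proof. by split=> [//|x y]; rewrite /model_lambda modelM !raddf0 addr0. Qed.
Lemma model_R_is_zmod_morphism n : zmod_morphism (@model_R n).
Proof. by move=> [a u] [a' u']; congr pair; rewrite /= raddfB. Qed.
Lemma model_R_is_monoid_morphism n : monoid_morphism (@model_R n).
Proof.
split=> [|[a u] [a' u']]; congr pair; rewrite /= ?rmorph1 ?raddf0 ?rmorphM //.
by rewrite raddfD /= !NR_act.
Qed.
Lemma model_F_is_zmod_morphism n : zmod_morphism (@model_F n).
Proof. by move=> [a u] [a' u']; congr pair; rewrite /= raddfB. Qed.
Lemma model_F_is_monoid_morphism n : monoid_morphism (@model_F n).
Proof.
split=> [|[a u] [a' u']]; congr pair; rewrite /= ?rmorph1 ?raddf0 ?rmorphM //.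
by rewrite raddfD /= !NF_act.
Qed.
Lemma model_V_is_zmod_morphism n : zmod_morphism (@model_V n).
Proof. by move=> [a u] [a' u']; congr pair; rewrite /= raddfB. Qed.
Lemma model_d_is_zmod_morphism n : zmod_morphism (@model_d n).
Proof. by move=> [a u] [a' u']; congr pair; rewrite /= ?subr0 ?raddfB. Qed.

HB.instance Definition _ n := GRing.isZmodMorphism.Build (W n) (model n)
  (@model_lambda n) (@model_lambda_is_zmod_morphism n).
HB.instance Definition _ n := GRing.isMonoidMorphism.Build (W n) (model n)
  (@model_lambda n) (@model_lambda_is_monoid_morphism n).
HB.instance Definition _ n := GRing.isZmodMorphism.Build (model n.+1) (model n)
  (@model_R n) (@model_R_is_zmod_morphism n).
HB.instance Definition _ n := GRing.isMonoidMorphism.Build (model n.+1) (model n)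
  (@model_R n) (@model_R_is_monoid_morphism n).
HB.instance Definition _ n := GRing.isZmodMorphism.Build (model n.+1) (model n)
  (@model_F n) (@model_F_is_zmod_morphism n).
HB.instance Definition _ n := GRing.isMonoidMorphism.Build (model n.+1) (model n)
  (@model_F n) (@model_F_is_monoid_morphism n).
HB.instance Definition _ n := GRing.isZmodMorphism.Build (model n) (model n.+1)
  (@model_V n) (@model_V_is_zmod_morphism n).
HB.instance Definition _ n := GRing.isZmodMorphism.Build (model n) (model n)
  (@model_d n) (@model_d_is_zmod_morphism n).

Lemma model_level0 (x : model 0) : x = 0.
Proof.
case: x => a u; congr pair; first by apply: gh_ext.
elim/mkNP: u => e t; rewrite -mkN0; apply/mkN_eq; split=> //.
by rewrite muln0 pdvd0.
Qed.

Lemma model_R_part n i (x : model n.+1) : model_part i x -> model_part i (model_R x).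
Proof.
case: x i => [a u] [|[|i]] /=; [| | case]; move=> -> //; rewrite ?raddf0 //.
by move=> ->; rewrite !raddf0.
Qed.

Lemma model_F_part n i (x : model n.+1) : model_part i x -> model_part i (model_F x).
Proof.
case: x i => [a u] [|[|i]] /=; [| | case]; move=> -> //; rewrite ?raddf0 //.
by move=> ->; rewrite !raddf0.
Qed.

Lemma model_V_part n i (x : model n) : model_part i x -> model_part i (model_V x).
Proof.
case: x i => [a u] [|[|i]] /=; [| | case]; move=> -> //; rewrite ?raddf0 //.
by move=> ->; rewrite !raddf0.
Qed.

Lemma model_FR n (x : model n.+2) : model_R (model_F x) = model_F (model_R x).
Proof. by case: x => a u; congr pair; rewrite /= ?wittFR ?NFR. Qed.

Lemma model_VR n (x : model n.+1) : model_R (model_V x) = model_V (model_R x).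
Proof. by case: x => a u; congr pair; rewrite /= ?wittVR ?NVR. Qed.

Lemma model_VF n (x : model n) (y : model n.+1) :
  model_V x * y = model_V (x * model_F y).
Proof.
case: x y => [a u] [a' u']; congr pair; rewrite /= ?wittVF //.
by rewrite NV_act NV_actF raddfD.
Qed.

Lemma model_lambdaV n (a : W n) : model_V (model_lambda a) = model_lambda (wittV a).
Proof. by congr pair; rewrite raddf0. Qed.

Lemma model_lambdaR n (a : W n.+1) : model_R (model_lambda a) = model_lambda (wittR a).
Proof. by congr pair; rewrite raddf0. Qed.

Lemma model_lambdaF n (a : W n.+1) : model_F (model_lambda a) = model_lambda (wittF a).
Proof. by congr pair; rewrite raddf0. Qed.

Lemma model_Mn n (a : W n) (u : N n) m : ((a, u) : model n) *+ m = (a *+ m, u *+ m).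
Proof. by elim: m => [//|m IH]; rewrite !mulrS IH. Qed.

Lemma model_FV n (x : model n) : model_F (model_V x) = x *+ p.
Proof. by case: x => a u; rewrite model_Mn; congr pair; rewrite /= ?wittFV ?NFV. Qed.

Lemma model_d_part n i (x : model n) : model_part i x -> model_part i.+1 (model_d x).
Proof. by case: i => [|[|i]] //= xE; rewrite /model_d xE raddf0. Qed.

Lemma model_dR n (x : model n.+1) : model_R (model_d x) = model_d (model_R x).
Proof. by congr pair; rewrite /= ?raddf0 ?NdR. Qed.

Lemma model_dM n i (x y : model n) : model_part i x ->
  model_d (x * y) = model_d x * y + (-1) ^+ i * (x * model_d y).
Proof.
case: x y => [a u] [a' u']; case: i => [|i] xE.
  rewrite expr0 mul1r !modelM; congr pair; rewrite /= ?mul0r ?mulr0 ?addr0 //.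
  by rewrite NdM !Nact0 addr0 add0r addrC.
have -> : a = 0 by case: i xE => [|i] //= [].
have d0 v : model_d ((0, v) : model n) = 0 by congr pair; rewrite raddf0.
by rewrite modelM mul0r !d0 mul0r (@model_mul11 n (0, u) (0, Nd b a')) // mulr0 addr0.
Qed.

Lemma model_dd n (x : model n) : model_d (model_d x) = 0.
Proof. by congr pair; rewrite raddf0. Qed.

Lemma model_FdV n (x : model n) : model_F (model_d (model_V x)) = model_d x.
Proof. by congr pair; rewrite /= ?raddf0 ?NFdV. Qed.

Lemma model_Fdteich (p_odd : odd p) n (c : Z) :
  model_F (model_d (model_lambda (teich p_pr n.+1 c)))
  = model_lambda (teich p_pr n c) ^+ p.-1 * model_d (model_lambda (teich p_pr n c)).
Proof.
rewrite -rmorphXn modelM; congr pair; rewrite /= ?mulr0 ?raddf0 //.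
by rewrite addr0 NFd_teich.
Qed.

Definition model_complex (p_odd : odd p) : witt_complex p_pr Z :=
  @WittComplex p p_pr Z model_graded
    (fun n => @model_R n) (fun n => @model_lambda n) (fun n => @model_F n)
    (fun n => @model_V n) (fun n => @model_d n)
    model_level0 model_R_part (fun n a => erefl) model_lambdaR
    model_F_part model_FR model_lambdaF
    model_V_part model_VR model_VF model_lambdaV model_FV
    model_d_part model_dR model_dM model_dd model_FdV (model_Fdteich p_odd).

End Model.

HB.lock Definition logN_val (p : nat) (p_pr : prime p) (E : witt_complex p_pr (Zloc p))
    (theta : forall n, E n) (b : bool) (n : nat) (u : logN p b n) : E n :=
  Gsum theta n (coN u) (ctN u).

(** * Maps out of the models *)

Section ModelHom.
Variables (p : nat) (p_pr : prime p) (p_odd : odd p).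
Local Notation Z := (Zloc p).
Local Notation W n := (witt p_pr n Z).
Variables (E : witt_complex p_pr Z) (b : bool) (theta : forall n, E n).
Implicit Types (n i j : nat).

Hypothesis hpart_theta : forall n, hpart 1 (theta n).
Hypothesis wc_F_theta : forall n, wc_F E n (theta n.+1) = theta n.
Hypothesis wc_R_theta : forall n, wc_R E n (theta n.+1) = theta n.
Hypothesis wc_d_theta : forall n, wc_d E n (theta n) = 0.
Hypothesis teichp_theta : forall n,
  if b then wc_lambda E n (teich p_pr n p%:R) * theta n
            = wc_d E n (wc_lambda E n (teich p_pr n p%:R))
  else theta n = 0.

Local Notation lval := (logN_val theta).

Lemma logN_valE n e t : lval (mkN b n e t) = Gsum theta n e t.
Proof.
have [ee' tt'] := mkN_rep b n e t.
rewrite logN_val.unlock; exact: (Gsum_cong p_odd wc_F_theta teichp_theta ee' tt').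
Qed.

Lemma logN_valB n : zmod_morphism (@logN_val p p_pr E theta b n).
Proof.
by elim/mkNP=> e t; elim/mkNP=> e' t'; rewrite mkN_B !logN_valE Gsum_B.
Qed.

HB.instance Definition _ n :=
  GRing.isZmodMorphism.Build (logN p b n) (E n)
    (@logN_val p p_pr E theta b n) (@logN_valB n).

Lemma hpart_logN_val n u : hpart 1 (@logN_val p p_pr E theta b n u).
Proof. by elim/mkNP: u => e t; rewrite logN_valE; apply: hpart_Gsum. Qed.

Lemma lambda_logN_val n (a : W n) (u : logN p b n) :
  wc_lambda E n a * lval u = lval (Nact a u).
Proof.
elim/mkNP: u => e t; rewrite NactE !logN_valE.
exact: (lambda_Gsum p_odd wc_F_theta teichp_theta).
Qed.

Lemma logN_val_mul n (u u' : logN p b n) : lval u * lval u' = 0.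
Proof.
elim/mkNP: u => e t; elim/mkNP: u' => e' t'; rewrite !logN_valE.
exact: (Gsum_mul p_odd hpart_theta wc_F_theta wc_d_theta teichp_theta).
Qed.

Lemma logN_val_d n (a : W n) : lval (Nd b a) = wc_d E n (wc_lambda E n a).
Proof. by rewrite NdE logN_valE (wc_d_lambda_Gsum theta). Qed.

Definition model_val n (x : model p_pr b n) : E n := wc_lambda E n x.1 + lval x.2.

Lemma model_val_is_zmod_morphism n : zmod_morphism (@model_val n).
Proof.
move=> [a u] [a' u']; rewrite modelB /model_val /= !raddfB /=.
by rewrite [in RHS]opprD [RHS]addrACA.
Qed.

Lemma model_val_is_monoid_morphism n : monoid_morphism (@model_val n).
Proof.
split=> [|[a u] [a' u']]; first by rewrite /model_val /= rmorph1 raddf0 addr0.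
rewrite modelM /model_val /= rmorphM raddfD /= mulrDl !mulrDr logN_val_mul addr0.
rewrite lambda_logN_val -!addrA; congr (_ + (_ + _)).
by rewrite -lambda_logN_val (hpart0_comm (wc_lambda_hpart E a') (hpart_logN_val u)).
Qed.

HB.instance Definition _ n := GRing.isZmodMorphism.Build (model p_pr b n) (E n)
  (@model_val n) (@model_val_is_zmod_morphism n).
HB.instance Definition _ n := GRing.isMonoidMorphism.Build (model p_pr b n) (E n)
  (@model_val n) (@model_val_is_monoid_morphism n).

Lemma model_val_hpart n i (x : model p_pr b n) :
  model_part i x -> hpart i (model_val x).
Proof.
case: x i => [a u] [|[|i]] /= xE; rewrite /model_val /=.
- by rewrite xE raddf0 addr0; apply: wc_lambda_hpart.
- by rewrite xE raddf0 add0r; apply: hpart_logN_val.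
- by case: xE => -> ->; rewrite !raddf0 addr0; apply: hpart0.
Qed.

Lemma model_valR n (x : model p_pr b n.+1) :
  model_val (model_R x) = wc_R E n (model_val x).
Proof.
case: x => a u; rewrite /model_val /= raddfD /= wc_lambdaR; congr (_ + _).
elim/mkNP: u => e t; rewrite (NRE p_pr) !logN_valE.
by rewrite (wc_R_Gsum wc_R_theta).
Qed.

Lemma model_val_lambda n (a : W n) : model_val (model_lambda b a) = wc_lambda E n a.
Proof. by rewrite /model_val /= raddf0 addr0. Qed.

Lemma model_vald n (x : model p_pr b n) : model_val (model_d x) = wc_d E n (model_val x).
Proof.
case: x => a u; rewrite /model_val /= raddf0 add0r logN_val_d raddfD /=.
by elim/mkNP: u => e t; rewrite logN_valE (wc_d_Gsum wc_d_theta) addr0.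
Qed.

Lemma model_valF n (x : model p_pr b n.+1) :
  model_val (model_F x) = wc_F E n (model_val x).
Proof.
case: x => a u; rewrite /model_val /= raddfD /= wc_lambdaF; congr (_ + _).
elim/mkNP: u => e t; rewrite (NFE p_pr) !logN_valE.
by rewrite (wc_F_Gsum wc_F_theta).
Qed.

Lemma model_valV n (x : model p_pr b n) :
  model_val (model_V x) = wc_V E n (model_val x).
Proof.
case: x => a u; rewrite /model_val /= raddfD /= wc_lambdaV; congr (_ + _).
elim/mkNP: u => e t; rewrite (NVE p_pr) !logN_valE.
by rewrite (wc_V_Gsum p_odd hpart_theta wc_F_theta teichp_theta).
Qed.

Definition model_hom : wc_hom (model_complex p_pr b p_odd) E :=
  @WcHom p p_pr Z (model_complex p_pr b p_odd) E (fun n => @model_val n)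
    model_val_hpart model_valR model_val_lambda model_vald model_valF model_valV.

End ModelHom.

(** * Composition of morphisms and endomorphisms of initial objects *)

Section WcHoms.
Variables (p : nat) (p_pr : prime p) (A : comNzRingType).
Implicit Types E : witt_complex p_pr A.

Definition wc_comp E1 E2 E3 (g : wc_hom E2 E3) (f : wc_hom E1 E2) : wc_hom E1 E3.
Proof.
apply: (@WcHom _ _ _ E1 E3 (fun n => g n \o f n)) => n.
- by move=> i x hx; do 2!apply: wc_map_hpart.
- by move=> x; rewrite /= !wc_mapR.
- by move=> a; rewrite /= !wc_map_lambda.
- by move=> x; rewrite /= !wc_mapd.
- by move=> x; rewrite /= !wc_mapF.
- by move=> x; rewrite /= !wc_mapV.
Defined.

Definition wc_id E : wc_hom E E :=
  @WcHom _ _ _ E E (fun n => idfun) (fun _ _ _ h => h) (fun _ _ => erefl)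
    (fun _ _ => erefl) (fun _ _ => erefl) (fun _ _ => erefl) (fun _ _ => erefl).

Lemma wc_map_Vone E1 E2 (f : wc_hom E1 E2) n i :
  f n (wc_Vone E1 n i) = wc_Vone E2 n i.
Proof.
elim: i n => [|i IH] [|n]; rewrite /= ?rmorph1 //; first exact: rmorph0.
by rewrite wc_mapV IH.
Qed.

Lemma wc_map_dVone E1 E2 (f : wc_hom E1 E2) n i :
  f n (wc_d E1 n (wc_Vone E1 n i)) = wc_d E2 n (wc_Vone E2 n i).
Proof. by rewrite wc_mapd wc_map_Vone. Qed.

Lemma wc_endo_id E (f : wc_hom E E) : is_de_Rham_Witt E -> forall n x, f n x = x.
Proof.
by move=> /(_ E)[g gP] n x; rewrite gP -[RHS]/(wc_id E n x) gP.
Qed.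

End WcHoms.

(** * Generators of the model *)

Section ModelElements.
Variables (p : nat) (p_pr : prime p) (p_odd : odd p) (b : bool).
Local Notation Z := (Zloc p).
Local Notation W n := (witt p_pr n Z).
Local Notation E := (model_complex p_pr b p_odd).
Implicit Types (n i j : nat).

Lemma model_Vone n i : wc_Vone E n i = model_lambda b (wVone p_pr n i).
Proof. exact: Vone_lambda. Qed.

Lemma Nd_wVone n i : Nd b (wVone p_pr n i) = mkN b n (fun j => if j == i then 1 else 0) 0.
Proof. by rewrite NdE; apply: mkN_ext => j jn; rewrite wdiff_wVone. Qed.

Lemma mkN_sum n (I : Type) (r : seq I) (e : I -> nat -> Z) :
  \sum_(i <- r) mkN b n (e i) 0 = mkN b n (fun j => \sum_(i <- r) e i j) 0.
Proof.
elim: r => [|i r IH].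
  by rewrite big_nil -mkN0; apply: mkN_ext => j _; rewrite big_nil.
by rewrite big_cons IH mkN_D addr0; apply: mkN_ext => j _; rewrite big_cons.
Qed.

Lemma model_sum n (I : Type) (r : seq I) (u : I -> logN p b n) :
  \sum_(i <- r) ((0, u i) : model p_pr b n) = (0, \sum_(i <- r) u i).
Proof.
elim: r => [|i r IH]; first by rewrite !big_nil.
by rewrite !big_cons IH modelD addr0.
Qed.

Lemma model_dVone_sum n (c : nat -> Z) :
  \sum_(i < n) uc E n (c i) * wc_d E n (wc_Vone E n i) = (0, mkN b n c 0).
Proof.
transitivity (\sum_(i < n) ((0, Nact (wconst p_pr n (c i)) (Nd b (wVone p_pr n i)))
    : model p_pr b n)).
  apply: eq_bigr => i _; rewrite model_Vone.
  rewrite -[wc_d E n _]/((0, Nd b _) : model p_pr b n).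
  rewrite -[uc E n _]/((wconst p_pr n (c i), 0) : model p_pr b n).
  by rewrite [LHS]modelM mulr0 Nact0 addr0.
rewrite model_sum; under eq_bigr => i _ do rewrite Nd_wVone NactE mulr0.
rewrite mkN_sum; congr pair; apply: mkN_ext => j jn.
rewrite (bigD1 (Ordinal jn)) //= big1 => [|i ij].
  by rewrite eqxx mulr1 mul0r mul0rn !addr0 gh_wconst.
rewrite mul0r mul0rn addr0 ifN ?mulr0 //.
by apply: contraNneq ij => ji; apply/eqP/val_inj.
Qed.

(** A constant Witt vector has no coordinates of positive index, and the twist uses only those. *)
Lemma model_theta n (t : Z) :
  uc E n t * ((0, mkN b n (fun=> 0) 1) : model p_pr b n) = (0, mkN b n (fun=> 0) t).
Proof.
rewrite -[uc E n _]/((wconst p_pr n t, 0) : model p_pr b n).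
rewrite [LHS]modelM mulr0 Nact0 addr0 NactE mulr1; congr pair.
apply/mkN_eq; split=> [j jn|]; last first.
  case: n => [|n]; first by rewrite muln0 pdvd0.
  by rewrite gh_wconst // subrr rpred0.
rewrite subr0 mulr0 add0r mul1r (_ : twist _ _ = 0) ?mul0rn ?rpred0 //.
by case: j jn => [|[|j]] jn //=; rewrite !wdiff_const ?mulr0 ?addr0 // ltnW.
Qed.

End ModelElements.

(** * The logarithmic structure on the model *)

Section LogModelComplex.
Variables (p : nat) (p_pr : prime p) (p_odd : odd p).
Local Notation Z := (Zloc p).
Local Notation W n := (witt p_pr n Z).
Local Notation N n := (logN p true n).
Local Notation th n t := (mkN true n (fun=> 0 : Z) t).
Local Notation T n x := (teich p_pr n x).
Implicit Types (n i j : nat) (x y : Z) (a : Zloc_nz p).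

Lemma Nd1 b n : Nd b (1 : W n) = 0.
Proof.
rewrite NdE -mkN0; apply/mkN_eq; split=> [[|j] jn|]; first exact: pdvd0.
  by rewrite wdiff1 // subrr rpred0.
by rewrite subrr rpred0.
Qed.

Lemma thD n t t' : th n (t + t') = th n t + th n t'.
Proof. by rewrite mkN_D; apply: mkN_ext => j _; rewrite addr0. Qed.

(** The top ghost component p^(p^(n-1)) vanishes modulo p^n, so only the twist of [p] remains. For p
    = 3 its second term turns the coordinate -1 of dV(1) into the coefficient -p of dV^2(1), as d[p]
    requires. *)
Lemma Nact_teichp n : Nact (T n p%:R) (th n 1) = Nd true (T n p%:R).
Proof.
rewrite NactE NdE; apply/mkN_eq; split=> [[|i] jn|]; first exact: pdvd0; last first.
  rewrite mulr1 subr0; case: n => [|n]; first exact: pdvd0.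
  rewrite gh_teich // -[_ ^+ _]mulr1; apply: pdvd_pX; rewrite // mul1n.
  exact: ltn_expl (prime_gt1 p_pr).
have wE k : (k.+1 < n)%N -> exists z, wdiff (T n p%:R) k.+1 = p%:R ^+ k.+1 * z +
    (if k == 0%N then -1 else if k == 1%N then - (q3 p * p)%:R else 0).
  move=> /(wdiff_teichp_mod p_pr p_odd)/(pdvdP p_pr)[z zE].
  by exists z; rewrite -zE subrK.
rewrite mulr0 add0r mul1r mulr1n /twist; case: i jn => [|[|i]] jn.
- by set x := (X in X \in _); have -> : x = 0; [rewrite /x; ring | exact: rpred0].
- have [z1 ->] := wE 0%N (ltnW jn); have [z2 ->] := wE 1%N jn.
  apply/(pdvdP p_pr); rewrite natrM /= !exprS expr0.
  by exists (- (q3 p)%:R + p%:R * z2 + (q3 p)%:R * z1 - z2); ring.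
- have [z2 ->] := wE i.+2 jn; have [z1 ->] := wE i.+1 (ltnW jn).
  apply/(pdvdP p_pr); rewrite natrM /= !exprS; case: i {jn} => [|i] /=.
    by exists (p%:R ^+ 2 * z2 + (q3 p)%:R * (p%:R * z1 - (q3 p)%:R) - z2); ring.
  exists (p%:R ^+ i.+3 * z2 + (q3 p)%:R * (p%:R ^+ i.+2 * z1) - z2).
  by rewrite !exprS; ring.
Qed.

Lemma Nd_teichpX n v : Nact (T n (p%:R ^+ v)) (th n v%:R) = Nd true (T n (p%:R ^+ v)).
Proof.
elim: v => [|v IH]; first by rewrite expr0 teich1 Nd1 mkN0 raddf0.
rewrite exprS teichM NdM -IH -Nact_teichp -!NactM [_ * (T n p%:R)]mulrC -raddfD /=.
by rewrite -thD -natr1.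
Qed.

(** The logarithmic derivative [x]^(-1) d[x] of a unit x with inverse x'. *)
Definition unit_dlog n x x' : N n := Nact (T n x') (Nd true (T n x)).

Lemma unit_dlogM n x x' y y' : x * x' = 1 -> y * y' = 1 ->
  unit_dlog n (x * y) (x' * y') = unit_dlog n x x' + unit_dlog n y y'.
Proof.
move=> xx' yy'; rewrite /unit_dlog !teichM NdM raddfD /= -!NactM addrC.
congr (_ + _); congr Nact; rewrite -!teichM; congr teich.
  by rewrite -mulrA [y' * y]mulrC yy' mulr1.
by rewrite mulrAC [x' * x]mulrC xx' mul1r.
Qed.

Lemma Znz_factors a : exists t : nat * Z * Z,
  [&& (a : Z) == p%:R ^+ t.1.1 * t.1.2 & t.1.2 * t.2 == 1].
Proof. by apply: (Zloc_factor_ex p_pr); case: a. Qed.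

Definition dlogN n a : N n :=
  let t := xchoose (Znz_factors a) in unit_dlog n t.1.2 t.2 + th n t.1.1%:R.

Lemma dlogN_eq n a v x x' : (a : Z) = p%:R ^+ v * x -> x * x' = 1 ->
  dlogN n a = unit_dlog n x x' + th n v%:R.
Proof.
move=> aE xx'; rewrite /dlogN; move: (xchooseP (Znz_factors a)).
case: (xchoose _) => [[w y] y'] /= /andP[/eqP aE' /eqP yy'].
have [-> xy] := Zloc_factor_uniq p_pr xx' yy' (etrans (esym aE) aE').
suff -> : x' = y' by rewrite xy.
by rewrite -[x']mul1r -yy' -xy mulrAC xx' mul1r.
Qed.

Lemma Znz_factorsP a : exists v x x', (a : Z) = p%:R ^+ v * x /\ x * x' = 1.
Proof.
have [[[v x] x'] /= /andP[/eqP aE /eqP xx']] := Znz_factors a.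
by exists v, x, x'.
Qed.

Lemma dlogN1 n : dlogN n 1%g = 0.
Proof.
rewrite (@dlogN_eq n 1%g 0 1 1) ?expr0 ?mulr1 //.
by rewrite /unit_dlog teich1 Nd1 raddf0 add0r mkN0.
Qed.

Lemma dlogN_M n a a' : dlogN n (a * a')%g = dlogN n a + dlogN n a'.
Proof.
have [v [x [x' [aE xx']]]] := Znz_factorsP a.
have [w [y [y' [aE' yy']]]] := Znz_factorsP a'.
rewrite (dlogN_eq n aE xx') (dlogN_eq n aE' yy').
have aaE : ((a * a')%g : Z) = p%:R ^+ (v + w) * (x * y).
  by rewrite -[LHS]/((a : Z) * (a' : Z)) aE aE' exprD; ring.
have xyE : (x * y) * (x' * y') = 1 by rewrite mulrACA xx' yy' mulr1.
by rewrite (dlogN_eq n aaE xyE) unit_dlogM // natrD thD addrACA.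
Qed.

Lemma NR_dlogN n a : NR (dlogN n.+1 a) = dlogN n a.
Proof.
have [v [x [x' [aE xx']]]] := Znz_factorsP a.
rewrite !(dlogN_eq _ aE xx') raddfD /= NR_act NdR !wittR_teich; congr (_ + _).
exact: NRE.
Qed.

(** On the unit part, [x]^(-p) [x]^(p-1) d[x] = [x]^(-1) d[x]. *)
Lemma NF_dlogN n a : NF (dlogN n.+1 a) = dlogN n a.
Proof.
have [v [x [x' [aE xx']]]] := Znz_factorsP a.
rewrite !(dlogN_eq _ aE xx') raddfD /= NF_act NFd_teich //.
congr (_ + _); last exact: NFE.
rewrite -NactM wittF_teich -!teichX -teichM; congr (Nact (teich _ _ _) _).
have -> : x' ^+ p = x' * x' ^+ p.-1 by rewrite -exprS prednK ?prime_gt0.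
by rewrite -mulrA -exprMn [x' * x]mulrC xx' expr1n mulr1.
Qed.

Lemma Nact_dlogN n a : Nact (T n (a : Z)) (dlogN n a) = Nd true (T n (a : Z)).
Proof.
have [v [x [x' [aE xx']]]] := Znz_factorsP a.
rewrite (dlogN_eq n aE xx') aE teichM raddfD /= -NactM.
rewrite NdM -Nd_teichpX -!NactM; congr (_ + _); last by rewrite mulrC.
by rewrite -mulrA -teichM xx' teich1 mulr1.
Qed.

(** The monoid is that of the log ring itself, so a morphism to E can only be [lwc_mu E] on
    monoids. *)
Definition log_model : log_witt_complex p_pr (Zloc_log p).
Proof.
apply: (@LogWittComplex p p_pr (Zloc_log p) (model_complex p_pr true p_odd) (Zloc_nz p)
  (fun n a => model_lambda true (T n (a : Z))) (fun n a => (0, dlogN n a)) id) => //.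
- by move=> n a a'; rewrite -rmorphM -teichM.
- by move=> n a; rewrite -[LHS]/(model_R _) model_lambdaR wittR_teich.
- by move=> n; rewrite dlogN1.
- by move=> n a a'; rewrite dlogN_M -[RHS]/(_ + _ : model _ _ _) modelD addr0.
- by move=> n a; rewrite -[LHS]/(model_R (0, dlogN n.+1 a)) /model_R /= raddf0 NR_dlogN.
- by move=> n a; rewrite [LHS]modelM mulr0 raddf0 addr0 Nact_dlogN.
- by move=> n a; congr pair; rewrite /= raddf0.
- by move=> n a; rewrite -[LHS]/(model_F (0, dlogN n.+1 a)) /model_F /= raddf0 NF_dlogN.
Defined.

End LogModelComplex.

(** * The map from the logarithmic model to a log Witt complex *)

Section LogModelHom.
Variables (p : nat) (p_pr : prime p) (p_odd : odd p).
Local Notation Z := (Zloc p).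
Local Notation T n x := (teich p_pr n x).
Variable E : log_witt_complex p_pr (Zloc_log p).
Implicit Types (n i j : nat) (x y : Z) (a : Zloc_nz p).

Lemma teichp_dlogp n : wc_lambda E n (T n p%:R) * dlogp E n
  = wc_d E n (wc_lambda E n (T n p%:R)).
Proof.
have := lwc_dlogP n (lwc_mu E (Zloc_nz_p p_pr)).
by rewrite lwc_muP.
Qed.

Let hpart_dlogp n : hpart 1 (dlogp E n) := @lwc_dlog_hpart _ _ _ E n _.
Let wc_F_dlogp n : wc_F E n (dlogp E n.+1) = dlogp E n := @lwc_Fdlog _ _ _ E n _.
Let wc_R_dlogp n : wc_R E n (dlogp E n.+1) = dlogp E n := @lwc_dlogR _ _ _ E n _.
Let wc_d_dlogp n : wc_d E n (dlogp E n) = 0 := @lwc_ddlog _ _ _ E n _.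

Definition log_model_wc_hom : wc_hom (model_complex p_pr true p_odd) E :=
  model_hom p_odd (b := true) hpart_dlogp wc_F_dlogp wc_R_dlogp wc_d_dlogp teichp_dlogp.

Lemma log_model_wc_homE n (x : model p_pr true n) :
  log_model_wc_hom n x = wc_lambda E n x.1 + logN_val (dlogp E) x.2.
Proof. by []. Qed.

Lemma dlog_exp n (a : plr_mon (Zloc_log p)) k :
  lwc_dlog E n (lwc_mu E (a ^+ k)%g) = lwc_dlog E n (lwc_mu E a) *+ k.
Proof.
elim: k => [|k IH]; first by rewrite expg0 lwc_mu1 lwc_dlog1.
by rewrite expgS lwc_muM lwc_dlogM IH mulrS.
Qed.

Lemma val_exp a k : ((a ^+ k)%g : Z) = (a : Z) ^+ k.
Proof. by elim: k => [|k IH]; rewrite ?expg0 // expgS exprS -IH. Qed.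

Lemma log_model_wc_hom_theta n :
  log_model_wc_hom n (0, mkN true n (fun=> 0) 1) = dlogp E n.
Proof.
rewrite log_model_wc_homE raddf0 add0r.
rewrite (logN_valE (b := true) p_odd wc_F_dlogp teichp_dlogp) /Gsum rmorph1 mul1r.
by rewrite big1 ?add0r // => j _; rewrite rmorph0 mul0r.
Qed.

(** Write a = p^v u in the monoid. Since [u] is invertible, [u] dlog u = d[u] forces dlog u =
    [u]^(-1) d[u] in E, as in the model. *)
Lemma log_model_wc_hom_dlog n a :
  log_model_wc_hom n (0, dlogN p_pr n a) = lwc_dlog E n (lwc_mu E a).
Proof.
have [v [x [x' [aE xx']]]] := Znz_factorsP p_pr a.
have x_neq0 : x != 0.
  by apply: contraTneq (oner_neq0 Z) => x0; rewrite negbK -xx' x0 mul0r.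
pose u : plr_mon (Zloc_log p) := MkZlocNz x_neq0.
have auE : a = (Zloc_nz_p p_pr ^+ v * u)%g.
  by apply: val_inj; rewrite [LHS]aE -[RHS]/((_ : Z) * x) val_exp.
rewrite {2}auE lwc_muM lwc_dlogM dlog_exp (dlogN_eq p_pr n aE xx').
have -> : ((0, unit_dlog p_pr n x x' + mkN true n (fun=> 0) v%:R) : model p_pr true n)
    = model_lambda true (T n x') * model_d (model_lambda true (T n x))
      + ((0, mkN true n (fun=> 0) 1) : model p_pr true n) *+ v.
  rewrite modelM model_Mn modelD !mul0rn mulr0 addr0 Nact0 addr0 mkN_Mn.
  by congr (_, _ + _); apply: mkN_ext => j _; rewrite mul0rn.
rewrite raddfD raddfMn /= log_model_wc_hom_theta addrC; congr (_ + _).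
have hl y : log_model_wc_hom n (model_lambda true (T n y)) = wc_lambda E n (T n y).
  exact: wc_map_lambda.
have hd y : log_model_wc_hom n (model_d (model_lambda true (T n y)))
    = wc_d E n (wc_lambda E n (T n y)) by rewrite -hl; apply: wc_mapd.
rewrite [LHS](rmorphM (log_model_wc_hom n)) hl hd.
have := @lwc_dlogP _ _ _ E n (lwc_mu E u); rewrite lwc_muP => <-.
by rewrite mulrA -rmorphM -teichM [x' * _]mulrC xx' teich1 rmorph1 mul1r.
Qed.

Definition log_model_hom : lwc_hom (log_model p_pr p_odd) E.
Proof.
apply: (@LwcHom _ _ _ (log_model p_pr p_odd) E log_model_wc_hom (lwc_mu E)) => //.
- exact: lwc_mu1.
- by move=> a a'; exact: (@lwc_muM _ _ _ E a a').
- move=> n a; rewrite [RHS](@lwc_muP _ _ _ E n a).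
  exact: (wc_map_lambda log_model_wc_hom).
- exact: log_model_wc_hom_dlog.
Defined.

End LogModelHom.

(** * Composition of morphisms of log Witt complexes *)

Section LogHoms.
Variables (p : nat) (p_pr : prime p) (L : prelogRing).
Implicit Types E : log_witt_complex p_pr L.

Definition lwc_comp E1 E2 E3 (g : lwc_hom E2 E3) (f : lwc_hom E1 E2) : lwc_hom E1 E3.
Proof.
apply: (@LwcHom _ _ _ E1 E3 (wc_comp g f)
  (fun a => lwc_map_mon g (lwc_map_mon f a))).
- by rewrite !lwc_map_mon1.
- by move=> a b; rewrite !lwc_map_monM.
- by move=> a; rewrite !lwc_map_mu.
- by move=> n a; rewrite /= !lwc_map_alpha.
- by move=> n a; rewrite /= !lwc_map_dlog.
Defined.

Definition lwc_id E : lwc_hom E E :=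
  @LwcHom _ _ _ E E (wc_id E) id erefl (fun _ _ => erefl) (fun _ => erefl)
    (fun _ _ => erefl) (fun _ _ => erefl).

Lemma lwc_endo_id E (f : lwc_hom E E) : is_log_de_Rham_Witt E -> forall n x, f n x = x.
Proof.
move=> /(_ E)[g gP] n x; rewrite (proj1 (gP f)) -[RHS]/(lwc_id E n x).
by rewrite (proj1 (gP (lwc_id E))).
Qed.

End LogHoms.

(* The theorem is transported along f, which detects relations since M is explicit, and
   along g, whose source M has explicit generators. *)
Section Retract.
Variables (p : nat) (p_pr : prime p) (p_odd : odd p) (b : bool).
Local Notation Z := (Zloc p).
Local Notation W n := (witt p_pr n Z).
Local Notation M := (model_complex p_pr b p_odd).
Variables (E : witt_complex p_pr Z) (f : wc_hom E M) (g : wc_hom M E).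
Hypothesis gfK : forall n x, g n (f n x) = x.
Local Notation dV n i := (wc_d E n (wc_Vone E n i)).
Implicit Types (n i j : nat) (t : Z).

Lemma wc_map_uc (E1 E2 : witt_complex p_pr Z) (h : wc_hom E1 E2) n t :
  h n (uc E1 n t) = uc E2 n t.
Proof. exact: wc_map_lambda. Qed.

Lemma wc_map_dVone_sum (E1 E2 : witt_complex p_pr Z) (h : wc_hom E1 E2) n (e : nat -> Z) :
  h n (\sum_(j < n) uc E1 n (e j) * wc_d E1 n (wc_Vone E1 n j))
  = \sum_(j < n) uc E2 n (e j) * wc_d E2 n (wc_Vone E2 n j).
Proof.
by rewrite raddf_sum /=; apply: eq_bigr => j _; rewrite rmorphM /= wc_map_uc wc_map_dVone.
Qed.

Lemma hpart0_lambda n (x : E n) : hpart 0 x <-> exists a, x = wc_lambda E n a.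
Proof.
split=> [hx|[a ->]]; last exact: wc_lambda_hpart.
have : (f n x).2 = 0 := wc_map_hpart f hx.
case fx : (f n x) => [a u] /= u0; exists a.
by rewrite -[LHS]gfK fx u0; apply: wc_map_lambda.
Qed.

(** In the applications the last generator is 0 without logarithmic poles and dlog[p] with them. *)
Lemma hpart1_sum n (z : E n) : hpart 1 z -> exists (e : nat -> Z) t,
  z = \sum_(j < n) uc E n (e j) * dV n j
      + uc E n t * g n (0, mkN b n (fun=> 0) 1).
Proof.
move=> hz; have : (f n z).1 = 0 := wc_map_hpart f hz.
case fz : (f n z) => [a u] /= a0; move: fz; rewrite {}a0.
elim/mkNP: u => e t fz; exists e, t.
have etE : (0, mkN b n e t) = \sum_(j < n) uc M n (e j) * wc_d M n (wc_Vone M n j)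
    + uc M n t * ((0, mkN b n (fun=> 0) 1) : model p_pr b n).
  rewrite model_dVone_sum model_theta [RHS]modelD mkN_D !addr0 add0r.
  by congr pair; apply: mkN_ext => j _; rewrite addr0.
rewrite -[LHS]gfK fz etE raddfD /= (wc_map_dVone_sum g); congr (_ + _).
by rewrite [LHS](rmorphM (g n)) wc_map_uc.
Qed.

Lemma hpart_ge2 n i (z : E n) : (2 <= i)%N -> hpart i z -> z = 0.
Proof.
case: i => [|[|i]] // _ /(wc_map_hpart f); rewrite -[hpart _ _]/(_ = 0) => fz.
by rewrite -[z]gfK fz raddf0.
Qed.

Lemma lambda_inj n : injective (wc_lambda E n).
Proof.
by move=> a a' /(congr1 (fun x => (f n x).1)); rewrite !wc_map_lambda.
Qed.

Lemma sum_eq0 n (e : nat -> Z) t (th : E n) : f n th = (0, mkN b n (fun=> 0) 1) ->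
  \sum_(j < n) uc E n (e j) * dV n j + uc E n t * th = 0 ->
  (forall j, (j < n)%N -> e j \in pdvd j) /\ t \in pdvd (b * n).
Proof.
move=> fth /(congr1 (f n)); rewrite raddfD raddf0 /= rmorphM /= wc_map_dVone_sum.
rewrite wc_map_uc fth model_dVone_sum model_theta.
rewrite -[LHS]/((_, _) : model p_pr b n) => /(congr1 snd) /=.
rewrite mkN_D -mkN0 => /mkN_eq[ej tn].
split=> [j jn|]; first by have := ej j jn; rewrite addr0 subr0.
by rewrite add0r subr0 in tn.
Qed.

End Retract.

(** * From Z_(p)-coefficients to bases and cyclic summands *)

Section CyclicSums.
Variables (p : nat) (p_pr : prime p).
Local Notation Z := (Zloc p).
Variable E : witt_complex p_pr Z.
Local Notation dV n i := (wc_d E n (wc_Vone E n i)).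
Implicit Types (n i j : nat).

Lemma ucMz n (c : int) (x : E n) : uc E n c%:~R * x = x *~ c.
Proof. by rewrite rmorph_int mulrzl. Qed.

Lemma dVone_sum_shift n (e : nat -> Z) :
  \sum_(j < n) uc E n (e j) * dV n j = \sum_(i < n.-1) uc E n (e i.+1) * dV n i.+1.
Proof.
case: n => [|n]; first by rewrite !big_ord0.
rewrite big_ord_recl dVone0 mulr0 add0r; apply: eq_bigr => i _; by rewrite lift0.
Qed.

Lemma hpartMz n i (x : E n) (c : int) : hpart i x -> hpart i (x *~ c).
Proof. by move=> hx; rewrite -ucMz; apply: hpart0M hx; apply: hpart_uc. Qed.

Lemma cyclic_dVone n :
  (forall x : E n, hpart 1 x ->
    exists e : nat -> Z, x = \sum_(j < n) uc E n (e j) * dV n j) ->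
  (forall e : nat -> Z, \sum_(j < n) uc E n (e j) * dV n j = 0 ->
    forall j, (j < n)%N -> e j \in pdvd j) ->
  cyclic_direct_sum (fun x : E n => hpart 1 x)
    (fun i : 'I_n.-1 => dV n i.+1) (fun i : 'I_n.-1 => p ^ i.+1)%N.
Proof.
move=> gen free; split=> [x|c].
  split=> [/gen[e ->]|[c ->]]; last first.
    by apply: hpart_sum => i _; apply/hpartMz/hpart_dVone.
  have [c cP] := fin_all_exists (fun i : 'I_n.-1 => Zloc_int_mod p_pr i.+1 (e i.+1)).
  exists c; rewrite dVone_sum_shift; apply: eq_bigr => i _.
  by rewrite (uc_cong (dVone_torsion E n i.+1) (cP i)) ucMz.
(* The family c extended to a sequence: c i sits at index i + 1, and all other entries are 0. *)
pose e j : Z := if j is k.+1 then oapp (fun i : 'I_n.-1 => (c i)%:~R) 0 (insub k) else 0.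
have eE (i : 'I_n.-1) : e i.+1 = (c i)%:~R by rewrite /e valK.
have cE : \sum_(i < n.-1) dV n i.+1 *~ c i = \sum_(j < n) uc E n (e j) * dV n j.
  by rewrite dVone_sum_shift; apply: eq_bigr => i _; rewrite eE ucMz.
split=> [c0 i|cP].
  have /free ej : \sum_(j < n) uc E n (e j) * dV n j = 0 by rewrite -cE.
  rewrite -(pdvd_int p_pr) -eE; apply: ej.
  by have := ltn_ord i; lia.
apply: big1 => i _; rewrite -ucMz; apply: (uc_pdvd (dVone_torsion E n i.+1)).
by rewrite (pdvd_int p_pr).
Qed.

Lemma Vone_basis n : injective (wc_lambda E n) ->
  (forall x : E n, hpart 0 x <-> exists a, x = wc_lambda E n a) ->
  forall x : E n, hpart 0 x <->
    exists! c : {ffun 'I_n -> Z}, x = \sum_(i < n) uc E n (c i) * wc_Vone E n i.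
Proof.
move=> linj h0 x; split=> [/h0[a ->]|[c [-> _]]]; last first.
  apply: hpart_sum => i _; apply: hpart0M; first exact: hpart_uc.
  exact: hpart_Vone.
exists [ffun i : 'I_n => wdiff a i]; split=> [|c aE].
  by rewrite (lambda_sum E a (leqnn n)); apply: eq_bigr => i _; rewrite ffunE.
have {aE}-> : a = \sum_(i < n) wconst p_pr n (c i) * wVone p_pr n i.
  apply: linj; rewrite aE raddf_sum /=; apply: eq_bigr => i _.
  by rewrite rmorphM /= Vone_lambda.
apply/ffunP => j; rewrite ffunE wdiff_sum // (bigD1 j) //= big1 => [|i ij].
  by rewrite wdiff_constM // wdiff_wVone // eqxx mulr1 addr0.
rewrite wdiff_constM // wdiff_wVone // ifN ?mulr0 //.
by apply: contraNneq ij => ji; apply/eqP/val_inj.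
Qed.

End CyclicSums.

(** * The initial complexes as retracts of the models *)

Section InitialComplexes.
Variables (p : nat) (p_pr : prime p) (p_odd : odd p).
Local Notation Z := (Zloc p).

(** The composite of g after f is an endomorphism of an initial object, hence the identity. *)
Lemma dRW_retract (Om : witt_complex p_pr Z) : is_de_Rham_Witt Om ->
  exists (f : wc_hom Om (model_complex p_pr false p_odd))
         (g : wc_hom (model_complex p_pr false p_odd) Om),
    (forall n x, g n (f n x) = x) /\
    forall n, g n (0, mkN false n (fun=> 0) 1) = 0.
Proof.
move=> Om_dRW; have [f _] := Om_dRW (model_complex p_pr false p_odd).
pose g := model_hom p_odd (b := false) (theta := fun n => 0 : Om n)
  (fun n => hpart0 _ 1) (fun n => rmorph0 _) (fun n => rmorph0 _)
  (fun n => raddf0 _) (fun n => erefl).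
exists f, g; split=> n; first by move=> x; apply: (wc_endo_id (wc_comp g f) Om_dRW).
(* Without poles t counts only modulo p^0, so the class of (0, 1) is zero. *)
rewrite -[RHS](raddf0 (g n)); congr (g n _); congr pair.
by rewrite -mkN0; apply/mkN_eq; split=> [j _|]; rewrite ?subrr ?rpred0 ?pdvd0.
Qed.

Lemma log_dRW_retract (OmL : log_witt_complex p_pr (Zloc_log p)) :
  is_log_de_Rham_Witt OmL ->
  exists (f : wc_hom OmL (model_complex p_pr true p_odd))
         (g : wc_hom (model_complex p_pr true p_odd) OmL),
    [/\ forall n x, g n (f n x) = x,
        forall n, f n (dlogp OmL n) = (0, mkN true n (fun=> 0) 1)
      & forall n, g n (0, mkN true n (fun=> 0) 1) = dlogp OmL n].
Proof.
move=> OmL_dRW; have [f _] := OmL_dRW (log_model p_pr p_odd).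
pose g := log_model_hom p_odd OmL; exists f, g; split=> n.
- by move=> x; apply: (lwc_endo_id (lwc_comp g f) OmL_dRW).
- rewrite [LHS](lwc_map_dlog f) lwc_map_mu.
  rewrite -[LHS]/(0, dlogN p_pr n (Zloc_nz_p p_pr)); congr pair.
  rewrite (@dlogN_eq _ p_pr n _ 1 1 1) ?mulr1 ?expr1 //.
  by rewrite /unit_dlog teich1 Nd1 raddf0 add0r.
- exact: log_model_wc_hom_theta.
Qed.

End InitialComplexes.

Theorem theorem5p2 (p : nat) (p_pr : prime p) (p_odd : odd p)
    (Om : witt_complex p_pr (Zloc p)) (Om_dRW : is_de_Rham_Witt Om)
    (OmL : log_witt_complex p_pr (Zloc_log p)) (OmL_dRW : is_log_de_Rham_Witt OmL)
    (iota : wc_hom Om OmL) (n : nat) :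
  (* (i) *)
  [/\ (* W_n Omega^0 of the log ring = W_n Omega^0 ~ W_n(Z_(p)) *)
      [/\ forall x, hpart 0 x -> iota n x = 0 -> x = 0,
          forall z : OmL n,
            hpart 0 z <-> exists x, hpart 0 x /\ z = iota n x,
          injective (wc_lambda Om n)
        & forall x : Om n, hpart 0 x <-> exists a, x = wc_lambda Om n a],
      (* W_n Omega^1 of the log ring = W_n Omega^1 (+) Z/p^n dlog[p]_n *)
      (forall z : OmL n, hpart 1 z <->
         exists y (c : int), hpart 1 y /\ z = iota n y + dlogp OmL n *~ c)
      /\ (forall y (c : int), hpart 1 y ->
            iota n y + dlogp OmL n *~ c = 0 <-> y = 0 /\ ((p ^ n)%:Z %| c)%Z),
      forall i (z : OmL n), (2 <= i)%N -> hpart i z -> z = 0,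
      (* W_n Omega^0 = (+)_(0 <= i < n) Z_(p) V^i(1) *)
      exists u : {rmorphism Zloc p -> Om n}, forall x : Om n, hpart 0 x <->
        exists! c : {ffun 'I_n -> Zloc p},
          x = \sum_(i < n) u (c i) * wc_Vone Om n i
    & (* W_n Omega^1 = (+)_(1 <= i < n) Z/p^i dV^i(1) *)
      cyclic_direct_sum (fun x : Om n => hpart 1 x)
        (fun i : 'I_n.-1 => wc_d Om n (wc_Vone Om n i.+1))
        (fun i : 'I_n.-1 => p ^ i.+1)%N]
  /\
  (* (ii) *)
  (let V1 := wc_Vone OmL n in let dV1 i := wc_d OmL n (V1 i) in
   let dlog := dlogp OmL n in
   [/\ forall i j, (i <= j)%N -> V1 i * V1 j = V1 j *+ (p ^ i),
       forall i j, (i < j)%N -> V1 i * dV1 j = dV1 j *+ (p ^ i),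
       forall i j, (j <= i)%N -> V1 i * dV1 j = 0
     & forall i, (1 <= i)%N -> V1 i * dlog =
         if p == 3%N then
           dlog *+ (3 ^ i) + dV1 i *+ (3 ^ (i - 1)) + dV1 i.+1 *+ (3 ^ i)
         else dlog *+ (p ^ i) + dV1 i *+ (p ^ (i - 1))])
  /\
  (* (iii) *)
  (let V1 m := wc_Vone OmL m in let dV1 m i := wc_d OmL m (V1 m i) in
   let dlog := dlogp OmL in
   [/\ forall i, (1 <= i)%N ->
         wc_F OmL n (V1 n.+1 i) = V1 n (i - 1)%N *+ p
         /\ wc_F OmL n (dV1 n.+1 i) = dV1 n (i - 1)%N,
       forall i, wc_V OmL n (V1 n i) = V1 n.+1 i.+1,
       forall i, wc_V OmL n (dV1 n i) = dV1 n.+1 i.+1 *+ p,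
       wc_F OmL n (dlog n.+1) = dlog n
     & wc_V OmL n (dlog n) =
         if p == 3%N then dlog n.+1 *+ 3 + dV1 n.+1 1%N + dV1 n.+1 2%N *+ 3
         else dlog n.+1 *+ p + dV1 n.+1 1%N]).
Proof.
have [f0 [g0 [g0f0 g0th]]] := dRW_retract p_odd Om_dRW.
have [f [g [gf fth gth]]] := log_dRW_retract p_odd OmL_dRW.
pose th := dlogp OmL.
have hth m : hpart 1 (th m) := @lwc_dlog_hpart _ _ _ OmL m _.
have Fth m : wc_F OmL m (th m.+1) = th m := @lwc_Fdlog _ _ _ OmL m _.
have pth m : if true then wc_lambda OmL m (teich p_pr m p%:R) * th m
    = wc_d OmL m (wc_lambda OmL m (teich p_pr m p%:R)) else th m = 0.
  exact: teichp_dlogp.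
have iota_sum m (e : nat -> Zloc p) := wc_map_dVone_sum iota m e.
have dV_eq0 (E : witt_complex p_pr (Zloc p)) (e : nat -> Zloc p) :
    (forall j, (j < n)%N -> e j \in pdvd j) ->
    \sum_(j < n) uc E n (e j) * wc_d E n (wc_Vone E n j) = 0.
  by move=> ej; apply: big1 => j _; apply: (uc_pdvd (dVone_torsion E n j)); apply: ej.
have Om1 (y : Om n) : hpart 1 y -> exists e : nat -> Zloc p,
    y = \sum_(j < n) uc Om n (e j) * wc_d Om n (wc_Vone Om n j).
  by case/(hpart1_sum g0f0)=> e [t ->]; exists e; rewrite g0th mulr0 addr0.
have OmL_free e t := sum_eq0 (e := e) (t := t) (fth n).
split; last split.
- split.
  + split.
    * move=> x /(hpart0_lambda g0f0)[a ->]; rewrite wc_map_lambda.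
      by rewrite -(raddf0 (wc_lambda OmL n)) => /(lambda_inj f) ->; rewrite raddf0.
    * move=> z; split=> [/(hpart0_lambda gf)[a ->]|[x [hx ->]]]; last exact: wc_map_hpart.
      exists (wc_lambda Om n a); split; first exact: wc_lambda_hpart.
      by rewrite wc_map_lambda.
    * by move=> a a'; apply: (lambda_inj f0).
    * by move=> x; apply: (hpart0_lambda g0f0).
  + split=> [z|y c hy].
      split=> [/(hpart1_sum gf)[e [t ->]]|[y [c [hy ->]]]]; last first.
        by apply: hpartD; [apply: wc_map_hpart | apply/hpartMz/hth].
      (* As p^n kills dlog[p], its coefficient may be replaced by an integer. *)
      have [c tc] := Zloc_int_mod p_pr n t.
      exists (\sum_(j < n) uc Om n (e j) * wc_d Om n (wc_Vone Om n j)), c; split.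
        apply: hpart_sum => j _; apply: hpart0M; first exact: hpart_uc.
        exact: hpart_dVone.
      rewrite iota_sum gth -ucMz; congr (_ + _); apply: uc_cong tc.
      by have := theta_torsion (b := true) p_odd Fth pth n; rewrite mul1n.
    split=> [|[-> pc]].
      (* A single relation in the logarithmic complex gives both conclusions: its dV-coefficients
         vanish modulo the p^j, so y = 0, and c vanishes modulo p^n. *)
      have [e ->] := Om1 y hy; rewrite iota_sum -ucMz => /OmL_free[ej].
      by rewrite mul1n (pdvd_int p_pr) => pc; split; first exact: dV_eq0.
    rewrite raddf0 add0r -ucMz; apply: (@uc_pdvd _ _ _ _ n).
      by have := theta_torsion (b := true) p_odd Fth pth n; rewrite mul1n.
    by rewrite (pdvd_int p_pr).
  + by move=> i z; apply: (hpart_ge2 gf).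
  + exists (uc Om n); apply: Vone_basis; first by move=> a a'; apply: (lambda_inj f0).
    by move=> x; apply: (hpart0_lambda g0f0).
  + apply: cyclic_dVone => // e e0.
    (* Independence of the dV^j(1) is tested after [iota], with coefficient 0 on dlog[p]. *)
    have /OmL_free[] // : \sum_(j < n) uc OmL n (e j) * wc_d OmL n (wc_Vone OmL n j)
      + uc OmL n 0 * dlogp OmL n = 0.
    by rewrite -iota_sum e0 raddf0 rmorph0 mul0r addr0.
- split=> [i j|i j|i j|[//|i] _].
  + exact: Vone_mul.
  + exact: Vone_dVone_lt.
  + exact: Vone_dVone_ge.
  + rewrite (Vone_theta Fth) (Vtheta_closed (b := true) p_odd Fth pth) mulr1n.
    rewrite subSS subn0 /q3.
    case: eqP => [p3|_]; last by rewrite mul0n mulr0n addr0.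
    by rewrite mul1n -p3 addrA.
- split=> //.
  + move=> [//|i] _; rewrite subSS subn0; split; last exact: wc_F_dVoneS.
    exact: wc_F_VoneS.
  + by move=> i; apply: wc_V_dVone.
  + rewrite (wc_V_theta (b := true) p_odd Fth pth) mulr1n /q3.
    case: eqP => [p3|_]; last by rewrite mul0n mulr0n addr0.
    by rewrite mul1n addrA -p3.
Qed.
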